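(* Let $X,Y,Z,P$ be Asplund spaces, $K\subset Z$ a closed convex pointed cone with $\operatorname{int}K\ne\emptyset$, $g:X\times P\to Z$ a map, $H:X\times P\rightrightarrows Y$ a set-valued map, $H_p(\cdot)=H(\cdot,p)$, and $S(p)=\{x\in X\mid 0\in H(x,p)\}$. Let $M\subset P$ be nonempty, $\overline{x}\in X$, $L>0$. Suppose: (1) $g$ is $L$-strictly Lipschitz at $\overline{x}$ with respect to $M$: for every $p\in M$ the map $g(\cdot,p)$ is strictly Lipschitz at $\overline{x}$ and there is a neighborhood $U_p$ of $\overline{x}$ with $\|g(x,p)-g(u,p)\|\le L\|x-u\|$ for all $x,u\in U_p$; (2) $\overline{x}$ is a weak solution of ''minimize $g(x,p)$ subject to $0\in H(x,p)$'' with respect to $M$: $\overline{x}\in\bigcap_{p\in M}S(p)$ and for every $p\in M$ there is $\varepsilon_p>0$ such that $g(x,p)-g(\overline{x},p)\notin-\operatorname{int}K$ for all $x\in B(\overline{x},\varepsilon_p)\cap S(p)$; (3) there exist $r>0$ and a neighborhood $V$ of $\overline{x}$ such that $d(x,S(p))\le r\,d(0,H(x,p))$ for all $p\in M$ and all $x\in V$; (4) for every $p\in M$, $H_p$ has closed graph and $H$ is Lipschitz-like around $((\overline{x},p),0)$. Then for every $e\in\operatorname{int}K$ and every $p\in M$ there exist $z^*\in K^*$ with $z^*(e)=1$ and $y^*\in Y^*$ such that \[ 0\in\partial(z^*\circ g(\cdot,p))(\overline{x})+D_N^*H_p(\overline{x},0)(y^* ). \]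
   Context: $K^*=\{z^*\in Z^*\mid z^*(z)\ge0\ \forall z\in K\}$. A function $h:X\to Z$ is strictly Lipschitz at $\overline{x}$ if it is Lipschitz around $\overline{x}$ and there is a neighborhood $V_0$ of $0$ in $X$ such that the sequence $(t_k^{-1}(h(x_k+t_kv)-h(x_k)))_k$ has a norm convergent subsequence whenever $v\in V_0$, $x_k\to\overline{x}$, $t_k\downarrow0$. A multifunction $F:W\rightrightarrows Y$ is Lipschitz-like around $(\overline{w},\overline{y})\in\operatorname{Gr}F$ if there exist $L'>0$ and neighborhoods $U$ of $\overline{w}$, $V$ of $\overline{y}$ with $F(w)\cap V\subset F(u)+L'\|w-u\|\mathbb{D}_Y$ for all $w,u\in U$ ($\mathbb{D}_Y$ the closed unit ball; $X\times P$ carries the sum norm). $d(x,A)=\inf_{a\in A}\|x-a\|$, $d(x,\emptyset)=\infty$. For $\Omega$ in an Asplund space and $\overline{x}\in\Omega$: Fréchet normal cone $\widehat N(\Omega,x)=\{x^*\mid\limsup_{u\to x,u\in\Omega}\frac{x^*(u-x)}{\|u-x\|}\le0\}$; limiting normal cone $N(\Omega,\overline{x})$ is the set of $w^*$-limits of $x_n^*\in\widehat N(\Omega,x_n)$ with $x_n\to\overline{x}$, $x_n\in\Omega$. The limiting subdifferential of $\varphi$ at $\overline{x}$ is $\partial\varphi(\overline{x})=\{x^*\mid(x^*,-1)\in N(\operatorname{epi}\varphi,(\overline{x},\varphi(\overline{x})))\}$. The normal coderivative is $D_N^*F(x,y)(y^* )=\{x^*\mid(x^*,-y^* )\in N(\operatorname{Gr}F,(x,y))\}$.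 *)

(* Defs.v *)
From HB Require Import structures.
From mathcomp Require Import all_boot all_order all_algebra.
From mathcomp Require Import all_classical all_reals all_analysis.
Set Implicit Arguments. Unset Strict Implicit. Unset Printing Implicit Defensive.
Import Order.TTheory GRing.Theory Num.Theory.
Import numFieldNormedType.Exports.
Local Open Scope classical_set_scope.
Local Open Scope ring_scope.

Section VarDefs.
Context {R : realType}.

Definition clin {W : normedModType R} (f : W -> R) : Prop :=
  (forall (a : R) (x y : W), f (a *: x + y) = a * f x + f y) /\ continuous f.

Definition lin_on {W : normedModType R} (S : set W) (f : W -> R) : Prop :=
  forall (a : R) (x y : W), S x -> S y -> f (a *: x + y) = a * f x + f y.

Definition bdd_on {W : normedModType R} (S : set W) (f : W -> R) : Prop :=
  exists C : R, forall y, S y -> `|f y| <= C * `|y|.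

Definition closed_subspace {W : normedModType R} (S : set W) : Prop :=
  S 0 /\ (forall (a : R) x y, S x -> S y -> S (a *: x + y)) /\ closed S.

Definition separable_set {W : normedModType R} (S : set W) : Prop :=
  exists s : nat -> W, (forall n, S (s n)) /\ S `<=` closure (range s).

Definition separable_dual_of {W : normedModType R} (S : set W) : Prop :=
  exists fs : nat -> W -> R,
    (forall n, lin_on S (fs n) /\ bdd_on S (fs n)) /\
    (forall f, lin_on S f -> bdd_on S f -> forall eps : R, 0 < eps ->
       exists n, forall y, S y -> `|f y - fs n y| <= eps * `|y|).

Definition asplund (W : completeNormedModType R) : Prop :=
  forall S : set W, closed_subspace S -> separable_set S -> separable_dual_of S.

Definition cvx_set {W : normedModType R} (K : set W) : Prop :=
  forall (x y : W) (t : R), K x -> K y -> 0 <= t <= 1 -> K (t *: x + (1 - t) *: y).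

Definition is_cone {W : normedModType R} (K : set W) : Prop :=
  forall (t : R) (z : W), 0 <= t -> K z -> K (t *: z).

Definition pointed {W : normedModType R} (K : set W) : Prop :=
  forall z, K z -> K (- z) -> z = 0.

Definition dual_cone {W : normedModType R} (K : set W) : set (W -> R) :=
  [set zs | clin zs /\ forall z, K z -> 0 <= zs z].

Definition lipschitz_near {U V : normedModType R} (h : U -> V) (x : U) (L : R) : Prop :=
  exists N, nbhs x N /\ forall a b, N a -> N b -> `|h a - h b| <= L * `|a - b|.

Definition strictly_lipschitz {U V : normedModType R} (h : U -> V) (xbar : U) : Prop :=
  (exists L : R, lipschitz_near h xbar L) /\
  exists V0, nbhs (0 : U) V0 /\
    forall v, V0 v -> forall (xs : nat -> U) (ts : nat -> R),
      xs @ \oo --> xbar -> (forall k, 0 < ts k) -> ts @ \oo --> (0 : R) ->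
      exists phi : nat -> nat, {homo phi : m n / (m < n)%N} /\
        exists l : V, (fun k => (ts (phi k))^-1 *:
                   (h (xs (phi k) + ts (phi k) *: v) - h (xs (phi k)))) @ \oo --> l.

(** distance, with d(x, emptyset) = +oo *)
Definition dist {W : normedModType R} (x : W) (A : set W) : \bar R :=
  ereal_inf [set (`|x - a|)%:E | a in A].

(** Lipschitz-like (Aubin) property of F : X x P => Y around (wbar, ybar),
    X x P with the sum norm *)
Definition lipschitz_like {X P Y : normedModType R} (F : X -> P -> set Y)
    (wbar : X * P) (ybar : Y) : Prop :=
  exists L' : R, 0 < L' /\ exists (U : set (X * P)) (V : set Y),
    nbhs wbar U /\ nbhs ybar V /\
    forall w u, U w -> U u -> forall y, F w.1 w.2 y -> V y ->
      exists y', F u.1 u.2 y' /\ `|y - y'| <= L' * (`|w.1 - u.1| + `|w.2 - u.2|).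

Definition fnormal {W : normedModType R} (Om : set W) (x : W) : set (W -> R) :=
  [set xs | clin xs /\ forall eps : R, 0 < eps -> exists2 delta : R, 0 < delta &
     forall u, Om u -> `|u - x| < delta -> xs (u - x) <= eps * `|u - x|].

(** limiting normal cone (sequential weak-star limits) *)
Definition lnormal {W : normedModType R} (Om : set W) (x : W) : set (W -> R) :=
  [set ws | clin ws /\ exists (xn : nat -> W) (xsn : nat -> W -> R),
     (forall n, Om (xn n)) /\ xn @ \oo --> x /\
     (forall n, fnormal Om (xn n) (xsn n)) /\
     forall w, (fun n => xsn n w) @ \oo --> ws w].

Definition epi {X : normedModType R} (phi : X -> R) : set (X * R^o) :=
  [set w | phi w.1 <= w.2].

(** limiting subdifferential: (xs, -1) in N(epi phi, (x, phi x)) *)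
Definition lsubdiff {X : normedModType R} (phi : X -> R) (x : X) : set (X -> R) :=
  [set xs | lnormal (epi phi) (x, phi x : R^o) (fun w => xs w.1 - w.2)].

Definition graph {X Y : normedModType R} (F : X -> set Y) : set (X * Y) :=
  [set w | F w.1 w.2].

(** normal coderivative: (xs, -ys) in N(Gr F, (x, y)) *)
Definition coderivN {X Y : normedModType R} (F : X -> set Y) (x : X) (y : Y)
    (ys : Y -> R) : set (X -> R) :=
  [set xs | lnormal (graph F) (x, y) (fun w => xs w.1 - ys w.2)].

Definition solset {X P Y : normedModType R} (H : X -> P -> set Y) (p : P) : set X :=
  [set x | H x p 0].

End VarDefs.

(* Main.v *)
(* Scalarize with the Gerstewitz functional phi z = inf {t | t e - z in K} of e: a
   weak solution minimizes phi (g x p - g xbar p) over S(p), and Clarke's penalization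
   together with the distance estimate makes (xbar, 0) a local minimizer of
   phi (g x p - g xbar p) + c |y| over the graph of H_p.  Approximate Frechet normals at
   this minimizer, to the graph of g(., p) and to that of H_p, give approximate
   multipliers; bounded sequences of functionals on Asplund spaces have weak-star
   convergent subsequences, and strict Lipschitzness of g(., p) kills the contribution
   of zst_k - zst when passing to the limit in the subgradients of <zst_k, g(., p)>.

   Approximate Frechet normals at a minimizer e0 of e |-> s (e0 - e) on a closed set A,
   s sublinear, come from a smooth variational principle.  A normal below s exists at e
   iff no finite nonnegative combination of the slope inequalities it must satisfy
   contradicts s (Hahn-Banach), and that condition is separably determined.  On a
   subspace with separable dual, every bounded sublinear function is a uniform limit of the
   smooth convex functions sup {f x - k rho f | f <= s}, where the penalty
   rho f = sum_j (|f - phi_j| / (1 + |phi_j|))^2 / 2^(j+1) is taken over a dense sequence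
   phi_j of the dual; the Borwein-Preiss principle applied with such approximations of s
   and of the norm yields a point e near e0 at which a smooth convex function is minimal
   over A, hence without contradictory combination. *)
Require Import Defs.
From HB Require Import structures.
From mathcomp Require Import all_boot all_order all_algebra.
From mathcomp Require Import all_classical all_reals all_analysis.
From mathcomp Require Import ring lra.
Set Implicit Arguments. Unset Strict Implicit. Unset Printing Implicit Defensive.
Import Order.TTheory GRing.Theory Num.Theory.
Import numFieldNormedType.Exports.
Local Open Scope classical_set_scope.
Local Open Scope ring_scope.

(** * Sublinear functions and the Hahn-Banach theorem *)

Section ScalarForms.
Context {R : realType} {V : lmodType R}.
Implicit Types (f : V -> R) (x y : V).

Section LinearOnSubset.
Variables (S : set V) (f : V -> R).
Hypothesis S0 : S 0.
Hypothesis f_lin : forall a x y, S x -> S y -> f (a *: x + y) = a * f x + f y.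

Lemma linear_on0 : f 0 = 0.
Proof. by have := f_lin (-1) S0 S0; rewrite scaler0 addr0; lra. Qed.

Lemma linear_onD x y : S x -> S y -> f (x + y) = f x + f y.
Proof. by move=> Sx Sy; have := f_lin 1 Sx Sy; rewrite scale1r mul1r. Qed.

Lemma linear_onZ a x : S x -> f (a *: x) = a * f x.
Proof. by move=> Sx; have := f_lin a Sx S0; rewrite !addr0 linear_on0 addr0. Qed.

Lemma linear_onN x : S x -> f (- x) = - f x.
Proof. by move=> Sx; rewrite -scaleN1r linear_onZ// mulN1r. Qed.

End LinearOnSubset.

Lemma scalar0 f : scalar f -> f 0 = 0.
Proof. by move=> lf; apply: (@linear_on0 setT) => // a x y _ _; exact: lf. Qed.

Lemma scalarD f x y : scalar f -> f (x + y) = f x + f y.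
Proof. by move=> lf; apply: (@linear_onD setT) => // a u v _ _; exact: lf. Qed.

Lemma scalarZ f a x : scalar f -> f (a *: x) = a * f x.
Proof. by move=> lf; apply: (@linear_onZ setT) => // b u v _ _; exact: lf. Qed.

Lemma scalarN f x : scalar f -> f (- x) = - f x.
Proof. by move=> lf; rewrite -scaleN1r scalarZ// mulN1r. Qed.

Lemma scalarB f x y : scalar f -> f (x - y) = f x - f y.
Proof. by move=> lf; rewrite scalarD// scalarN. Qed.

Lemma scalar_opp f : scalar f -> scalar (fun x => - f x).
Proof. by move=> lf a x y; rewrite lf opprD mulrN. Qed.

End ScalarForms.

Section Sublinear.
Context {R : realType}.

Definition sublinear {V : lmodType R} (p : V -> R) : Prop :=
  (forall x y, p (x + y) <= p x + p y) /\
  (forall t x, 0 <= t -> p (t *: x) = t * p x).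

Section Theory.
Context {V : lmodType R}.
Implicit Types (p q : V -> R) (x : V).

Lemma sublinear0 p : sublinear p -> p 0 = 0.
Proof. by case=> _ /(_ 0 0 (lexx _)); rewrite scale0r mul0r. Qed.

Lemma sublinearN_ge p x : sublinear p -> - p (- x) <= p x.
Proof. by move=> sp; have := sp.1 x (- x); rewrite subrr (sublinear0 sp); lra. Qed.

Lemma sublinear_subr p x y : sublinear p -> p x - p y <= p (x - y).
Proof. by move=> sp; have := sp.1 (x - y) y; rewrite subrK; lra. Qed.

Lemma scalar_sublinear p : scalar p -> sublinear p.
Proof. by move=> lp; split=> [x y|t x _]; rewrite ?scalarD ?scalarZ. Qed.

Lemma sublinearD p q : sublinear p -> sublinear q -> sublinear (fun x => p x + q x).
Proof.
move=> sp sq; split=> [x y|t x t0]; last by rewrite sp.2// sq.2// mulrDr.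
by have := sp.1 x y; have := sq.1 x y; lra.
Qed.

Lemma sublinearZ (c : R) p : 0 <= c -> sublinear p -> sublinear (fun x => c * p x).
Proof.
move=> c0 sp; split=> [x y|t x t0]; last by rewrite sp.2// mulrCA.
by rewrite -mulrDr; apply: ler_wpM2l => //; exact: sp.1.
Qed.

Lemma sublinear_comp (W : lmodType R) (p : W -> R) (l : V -> W) :
  sublinear p -> linear l -> sublinear (fun x => p (l x)).
Proof.
move=> sp ll; have lD x y : l (x + y) = l x + l y.
  by have := ll 1 x y; rewrite !scale1r.
have l0 : l 0 = 0 by apply: (addrI (l 0)); rewrite -lD !addr0.
have lZ t x : l (t *: x) = t *: l x by have := ll t x 0; rewrite !addr0 l0 addr0.
by split=> [x y|t x t0]; [rewrite lD; exact: sp.1|rewrite lZ sp.2].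
Qed.

Lemma sublinear_inf (A : V -> set R) : (forall w, has_inf (A w)) ->
  (forall w w' r r', A w r -> A w' r' ->
     exists2 r'', A (w + w') r'' & r'' <= r + r') ->
  (forall t w r, 0 < t -> A w r -> exists2 r'', A (t *: w) r'' & r'' <= t * r) ->
  sublinear (fun w => inf (A w)).
Proof.
move=> Ainf AD AZ.
have infZ_le t w : 0 < t -> inf (A (t *: w)) <= t * inf (A w).
  move=> t0; apply/ler_addgt0Pr => e e0.
  have [r Ar rl] := inf_adherent (divr_gt0 e0 t0) (Ainf w).
  have [r' Ar' r'l] := AZ _ _ _ t0 Ar.
  apply: le_trans (ge_inf (Ainf _).2 Ar') _; apply: le_trans r'l _.
  by rewrite -ler_pdivlMl// mulrDr mulrA mulVf ?gt_eqF// mul1r mulrC ltW.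
split=> [x y|t x].
  apply/ler_addgt0Pr => e e0; have e2 : 0 < e / 2 by lra.
  have [r Ar rl] := inf_adherent e2 (Ainf x).
  have [r' Ar' r'l] := inf_adherent e2 (Ainf y).
  have [r'' Ar'' r''l] := AD _ _ _ _ Ar Ar'.
  by have := ge_inf (Ainf _).2 Ar''; lra.
rewrite le_eqVlt => /predU1P[<-|t0].
  have := infZ_le 2 0 (ltr0n _ _); have := infZ_le 2^-1 0; rewrite !scaler0.
  by rewrite scale0r mul0r => /(_ ltac:(lra)); lra.
apply/eqP; rewrite eq_le infZ_le//=.
have := infZ_le t^-1 (t *: x); rewrite invr_gt0 => /(_ t0).
by rewrite scalerA mulVf ?gt_eqF// scale1r ler_pdivlMl.
Qed.

End Theory.

Section HahnBanach.
Context {V : lmodType R}.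
Implicit Types (p q : V -> R) (x : V) (D : set (R^o * V)).

Definition convex_cone {W : lmodType R} (D : set W) : Prop :=
  [/\ D 0, forall u v, D u -> D v -> D (u + v) &
      forall t u, 0 < t -> D u -> D (t *: u)].

Lemma sublinear_below_cone p D : sublinear p -> convex_cone D ->
  (forall u, D u -> 0 <= u.1 + p (- u.2)) ->
  exists q, [/\ sublinear q, forall x, q x <= p x & forall u, D u -> q u.2 <= u.1].
Proof.
move=> sp [D0 DD DZ] pD.
pose A w := [set u.1 + p (w - u.2) | u in D].
have Ap w : A w (p w) by exists 0 => //=; rewrite subr0 add0r.
have Ainf w : has_inf (A w).
  split; [by exists (p w)|exists (- p (- w)) => _ [u Du <-]].
  by have := pD u Du; have := sp.1 (w - u.2) (- w); rewrite addrAC subrr add0r; lra.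
exists (fun w => inf (A w)); split=> [|w|u Du].
- apply: sublinear_inf => // [w w' _ _ [u Du <-] [u' Du' <-]|t w _ t0 [u Du <-]].
    exists ((u + u').1 + p (w + w' - (u + u').2)); first by exists (u + u'); auto.
    by have := sp.1 (w - u.2) (w' - u'.2); rewrite addrACA -opprD /=; lra.
  exists ((t *: u).1 + p (t *: w - (t *: u).2)); first by exists (t *: u); auto.
  by rewrite /= -scalerBr sp.2 ?(ltW t0)// mulrDr.
- exact: (ge_inf (Ainf w).2 (Ap w)).
- by apply: (ge_inf (Ainf u.2).2); exists u => //; rewrite subrr (sublinear0 sp) addr0.
Qed.

Lemma ray_convex_cone (W : lmodType R) (u : W) :
  convex_cone [set t *: u | t in [set t : R | 0 <= t]].
Proof.
split=> [|_ _ [t /= t0 <-] [t' /= t'0 <-]|t _ t0 [t' /= t'0 <-]].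
- by exists 0; rewrite ?scale0r//= lexx.
- by exists (t + t'); rewrite ?scalerDl//= addr_ge0.
- by exists (t * t'); rewrite ?scalerA//= mulr_ge0// ltW.
Qed.

Lemma minimal_sublinear_scalar q : sublinear q ->
  (forall q', sublinear q' -> (forall x, q' x <= q x) -> forall x, q x <= q' x) ->
  scalar q.
Proof.
move=> sq qmin.
have qN x : q (- x) = - q x.
  have [|q' [sq' q'q q'x]] := sublinear_below_cone sq
      (ray_convex_cone ((- q x : R^o), - x)).
    move=> _ [t /= t0 <-] /=; rewrite -scalerN opprK sq.2// /GRing.scale /=; lra.
  have /= := q'x ((- q x : R^o), - x) (ex_intro2 _ _ 1 ler01 (scale1r _)).
  by have := qmin _ sq' q'q (- x); have := sublinearN_ge x sq; lra.
have qD x y : q (x + y) = q x + q y.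
  have := sublinear_subr (x + y) y sq; have := sq.1 x y.
  by have := sq.1 (x + y) (- y); rewrite addrK qN; lra.
move=> a x y; rewrite qD; congr (_ + _).
have [a0|a0] := leP 0 a; first exact: sq.2.
by rewrite -[a in LHS]opprK scaleNr qN sq.2; lra.
Qed.

Lemma sublinear_chain_inf p (A : set (V -> R)) : A !=set0 ->
  (forall q, A q -> sublinear q /\ forall x, q x <= p x) ->
  (forall q q', A q -> A q' -> (forall x, q x <= q' x) \/ (forall x, q' x <= q x)) ->
  sublinear (fun x => inf [set q x | q in A]) /\
  forall q, A q -> forall x, inf [set q x | q in A] <= q x.
Proof.
move=> [q0 Aq0] Ap Atot.
have Ainf w : has_inf [set q w | q in A].
  split; [by exists (q0 w), q0|exists (- p (- w)) => _ [q /Ap[sq qp] <-]].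
  by have := qp (- w); have := sublinearN_ge w sq; lra.
split; last by move=> q Aq x; apply: (ge_inf (Ainf x).2); exists q.
apply: sublinear_inf => // [w w' _ _ [q Aq <-] [q' Aq' <-]|t w _ t0 [q Aq <-]].
  have [qq'|q'q] := Atot q q' Aq Aq'.
    exists (q (w + w')); first by exists q.
    by apply: le_trans ((Ap _ Aq).1.1 _ _) _; rewrite lerD2l.
  exists (q' (w + w')); first by exists q'.
  by apply: le_trans ((Ap _ Aq').1.1 _ _) _; rewrite lerD2r.
by exists (q (t *: w)); [exists q|rewrite (Ap _ Aq).1.2// ltW].
Qed.

Lemma hahn_banach p : sublinear p -> exists2 f, scalar f & forall x, f x <= p x.
Proof.
move=> sp; pose T := {q : V -> R | sublinear q /\ forall x, q x <= p x}.
pose rel_ge : rel T := fun t t' => `[< forall x, sval t' x <= sval t x >].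
pose below q (sq : sublinear q) (qp : forall x, q x <= p x) : T :=
  exist (fun q => sublinear q /\ forall x, q x <= p x) q (conj sq qp).
pose t0 : T := below p sp (fun=> lexx _).
have [t|t1 t2 t3 /asboolP le21 /asboolP le32|A Atot|t tmin] := @ZL_preorder T t0 rel_ge.
- exact/asboolP.
- by apply/asboolP => x; exact: le_trans (le32 x) (le21 x).
- have [[t1 At1]|A0] := pselect (A !=set0); last first.
    by exists t0 => t At; exfalso; apply: A0; exists t.
  have [|_ [t _ <-]|_ _ [t At <-] [t' At' <-]|sB Ble] :=
      @sublinear_chain_inf p [set sval (t : T) | t in A].
  + by exists (sval t1), t1.
  + exact: svalP t.
  + by have [/asboolP|/asboolP] := Atot t t' At At'; [right|left].
  have Bp x := le_trans (Ble _ (ex_intro2 _ _ t1 At1 erefl) x) ((svalP t1).2 x).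
  exists (below _ sB Bp) => t At; apply/asboolP => x /=.
  by apply: Ble; exists t.
have [st tp] := svalP t; exists (sval t) => //.
apply: minimal_sublinear_scalar => // q sq qt.
have qp x := le_trans (qt x) (tp x).
by apply/asboolP; apply: (tmin (below _ sq qp)); exact/asboolP.
Qed.

Lemma hahn_banach_cone p D : sublinear p -> convex_cone D ->
  (forall u, D u -> 0 <= u.1 + p (- u.2)) ->
  exists f, [/\ scalar f, forall x, f x <= p x & forall u, D u -> f u.2 <= u.1].
Proof.
move=> sp cD pD; have [q [sq qp qD]] := sublinear_below_cone sp cD pD.
have [f lf fq] := hahn_banach sq; exists f; split=> // [x|u Du].
  exact: le_trans (fq x) (qp x).
exact: le_trans (fq _) (qD u Du).
Qed.

Lemma hahn_banach_at p x : sublinear p ->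
  exists f, [/\ scalar f, forall y, f y <= p y & f x = p x].
Proof.
move=> sp; have [|f [lf fp fx]] := hahn_banach_cone sp
    (ray_convex_cone ((- p x : R^o), - x)).
  by move=> _ [t /= t0 <-] /=; rewrite -scalerN opprK sp.2// /GRing.scale /=; lra.
exists f; split=> //; apply/eqP; rewrite eq_le fp/=.
have /= := fx ((- p x : R^o), - x) (ex_intro2 _ _ 1 ler01 (scale1r _)).
by rewrite scalarN// lerN2.
Qed.

Lemma hahn_banach_ext p (S : set V) (f0 : V -> R) : sublinear p -> S 0 ->
  (forall a x y, S x -> S y -> S (a *: x + y)) ->
  (forall a x y, S x -> S y -> f0 (a *: x + y) = a * f0 x + f0 y) ->
  (forall x, S x -> f0 x <= p x) ->
  exists f, [/\ scalar f, forall x, f x <= p x & forall x, S x -> f x = f0 x].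
Proof.
move=> sp S0 Slin f0lin f0p.
have SZ a x : S x -> S (a *: x) by move=> Sx; have := Slin a x 0 Sx S0; rewrite addr0.
have f0Z := linear_onZ S0 f0lin.
pose D := [set ((f0 y : R^o), y) | y in S].
have cD : convex_cone D.
  split=> [|_ _ [y Sy <-] [z Sz <-]|t _ t0 [y Sy <-]].
  - by exists 0; rewrite ?(linear_on0 S0 f0lin).
  - have := Slin 1 y z Sy Sz; rewrite scale1r => Syz.
    by exists (y + z); rewrite ?(linear_onD f0lin).
  - by exists (t *: y); [exact: SZ|rewrite f0Z].
have [|f [lf fp fD]] := hahn_banach_cone sp cD.
  move=> _ [y Sy <-] /=; have := f0p _ (SZ (-1) y Sy).
  by rewrite f0Z// scaleN1r; lra.
have f_le x : S x -> f x <= f0 x by move=> Sx; apply: (fD (f0 x, x)); exists x.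
exists f; split=> // x Sx; apply/eqP; rewrite eq_le f_le//=.
by have := f_le _ (SZ (-1) x Sx); rewrite f0Z// scalarZ//; lra.
Qed.

End HahnBanach.

Section NormedForms.
Context {V : normedModType R}.
Implicit Types f : V -> R.

Definition bounded_form (C : R) f : Prop :=
  scalar f /\ forall x, `|f x| <= C * `|x|.

Lemma norm_sublinear : sublinear (fun x : V => `|x|).
Proof.
by split=> [x y|t x t0]; [exact: ler_normD|rewrite normrZ ger0_norm].
Qed.

Lemma bounded_form_le (C : R) f : scalar f -> (forall x, f x <= C * `|x|) ->
  bounded_form C f.
Proof.
move=> lf fC; split=> // x.
by rewrite ler_norml fC andbT lerNl -(scalarN _ lf) -normrN; exact: fC.
Qed.

Lemma bounded_formW (C C' : R) f : C <= C' -> bounded_form C f -> bounded_form C' f.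
Proof.
by move=> CC' [lf fC]; split=> // x; apply: le_trans (fC x) _; exact: ler_wpM2r.
Qed.

Lemma bounded_form_ub (C : R) f : bounded_form C f -> forall x, f x <= C * `|x|.
Proof. by move=> [_ fC] x; exact: le_trans (ler_norm _) (fC x). Qed.

Lemma bounded_form_clin (C : R) f : bounded_form C f -> clin f.
Proof.
move=> [lf fC]; split=> //; have C0 : 0 < 1 + `|C| by rewrite ltr_wpDr.
move=> x; apply/cvgrPdist_lt => eps e0.
near=> t; rewrite -scalarB//; apply: le_lt_trans (fC _) _.
apply: (@le_lt_trans _ _ ((1 + `|C|) * `|x - t|)).
  by apply: ler_wpM2r => //; rewrite (le_trans (ler_norm C))// lerDr.
rewrite mulrC -ltr_pdivlMr//; near: t.
by apply: (@cvgr_dist_lt _ _ _ (nbhs x)); [exact: cvg_id|rewrite divr_gt0].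
Unshelve. all: by end_near. Qed.

End NormedForms.
End Sublinear.

(** * Closed separable subspaces and Asplund products *)

Section ProductInstances.
Context {R : realType} {U V : completeNormedModType R}.

HB.instance Definition _ := Pointed.on (U * V)%type.

Lemma prod_cauchy_cvg (F : set_system (U * V)) :
  ProperFilter F -> cauchy F -> cvg F.
Proof.
move=> FF Fc.
have cauchy_fst : cauchy (fst @ F).
  move=> A entA; have := prod_entP entA (@entourageT V).
  move=> /Fc[[P Q] /= [FP FQ] PQA]; exists (fst @` P, fst @` Q) => /=.
    by split; [apply: filterS FP|apply: filterS FQ] => x; exists x.
  by move=> [a b] [/= [x Px <-] [y Qy <-]]; have [] := PQA (x, y) (conj Px Qy).
have cauchy_snd : cauchy (snd @ F).
  move=> A entA; have := prod_entP (@entourageT U) entA.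
  move=> /Fc[[P Q] /= [FP FQ] PQA]; exists (snd @` P, snd @` Q) => /=.
    by split; [apply: filterS FP|apply: filterS FQ] => x; exists x.
  by move=> [a b] [/= [x Px <-] [y Qy <-]]; have [] := PQA (x, y) (conj Px Qy).
have cvg_fst : fst @ F --> lim (fst @ F) := cauchy_cvg _ cauchy_fst.
have cvg_snd : snd @ F --> lim (snd @ F) := cauchy_cvg _ cauchy_snd.
apply: (cvgP (lim (fst @ F), lim (snd @ F))).
move=> A [[B1 B2] /= [/cvg_fst FB1 /cvg_snd FB2] BA].
have FB : F (fst @^-1` B1 `&` snd @^-1` B2) by exact: filterI.
by apply: filterS FB => x [Bx1 Bx2]; exact: BA.
Qed.

HB.instance Definition _ := Uniform_isComplete.Build (U * V)%type prod_cauchy_cvg.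

End ProductInstances.

Section ProductForms.
Context {R : realType}.

Section Norms.
Context {V W : normedModType R}.
Implicit Types z : V * W.

Lemma norm_fst z : `|z.1| <= `|z|.
Proof. by rewrite prod_normE le_max lexx. Qed.

Lemma norm_snd z : `|z.2| <= `|z|.
Proof. by rewrite prod_normE le_max lexx orbT. Qed.

Lemma norm_pair_le z (c : R) : `|z.1| <= c -> `|z.2| <= c -> `|z| <= c.
Proof. by move=> z1 z2; rewrite prod_normE ge_max z1. Qed.

Lemma norm_pairx0 (x : V) : `|(x, 0) : V * W| = `|x|.
Proof. by rewrite prod_normE /= normr0 max_l. Qed.

Lemma norm_pair0x (y : W) : `|(0, y) : V * W| = `|y|.
Proof. by rewrite prod_normE /= normr0 max_r. Qed.

End Norms.

Section Forms.
Context {V W : lmodType R}.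
Implicit Types f : V * W -> R.

Lemma scalar_pairE f z : scalar f -> f z = f (z.1, 0) + f (0, z.2).
Proof.
move=> lf; rewrite -scalarD//; congr f.
by apply: injective_projections; rewrite /= ?addr0 ?add0r.
Qed.

Lemma scalar_pair_realE (f : V * R^o -> R) z :
  scalar f -> f z = f (z.1, 0) + z.2 * f (0, 1).
Proof.
move=> lf; have -> : z = (z.2 : R) *: (0, 1) + (z.1, 0) :> V * R^o.
  by apply: injective_projections; rewrite /= ?scaler0 ?add0r ?addr0 ?[_ *: 1]mulr1.
by rewrite lf addrC /= scaler0 add0r addr0 [_ *: 1]mulr1.
Qed.

Lemma scalar_pairx0 f : scalar f -> scalar (fun x => f (x, 0)).
Proof.
move=> lf a x y; rewrite -lf; congr f.
by apply: injective_projections; rewrite //= scaler0 addr0.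
Qed.

Lemma scalar_pair0x f : scalar f -> scalar (fun y => f (0, y)).
Proof.
move=> lf a x y; rewrite -lf; congr f.
by apply: injective_projections; rewrite //= scaler0 addr0.
Qed.

End Forms.

Lemma bounded_form_pairx0 {V W : normedModType R} (C : R) (f : V * W -> R) :
  bounded_form C f -> bounded_form C (fun x => f (x, 0)).
Proof.
move=> [lf fC]; split=> [|x]; first exact: scalar_pairx0.
by rewrite (le_trans (fC _))// norm_pairx0.
Qed.

Lemma bounded_form_pair0x {V W : normedModType R} (C : R) (f : V * W -> R) :
  bounded_form C f -> bounded_form C (fun y => f (0, y)).
Proof.
move=> [lf fC]; split=> [|x]; first exact: scalar_pair0x.
by rewrite (le_trans (fC _))// norm_pair0x.
Qed.

End ProductForms.

Section SeparableSubspaces.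
Context {R : realType} {E : normedModType R}.
Implicit Types (x y : E) (d : nat -> E) (S T : set E).

Lemma closure_normP (A : set E) x :
  closure A x <-> forall eps : R, 0 < eps -> exists2 y, A y & `|x - y| < eps.
Proof.
split=> [clA eps e0|Ax B /nbhs_normP[eps /= e0 xB]].
  have [y [Ay xy]] := clA _ (nbhsx_ballx x eps e0).
  by exists y => //; move: xy; rewrite -ball_normE.
by have [y Ay xy] := Ax _ e0; exists y; split=> //; exact: xB.
Qed.

Fixpoint eval_tree (b : nat -> E) (F : nat -> E -> E -> E)
    (t : GenTree.tree nat) : E :=
  match t with
  | GenTree.Leaf n => b n
  | GenTree.Node n [:: t1; t2] => F n (eval_tree b F t1) (eval_tree b F t2)
  | _ => b 0%N
  end.

Lemma countable_op_closure (b : nat -> E) (F : nat -> E -> E -> E) :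
  exists d, (forall n, exists k, d k = b n) /\
    (forall n i j, exists k, d k = F n (d i) (d j)).
Proof.
pose tr k := odflt (GenTree.Leaf 0%N) (unpickle k).
exists (fun k => eval_tree b F (tr k)); split=> [n|n i j].
  by exists (pickle (GenTree.Leaf n)); rewrite /tr pickleK.
by exists (pickle (GenTree.Node n [:: tr i; tr j])); rewrite {1}/tr pickleK.
Qed.

Lemma ratr_scale_approx (a : R) x (eps : R) : 0 < eps ->
  exists r : rat, `|a *: x - ratr r *: x| <= eps.
Proof.
move=> e0; have x1 : 0 < 1 + `|x| by rewrite ltr_wpDr.
have [r] : exists r : rat, ratr r \in `]a, a + eps / (1 + `|x|)[.
  by apply: rat_in_itvoo; rewrite ltrDl divr_gt0.
rewrite in_itv/= => /andP[ar ra]; exists r.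
rewrite -scalerBl normrZ; apply: (@le_trans _ _ (`|a - ratr r| * (1 + `|x|))).
  by apply: ler_wpM2l => //; rewrite lerDr.
by rewrite -ler_pdivlMr// distrC gtr0_norm; lra.
Qed.

Lemma closed_subspace_closure d :
  (forall (r : rat) i j, exists k, d k = ratr r *: d i + d j) ->
  closed_subspace (closure (range d)).
Proof.
move=> drat; split; last split; last exact: closed_closure.
  have [k kE] := drat (-1) 0%N 0%N; apply: subset_closure; exists k => //.
  by rewrite kE rmorphN1 scaleN1r addNr.
move=> a x y /closure_normP clx /closure_normP cly; apply/closure_normP => eps e0.
have e3 : 0 < eps / 3 by lra.
have a0 : 0 < 1 + `|a| by rewrite ltr_wpDr.
have [_ [i _ <-] xi] := clx _ (divr_gt0 e3 a0).
have [_ [j _ <-] yj] := cly _ e3.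
have [r ri] := ratr_scale_approx a (d i) e3.
have [k kE] := drat r i j; exists (d k); first by exists k.
have -> : a *: x + y - d k =
    a *: (x - d i) + (y - d j) + (a *: d i - ratr r *: d i).
  by rewrite kE scalerBr [RHS]addrAC subrKA addrACA -opprD.
have ax : `|a *: (x - d i)| <= eps / 3.
  rewrite normrZ; apply: (@le_trans _ _ ((1 + `|a|) * `|x - d i|)).
    by apply: ler_wpM2r => //; rewrite lerDr.
  by rewrite mulrC -ler_pdivlMr// ltW.
have := ler_normD (a *: (x - d i) + (y - d j)) (a *: d i - ratr r *: d i).
by have := ler_normD (a *: (x - d i)) (y - d j); lra.
Qed.

Lemma rich_separable_subspace (b : nat -> E) (F : nat -> E -> E) :
  exists d, [/\ forall n, exists k, d k = b n,
    forall n i, exists k, d k = F n (d i),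
    closed_subspace (closure (range d)) & separable_set (closure (range d))].
Proof.
pose F' n x y := if unpickle n is Some t then
  (match t with inl r => ratr r *: x + y | inr m => F m x end) else x.
have [d [db dF]] := countable_op_closure b F'.
exists d; split=> //.
- move=> n i; have [k kE] := dF (pickle (inr n : rat + nat)) i i.
  by exists k; rewrite kE /F' pickleK.
- apply: closed_subspace_closure => r i j.
  have [k kE] := dF (pickle (inl r : rat + nat)) i j.
  by exists k; rewrite kE /F' pickleK.
- by exists d; split=> // n; apply: subset_closure; exists n.
Qed.

Lemma separable_subspace_containing (b : nat -> E) :
  exists T, [/\ closed_subspace T, separable_set T & forall n, T (b n)].
Proof.
have [d [db _ dc ds]] := rich_separable_subspace b (fun=> id).
exists (closure (range d)); split=> // n.
by have [k <-] := db n; apply: subset_closure; exists k.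
Qed.

Section Subspace.
Variable T : set E.
Hypothesis T_sub : closed_subspace T.

Lemma subspaceD x y : T x -> T y -> T (x + y).
Proof. by move=> Tx Ty; have := T_sub.2.1 1 _ _ Tx Ty; rewrite scale1r. Qed.

Lemma subspaceZ (a : R) x : T x -> T (a *: x).
Proof. by move=> Tx; have := T_sub.2.1 a _ _ Tx T_sub.1; rewrite addr0. Qed.

Lemma subspaceN x : T x -> T (- x).
Proof. by move=> Tx; rewrite -scaleN1r; exact: subspaceZ. Qed.

Lemma subspaceB x y : T x -> T y -> T (x - y).
Proof. by move=> Tx Ty; apply: subspaceD => //; exact: subspaceN. Qed.

End Subspace.

End SeparableSubspaces.

Lemma separable_subspace_image {R : realType} {E V : normedModType R} (f : E -> V)
    (S : set E) : separable_set S -> (forall x y, `|f x - f y| <= `|x - y|) ->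
  exists T : set V, [/\ closed_subspace T, separable_set T & forall x, S x -> T (f x)].
Proof.
move=> [s [_ Ss]] f_short.
have [T [Tsub Tsep Ts]] := separable_subspace_containing (f \o s).
exists T; split=> // x /Ss/closure_normP xs; apply: Tsub.2.2.
apply/closure_normP => eps /xs[_ [n _ <-] xn]; exists (f (s n)); first exact: Ts.
exact: le_lt_trans (f_short _ _) xn.
Qed.

Section AsplundSpaces.
Context {R : realType}.

Definition functional {E : normedModType R} (T : set E) (f : E -> R) : Prop :=
  lin_on T f /\ bdd_on T f.

Lemma bounded_form_functional {E : normedModType R} (T : set E) (C : R) f :
  bounded_form C f -> functional T f.
Proof. by move=> [lf fC]; split=> [a x y _ _|]; [exact: lf|exists C => y _]. Qed.

Lemma functional_extension {E : normedModType R} (S : set E) f :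
  closed_subspace S -> functional S f ->
  exists C F, bounded_form C F /\ forall x, S x -> F x = f x.
Proof.
move=> [S0 [Slin _]] [flin [C fC]].
have sC : sublinear (fun x : E => `|C| * `|x|).
  by apply: sublinearZ => //; exact: norm_sublinear.
have f_le x : S x -> f x <= `|C| * `|x|.
  move=> Sx; apply: le_trans (ler_norm _) _; apply: le_trans (fC _ Sx) _.
  by apply: ler_wpM2r => //; exact: ler_norm.
have [F [lF FC FS]] := hahn_banach_ext sC S0 Slin flin f_le.
by exists `|C|, F; split=> //; exact: bounded_form_le.
Qed.

Lemma asplund_real : asplund (R^o : completeNormedModType R).
Proof.
move=> S [S0 _] _.
exists (fun n (y : R^o) => ratr (odflt 0 (unpickle n : option rat)) * (y : R)); split.
  move=> n; split=> [a x y _ _|]; first by rewrite mulrDr mulrCA.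
  by eexists => y _; rewrite normrM.
move=> f flin _ eps e0.
have [c cP] : exists c : R, forall y, S y -> f y = c * (y : R).
  have [[y0 [Sy0 y00]]|S_0] := pselect (exists y : R^o, S y /\ y != 0).
    exists (f y0 / y0) => y Sy.
    have := linear_onZ S0 flin (y / y0) Sy0; rewrite /GRing.scale /= divfK// => ->.
    by rewrite mulrAC [RHS]mulrAC [f y0 * _]mulrC.
  exists 0 => y Sy; have [->|y0] := eqVneq y 0.
    by rewrite (linear_on0 S0 flin) mulr0.
  by exfalso; apply: S_0; exists y.
have [r cr] := ratr_scale_approx c (1 : R^o) e0.
exists (pickle r) => y Sy; rewrite pickleK /= cP// -mulrBl normrM.
by apply: ler_wpM2r => //; move: cr; rewrite -scalerBl /GRing.scale /= mulr1.
Qed.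

Lemma asplund_prod (V W : completeNormedModType R) :
  asplund V -> asplund W -> asplund (V * W)%type.
Proof.
move=> aV aW S Ssub Ssep.
have [S1 [S1s S1p SS1]] : exists T : set V, [/\ closed_subspace T, separable_set T &
    forall z, S z -> T z.1].
  by apply: separable_subspace_image Ssep _ => x y; exact: norm_fst (x - y).
have [S2 [S2s S2p SS2]] : exists T : set W, [/\ closed_subspace T, separable_set T &
    forall z, S z -> T z.2].
  by apply: separable_subspace_image Ssep _ => x y; exact: norm_snd (x - y).
have [f1 [f1P f1d]] := aV _ S1s S1p; have [f2 [f2P f2d]] := aW _ S2s S2p.
pose pr n := odflt (0%N, 0%N) (unpickle n : option (nat * nat)).
exists (fun n z => f1 (pr n).1 z.1 + f2 (pr n).2 z.2); split.
  move=> n; have [l1 [C1 b1]] := f1P (pr n).1; have [l2 [C2 b2]] := f2P (pr n).2.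
  split=> [a x y Sx Sy|]; first by rewrite /= l1 ?l2; auto; ring.
  exists (`|C1| + `|C2|) => y Sy; apply: le_trans (ler_normD _ _) _; rewrite mulrDl.
  have le_abs_mul (C u v : R) : 0 <= u -> u <= v -> C * u <= `|C| * v.
    by move=> u0 uv; apply: le_trans (ler_wpM2r u0 (ler_norm C)) _; exact: ler_wpM2l.
  apply: lerD; [apply: le_trans (b1 _ (SS1 _ Sy)) _|apply: le_trans (b2 _ (SS2 _ Sy)) _].
    by apply: le_abs_mul => //; exact: norm_fst.
  by apply: le_abs_mul => //; exact: norm_snd.
move=> f flin fbd eps e0.
have [C [F [bF FE]]] := functional_extension Ssub (conj flin fbd).
have e2 : 0 < eps / 2 by lra.
have [l1 b1] := bounded_form_functional S1 (bounded_form_pairx0 bF).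
have [l2 b2] := bounded_form_functional S2 (bounded_form_pair0x bF).
have [i iP] := f1d _ l1 b1 _ e2; have [j jP] := f2d _ l2 b2 _ e2.
exists (pickle (i, j)) => y Sy; rewrite /pr pickleK /= -FE// (scalar_pairE y bF.1).
rewrite opprD addrACA; apply: le_trans (ler_normD _ _) _.
have := iP _ (SS1 _ Sy); have := jP _ (SS2 _ Sy).
have : eps / 2 * `|y.1| <= eps / 2 * `|y| by rewrite ler_pM2l// norm_fst.
have : eps / 2 * `|y.2| <= eps / 2 * `|y| by rewrite ler_pM2l// norm_snd.
lra.
Qed.

End AsplundSpaces.

(** * Separable reduction *)

Lemma harmonic_lt {R : realType} (eps : R) : 0 < eps -> exists k, harmonic k < eps.
Proof. by move=> /ltr_add_invr[k]; rewrite add0r; exists k. Qed.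

Lemma harmonic_le1 {R : realType} (k : nat) : harmonic k <= 1 :> R.
Proof. by rewrite invf_le1// ler1n. Qed.

Lemma harmonic_le {R : realType} (k k' : nat) :
  (k <= k')%N -> harmonic k' <= harmonic k :> R.
Proof. by move=> kk'; rewrite lef_pV2 ?posrE// ler_nat. Qed.

Section SeparableReduction.
Context {R : realType} {E : normedModType R}.
Variables (s : E -> R) (C : R).
Hypothesis s_sub : sublinear s.
Hypothesis C_ge0 : 0 <= C.
Hypothesis s_le : forall x, s x <= C * `|x|.

(* An item is a weight, a point of the set, the slope 1/(j+1) allowed for a
   normal functional in the direction of that point and the radius 1/(n+1)
   within which this slope is allowed. *)
Local Notation item := ((R * E) * (nat * nat))%type.
Local Notation coef i := (i.1.1).
Local Notation point i := (i.1.2).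
Local Notation slope i := (harmonic i.2.1).
Local Notation radius i := (harmonic i.2.2).
Implicit Types (A : set E) (a e : E) (l : seq item) (i : item) (m : nat -> nat).

Definition weight l : R := \sum_(i <- l) coef i.
Definition slope_cost a l : R := \sum_(i <- l) coef i * (slope i * `|point i - a|).
Definition displacement a l : E := \sum_(i <- l) coef i *: (point i - a).
Definition cost a l : R := slope_cost a l + s (- displacement a l).

Definition admissible A a (margin : R) l : Prop :=
  forall i, i \in l ->
    [/\ 0 <= coef i, A (point i) & `|point i - a| + margin < radius i].

Definition radii_from m l : Prop := forall i, i \in l -> i.2.2 = m i.2.1.

Definition no_violation A a m : Prop :=
  forall l, radii_from m l -> admissible A a 0 l -> 0 <= cost a l.

Lemma weight_ge0 A a margin l : admissible A a margin l -> 0 <= weight l.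
Proof. by move=> adl; rewrite /weight big_seq; apply: sumr_ge0 => i /adl[]. Qed.

Lemma displacement_shift a a' l :
  displacement a' l = displacement a l + weight l *: (a - a').
Proof.
rewrite /displacement /weight scaler_suml -big_split/=; apply: eq_bigr => i _.
by rewrite -scalerDr subrKA.
Qed.

Lemma cost_shift A a a' margin l : admissible A a margin l ->
  cost a' l <= cost a l + (1 + C) * weight l * `|a - a'|.
Proof.
move=> adl; have w0 := weight_ge0 adl.
have slopeD : slope_cost a' l <= slope_cost a l + weight l * `|a - a'|.
  rewrite /slope_cost /weight mulr_suml -big_split/= big_seq [leRHS]big_seq.
  apply: ler_sum => i /adl[l0 _ _]; rewrite -mulrDr; apply: ler_wpM2l => //.
  have := ler_normD (point i - a) (a - a'); rewrite subrKA => tri.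
  apply: le_trans (ler_wpM2l (harmonic_ge0 _) tri) _.
  by rewrite mulrDr lerD2l ler_piMl// harmonic_le1.
have := s_sub.1 (- displacement a l) (- (weight l *: (a - a'))).
rewrite -opprD -displacement_shift -scalerN s_sub.2//.
have := ler_wpM2l w0 (s_le (- (a - a'))); rewrite normrN /cost; lra.
Qed.

Lemma admissible_shift A a a' margin margin' l : admissible A a margin l ->
  margin' + `|a - a'| <= margin -> admissible A a' margin' l.
Proof.
move=> adl le_margin i /adl[l0 Ai rad]; split=> //.
have := ler_normD (point i - a) (a - a'); rewrite subrKA.
by move: rad; lra.
Qed.

Lemma admissible_margin A a l : admissible A a 0 l ->
  exists2 margin : R, 0 < margin & admissible A a margin l.
Proof.
elim: l => [|i l IH] adl; first by exists 1.
have [|k1 k10 adk1] := IH; first by move=> i' il; apply: adl; rewrite in_cons il orbT.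
have [l0 Ai] := adl i (mem_head _ _); rewrite addr0 => rad.
pose k2 := (radius i - `|point i - a|) / 2.
have k20 : 0 < k2 by rewrite divr_gt0// subr_gt0.
exists (Num.min k1 k2); first by rewrite lt_min k10.
move=> i'; rewrite in_cons => /predU1P[->|/adk1[l'0 Ai' rad']]; split=> //.
  apply: (@le_lt_trans _ _ (`|point i - a| + k2)).
    by rewrite lerD2l ge_min lexx orbT.
  by move: rad; rewrite /k2; lra.
by apply: le_lt_trans rad'; rewrite lerD2l ge_min lexx.
Qed.

Definition violates A a (k : nat) l : Prop :=
  [/\ admissible A a (harmonic k) l, weight l <= k%:R & cost a l < - harmonic k].

Definition reach (k : nat) : R := harmonic k / (1 + (1 + C) * k%:R).

Let reach_denominator_gt0 k : 0 < 1 + (1 + C) * k%:R.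
Proof. by rewrite ltr_wpDr// mulr_ge0// addr_ge0. Qed.

Lemma reach_gt0 k : 0 < reach k.
Proof. exact: divr_gt0 (harmonic_gt0 k) (reach_denominator_gt0 k). Qed.

Lemma reach_le k : reach k <= harmonic k.
Proof. by rewrite ler_pdivrMr// ler_peMr ?harmonic_ge0// lerDl mulr_ge0// addr_ge0. Qed.

Lemma cost_within_reach A a a' margin l k : admissible A a margin l ->
  weight l <= k%:R -> `|a - a'| < reach k -> cost a' l < cost a l + harmonic k.
Proof.
move=> adl wk; rewrite ltr_pdivlMr// => aa'.
apply: le_lt_trans (cost_shift _ adl) _; rewrite ltrD2l; apply: le_lt_trans aa'.
rewrite mulrC ler_wpM2l//; apply: (@le_trans _ _ ((1 + C) * k%:R)); last by rewrite lerDr.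
by rewrite ler_wpM2l// addr_ge0.
Qed.

Lemma violates_nearby A e l : admissible A e 0 l -> cost e l < 0 ->
  exists k, forall a, `|e - a| < reach k -> violates A a k l.
Proof.
move=> adl cl; have [margin margin0 adm] := admissible_margin adl.
have eps0 : 0 < Num.min (margin / 2) (- cost e l / 2).
  by rewrite lt_min !divr_gt0// oppr_gt0.
have [k1] := harmonic_lt eps0; rewrite lt_min => /andP[k1m k1c].
pose k := maxn k1 (Num.bound (weight l)).
have kk1 : harmonic k <= harmonic k1 :> R by rewrite harmonic_le// leq_maxl.
have wk : weight l <= k%:R.
  apply: ltW; apply: lt_le_trans (archi_boundP (weight_ge0 adl)) _.
  by rewrite ler_nat leq_maxr.
exists k => a ea; split=> //.
  by apply: admissible_shift adm _; have := reach_le k; lra.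
by have := cost_within_reach adl wk ea; lra.
Qed.

Lemma violates_persist A a e k l : violates A a k l -> `|a - e| < reach k ->
  admissible A e 0 l /\ cost e l < 0.
Proof.
move=> [adl wk cl] ae; split.
  by apply: admissible_shift adl _; have := reach_le k; lra.
by have := cost_within_reach adl wk ae; lra.
Qed.

(* Only the weights and the points of a violation are chosen; its shape
   (indices and radii) and its margin range over a countable set. *)
Lemma separable_no_violation A (e0 : E) : exists T : set E,
  [/\ closed_subspace T, separable_set T, T e0 &
  forall e m, T e -> no_violation (A `&` T) e m -> no_violation A e m].
Proof.
pose W (a : E) (shape : seq (nat * nat)) (k : nat) : seq item :=
  xget [::] [set l | map snd l = shape /\ violates A a k l].
pose F n a := if (unpickle n : option (seq (nat * nat) * nat * nat)) is
    Some (shape, k, j) then nth 0 [seq point i | i <- W a shape k] j else a.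
have [d [db dF dsub dsep]] := rich_separable_subspace (fun=> e0) F.
exists (closure (range d)); split=> //.
  by have [k <-] := db 0%N; apply: subset_closure; exists k.
move=> e m Te nv l lm adl; rewrite leNgt; apply/negP => cl.
have [k near_e] := violates_nearby adl cl.
have [_ [n0 _ <-] en0] := (closure_normP _ _).1 Te _ (reach_gt0 k).
have [] : [set l' | map snd l' = map snd l /\ violates A (d n0) k l']
    (W (d n0) (map snd l) k).
  by apply: xgetPex; exists l; split=> //; exact: near_e.
set l' := W _ _ _ => shape_l' viol_l'.
have [|adl' cl'] := violates_persist (e := e) viol_l'; first by rewrite distrC.
suff : 0 <= cost e l' by lra.
apply: nv => i il'.
  have /mapP[i' il ->] : i.2 \in map snd l by rewrite -shape_l'; exact: map_f.
  exact: lm.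
have [l0 Ai rad] := adl' i il'; split=> //; split=> //; apply: subset_closure.
pose pts := [seq point i | i <- l'].
have [n nE] := dF (pickle ((map snd l, k), index (point i) pts)) n0.
exists n => //; rewrite nE /F pickleK nth_index//.
exact: (map_f (fun i : item => point i)).
Qed.

Lemma normal_of_no_violation A e m :
  no_violation A e m -> exists2 nu, fnormal A e nu & forall x, nu x <= s x.
Proof.
move=> nv.
pose D := [set ((slope_cost e l : R^o), displacement e l) | l in
  [set l | radii_from m l /\ admissible A e 0 l]].
have cD : convex_cone D.
  split=> [|_ _ [l [lm adl] <-] [l' [lm' adl'] <-]|t _ t0 [l [lm adl] <-]].
  - exists [::]; first by split.
    by rewrite /slope_cost /displacement !big_nil.
  - exists (l ++ l'); last by rewrite /slope_cost /displacement !big_cat.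
    by split=> i; rewrite mem_cat => /orP[]; auto.
  - exists [seq ((t * coef i, point i), i.2) | i <- l].
      split=> _ /mapP[i il ->]/=; first exact: lm.
      by have [l0 Ai rad] := adl i il; rewrite mulr_ge0// ltW.
    rewrite /slope_cost /displacement !big_map; congr pair => /=.
      by rewrite [RHS]/GRing.scale/= mulr_sumr; apply: eq_bigr => i _; rewrite -mulrA.
    by rewrite scaler_sumr; apply: eq_bigr => i _; rewrite scalerA.
have [|nu [lnu nus nuD]] := hahn_banach_cone s_sub cD.
  by move=> _ [l [lm adl] <-]; exact: nv.
have nu_slope j u : A u -> `|u - e| < harmonic (m j) ->
    nu (u - e) <= harmonic j * `|u - e|.
  move=> Au ue; apply: (nuD ((_ : R^o), _)); exists [:: ((1, u), (j, m j))].
    by split=> i; rewrite mem_seq1 => /eqP ->//=; split=> //=; rewrite addr0.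
  by rewrite /slope_cost /displacement !big_seq1/= mul1r scale1r.
exists nu => //; split.
  apply: (bounded_form_clin (C := C)); apply: bounded_form_le => // x.
  exact: le_trans (nus x) (s_le x).
move=> eps /harmonic_lt[j j_eps].
exists (harmonic (m j)) => [|u Au ue]; first exact: harmonic_gt0.
by apply: le_trans (nu_slope j u Au ue) _; apply: ler_wpM2r => //; exact: ltW.
Qed.

End SeparableReduction.

(** * Geometrically weighted series *)

Section WeightedSums.
Context {R : realType}.
Implicit Types (a b : nat -> R).

Definition wseries a : nat -> R := series (fun j => a j / 2 ^+ j.+1).
Definition wsum a : R := limn (wseries a).

Definition bounded_seq a : Prop := exists B : R, forall j, `|a j| <= B.

Lemma bounded_seq_cst (c : R) : bounded_seq (fun=> c).
Proof. by exists `|c|. Qed.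

Lemma bounded_seqD a b : bounded_seq a -> bounded_seq b ->
  bounded_seq (fun j => a j + b j).
Proof.
move=> [A aA] [B bB]; exists (A + B) => j.
by apply: le_trans (ler_normD _ _) _; exact: lerD.
Qed.

Lemma bounded_seqZ (c : R) a : bounded_seq a -> bounded_seq (fun j => c * a j).
Proof.
by move=> [A aA]; exists (`|c| * A) => j; rewrite normrM; exact: ler_wpM2l.
Qed.

Lemma bounded_seq_itv a (B : R) : (forall j, 0 <= a j <= B) -> bounded_seq a.
Proof. by move=> aB; exists B => j; have /andP[a0 ?] := aB j; rewrite ger0_norm. Qed.

Lemma bounded_seq_shift a : bounded_seq a -> bounded_seq (fun j => a j.+1).
Proof. by case=> B aB; exists B. Qed.

Lemma wseriesD a b n :
  wseries (fun j => a j + b j) n = wseries a n + wseries b n.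
Proof.
by rewrite /wseries/series/= -big_split; apply: eq_bigr => j _; rewrite mulrDl.
Qed.

Lemma wseriesZ (c : R) a n : wseries (fun j => c * a j) n = c * wseries a n.
Proof.
by rewrite /wseries/series/= mulr_sumr; apply: eq_bigr => j _; rewrite mulrA.
Qed.

Lemma wseriesS a n : wseries a n.+1 = wseries a n + a n / 2 ^+ n.+1.
Proof. by rewrite /wseries/series/= big_nat_recr. Qed.

Lemma le_wseries a b n : (forall j, a j <= b j) -> wseries a n <= wseries b n.
Proof.
by move=> ab; apply: ler_sum => j _; apply: ler_wpM2r; rewrite ?invr_ge0 ?exprn_ge0.
Qed.

Lemma cvg_wseries_cst (c : R) : wseries (fun=> c) @ \oo --> c.
Proof.
have := @cvg_geometric_series_half R c 0; rewrite expr0 divr1.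
have -> // : (fun k => c / (2 ^ (k + 1))%:R) = (fun k => c / 2 ^+ k.+1) :> (R ^nat).
by apply/funext => k; rewrite addn1 natrX.
Qed.

Lemma cvg_wseries a : bounded_seq a -> wseries a @ \oo --> wsum a.
Proof.
move=> [B aB]; apply: normed_cvg.
apply: (@series_le_cvg _ _ (fun j => B / 2 ^+ j.+1)) => [j|j|j|].
- exact: normr_ge0.
- by rewrite /= divr_ge0 ?exprn_ge0//; exact: le_trans (normr_ge0 _) (aB 0%N).
- rewrite /= normrM [`|_^-1|]ger0_norm ?invr_ge0 ?exprn_ge0//.
  by apply: ler_wpM2r; rewrite ?invr_ge0 ?exprn_ge0.
- by apply/cvg_ex; exists B; exact: cvg_wseries_cst.
Qed.

Lemma div_exp2_le (c : R) j : 0 <= c -> c / 2 ^+ j <= c.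
Proof. by move=> c0; rewrite ler_pdivrMr ?exprn_gt0// ler_peMr// exprn_ege1// ler1n. Qed.

Lemma is_cvg_wseries a : bounded_seq a -> cvgn (wseries a).
Proof. by move=> /cvg_wseries ?; apply/cvg_ex; exists (wsum a). Qed.

Lemma le_wsum a b : bounded_seq a -> bounded_seq b ->
  (forall j, a j <= b j) -> wsum a <= wsum b.
Proof.
move=> ba bb ab; apply: ler_lim; [exact: is_cvg_wseries..|].
by apply: nearW => n; exact: le_wseries.
Qed.

Lemma wsum_cst (c : R) : wsum (fun=> c) = c.
Proof. by apply: cvg_lim => //; exact: cvg_wseries_cst. Qed.

Lemma wsumD a b : bounded_seq a -> bounded_seq b ->
  wsum (fun j => a j + b j) = wsum a + wsum b.
Proof.
move=> ba bb; apply: cvg_lim => //.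
rewrite (funext (wseriesD a b)).
by apply: cvgD; exact: cvg_wseries.
Qed.

Lemma wsumZ (c : R) a : bounded_seq a -> wsum (fun j => c * a j) = c * wsum a.
Proof.
move=> ba; apply: cvg_lim => //; rewrite (funext (wseriesZ c a)).
by apply: cvgM; [exact: cvg_cst|exact: cvg_wseries].
Qed.

Lemma wsum_le_cst a (B : R) : bounded_seq a -> (forall j, a j <= B) -> wsum a <= B.
Proof.
by move=> ba aB; rewrite -[leRHS]wsum_cst le_wsum//; exact: bounded_seq_cst.
Qed.

Lemma wsum_ge0 a : bounded_seq a -> (forall j, 0 <= a j) -> 0 <= wsum a.
Proof.
by move=> ba a0; rewrite -(wsum_cst 0) le_wsum//; exact: bounded_seq_cst.
Qed.

Lemma wsum_shift a : bounded_seq a -> wsum a = a 0 / 2 + wsum (fun j => a j.+1) / 2.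
Proof.
move=> ba; apply: cvg_lim => //; rewrite -cvg_shiftS.
have -> : [sequence wseries a n.+1]_n =
    (fun n => a 0 / 2 + wseries (fun j => a j.+1) n / 2).
  apply/funext => n; rewrite /wseries/series/= big_nat_recl// expr1; congr (_ + _).
  by rewrite mulr_suml; apply: eq_bigr => j _; rewrite exprSr invfM mulrA.
apply: cvgD; first exact: cvg_cst.
by apply: cvgM; [exact/cvg_wseries/bounded_seq_shift|exact: cvg_cst].
Qed.

Lemma wsum_tail_le a (eps C : R) (J : nat) : bounded_seq a -> 0 <= eps ->
  (forall j, (j < J)%N -> a j <= eps) -> (forall j, a j <= C) ->
  wsum a <= eps + C / 2 ^+ J.
Proof.
move=> + eps0; elim: J a => [|J IH] a ba a_eps aC.
  by have := wsum_le_cst ba aC; rewrite expr0 divr1; lra.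
rewrite wsum_shift//; have := a_eps 0%N isT.
have := IH _ (bounded_seq_shift ba) (fun j => a_eps j.+1) (fun j => aC j.+1).
by rewrite exprSr invfM mulrA; lra.
Qed.

Lemma wseries_le_wsum a n : bounded_seq a -> (forall j, 0 <= a j) ->
  wseries a n <= wsum a.
Proof.
move=> ba a0; apply: nondecreasing_cvgn_le; last exact: is_cvg_wseries.
by apply/nondecreasing_seqP => k; rewrite wseriesS lerDl divr_ge0// exprn_ge0.
Qed.

Lemma wseries_cst_le (c : R) n : 0 <= c -> wseries (fun=> c) n <= c.
Proof.
by move=> c0; rewrite -[leRHS]wsum_cst wseries_le_wsum//; exact: bounded_seq_cst.
Qed.

Lemma wseries_dist_le a b n (c : R) : 0 <= c ->
  (forall j, `|a j - b j| <= c) -> `|wseries a n - wseries b n| <= c.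
Proof.
move=> c0 abc.
have half u v : (forall j, `|u j - v j| <= c) -> wseries u n <= wseries v n + c.
  move=> uvc; apply: le_trans (lerD (lexx _) (wseries_cst_le n c0)).
  by rewrite -wseriesD; apply: le_wseries => j; have := ler_normlW (uvc j); lra.
rewrite ler_distl lerBlDr; apply/andP; split; apply: half => j //.
by rewrite distrC.
Qed.

Lemma wsum_le_of_wseries a (B : R) : bounded_seq a ->
  (forall n, wseries a n <= B) -> wsum a <= B.
Proof. by move=> ba aB; apply: limr_le; [exact: is_cvg_wseries|exact: nearW]. Qed.

Lemma wsum_term_le a j : bounded_seq a -> (forall j, 0 <= a j) ->
  a j / 2 ^+ j.+1 <= wsum a.
Proof.
move=> ba a0; apply: le_trans (wseries_le_wsum j.+1 ba a0).
by rewrite wseriesS lerDr sumr_ge0// => k _; rewrite divr_ge0// exprn_ge0.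
Qed.

End WeightedSums.

(** * Functionals on a subspace and their limits *)

Section Limits.
Context {R : realType}.

Lemma le_cvg_to (I : topologicalType) (F : set_system I) {FF : ProperFilter F}
    (u v : I -> R) (a b : R) :
  u @ F --> a -> v @ F --> b -> (forall i, u i <= v i) -> a <= b.
Proof. by move=> ua vb uv; apply: (ler_cvg_to ua vb); exact: nearW. Qed.

Lemma norm_cvg_le (I : topologicalType) (F : set_system I) {FF : ProperFilter F}
    (u : I -> R) (a c : R) : u @ F --> a -> (forall i, `|u i| <= c) -> `|a| <= c.
Proof. by move=> ua uc; exact: (le_cvg_to (cvg_norm ua) (cvg_cst c) uc). Qed.

Lemma cvg_of_dist_le (I : Type) (F : set_system I) {FF : Filter F}
    (V : normedModType R) (u v : I -> V) (l : V) (C : R) (d : I -> R) :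
  v @ F --> l -> d @ F --> (0 : R) -> (forall i, `|u i - v i| <= C * d i) -> u @ F --> l.
Proof.
move=> vl d0 uv; rewrite -[l]addr0.
have -> : u = (fun i => v i + (u i - v i)).
  by apply/funext => i; rewrite addrC subrK.
apply: cvgD => //; apply/norm_cvg0P.
apply: (@squeeze_cvgr _ _ _ _ (fun=> 0) (fun i => C * d i)).
- by apply: nearW => i; rewrite normr_ge0 uv.
- exact: cvg_cst.
- by rewrite -(mulr0 C); apply: cvgM => //; exact: cvg_cst.
Qed.

Lemma cvg_dist0 (I : Type) (F : set_system I) {FF : Filter F} (V : normedModType R)
    (u : I -> V) (l : V) : u @ F --> l -> (fun i => `|u i - l|) @ F --> (0 : R).
Proof.
by move=> ul; apply/norm_cvg0P; rewrite -(subrr l); apply: cvgB => //; exact: cvg_cst.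
Qed.

Lemma free_ultrafilter : exists U : set_system nat, UltraFilter U /\ \oo `<=` U.
Proof. exact: ultraFilterLemma. Qed.

Lemma ultra_cvg (I : topologicalType) (U : set_system I) (a : I -> R) (B : R) :
  UltraFilter U -> (forall i, `|a i| <= B) -> exists l : R, a @ U --> l.
Proof.
move=> UU aB; have [|l [_ al]] := @segment_compact R (- B) B (a @ U) _.
  by rewrite /= nbhs_simpl; apply: filterE => i; rewrite /= in_itv/= -ler_norml.
exists l => A lA; have [//|UC] := in_ultra_setVsetC (a @^-1` A) UU.
by have [r []] := al (~` A) A UC lA.
Qed.

Lemma cvg_wseries_pointwise (I : topologicalType) (F : set_system I) {FF : ProperFilter F}
    (a : I -> nat -> R) (b : nat -> R) n :
  (forall j, (fun i => a i j) @ F --> b j) ->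
  (fun i => wseries (a i) n) @ F --> wseries b n.
Proof.
move=> ab; elim: n => [|n IH].
  have wseries0 (c : nat -> R) : wseries c 0 = 0 by rewrite /wseries/series/= big_nil.
  by rewrite wseries0 (funext (fun i => wseries0 (a i))); exact: cvg_cst.
rewrite wseriesS (funext (fun i => wseriesS (a i) n)).
by apply: cvgD => //; apply: cvgM => //; exact: cvg_cst.
Qed.

Lemma bounded_form_cvg (I : topologicalType) (F : set_system I) {FF : ProperFilter F}
    (E : normedModType R) (fn : I -> E -> R) (f : E -> R) (C : R) :
  (forall i, bounded_form C (fn i)) -> (forall x, (fun i => fn i x) @ F --> f x) ->
  bounded_form C f.
Proof.
move=> bfn ff; split=> [a x y|x]; last first.
  by apply: norm_cvg_le (ff x) _ => i; exact: (bfn i).2.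
apply: (cvg_unique (@norm_hausdorff _ _) (ff _)).
rewrite (funext (fun i => (bfn i).1 a x y)).
by apply: cvgD => //; apply: cvgM => //; exact: cvg_cst.
Qed.

End Limits.

Section DualNorm.
Context {R : realType} {E : normedModType R}.
Variable T : set E.
Implicit Types (f g : E -> R) (x y : E).
Hypothesis T_sub : closed_subspace T.

Lemma functional0 f : functional T f -> f 0 = 0.
Proof. by case=> lf _; exact: linear_on0 T_sub.1 lf. Qed.

Lemma functionalD f x y : functional T f -> T x -> T y -> f (x + y) = f x + f y.
Proof. by case=> lf _; exact: linear_onD lf x y. Qed.

Lemma functionalZ f a x : functional T f -> T x -> f (a *: x) = a * f x.
Proof. by case=> lf _; exact: linear_onZ T_sub.1 lf a x. Qed.

Lemma functionalN f x : functional T f -> T x -> f (- x) = - f x.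
Proof. by case=> lf _; exact: linear_onN T_sub.1 lf x. Qed.

Lemma functional_comb f g (a b : R) : functional T f -> functional T g ->
  functional T (fun y => a * f y + b * g y).
Proof.
move=> ff fg; split=> [c x y Tx Ty|]; first by rewrite ff.1// fg.1//; ring.
have [[_ [A fA]] [_ [B gB]]] := (ff, fg).
exists (`|a| * A + `|b| * B) => y Ty.
apply: le_trans (ler_normD _ _) _; rewrite !normrM mulrDl -!mulrA.
by apply: lerD; apply: ler_wpM2l => //; [exact: fA|exact: gB].
Qed.

Definition dual_norm f : R := sup [set `|f y| | y in [set y | T y /\ `|y| <= 1]].

Lemma dual_norm_has_sup f : functional T f ->
  has_sup [set `|f y| | y in [set y | T y /\ `|y| <= 1]].
Proof.
move=> [_ [B fB]]; split.
  by exists `|f 0|, 0 => //=; rewrite normr0; split=> //; exact: T_sub.1.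
exists `|B| => _ [y [Ty y1] <-]; apply: le_trans (fB _ Ty) _.
apply: (@le_trans _ _ (`|B| * `|y|)); last by rewrite ler_piMr.
by apply: ler_wpM2r => //; exact: ler_norm.
Qed.

Lemma dual_norm_ge0 f : functional T f -> 0 <= dual_norm f.
Proof.
move=> ff; apply: le_trans (normr_ge0 (f 0)) _.
apply: ub_le_sup; first exact: (dual_norm_has_sup ff).2.
by exists 0 => //=; rewrite normr0; split=> //; exact: T_sub.1.
Qed.

Lemma le_dual_norm f y : functional T f -> T y -> `|f y| <= dual_norm f * `|y|.
Proof.
move=> ff Ty; have [->|y0] := eqVneq y 0; first by rewrite (functional0 ff) !normr0 mulr0.
have yp : 0 < `|y| by rewrite normr_gt0.
have : `|f (`|y|^-1 *: y)| <= dual_norm f.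
  apply: ub_le_sup; first exact: (dual_norm_has_sup ff).2.
  exists (`|y|^-1 *: y) => //=; split; first exact: subspaceZ.
  by rewrite normrZ normfV normr_id mulVf// gt_eqF.
by rewrite functionalZ// normrM normfV normr_id mulrC ler_pdivrMr.
Qed.

Lemma dual_norm_le f (B : R) : 0 <= B ->
  (forall y, T y -> `|f y| <= B * `|y|) -> dual_norm f <= B.
Proof.
move=> B0 fB; apply: ge_sup.
  by exists `|f 0|, 0 => //=; rewrite normr0; split=> //; exact: T_sub.1.
by move=> _ [y [Ty y1] <-]; apply: le_trans (fB _ Ty) _; rewrite ler_piMr.
Qed.

Lemma dual_norm_comb f g (a b : R) : functional T f -> functional T g ->
  dual_norm (fun y => a * f y + b * g y) <= `|a| * dual_norm f + `|b| * dual_norm g.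
Proof.
move=> ff fg; apply: dual_norm_le => [|y Ty].
  by rewrite addr_ge0 ?mulr_ge0 ?dual_norm_ge0.
apply: le_trans (ler_normD _ _) _; rewrite !normrM mulrDl -!mulrA.
by apply: lerD; apply: ler_wpM2l => //; exact: le_dual_norm.
Qed.

Lemma functional_sub f g : functional T f -> functional T g ->
  functional T (fun y => f y - g y).
Proof.
move=> ff fg; have := functional_comb 1 (-1) ff fg.
by congr (functional T _); apply/funext => y; rewrite mul1r mulN1r.
Qed.

Lemma dual_norm_sub f g : functional T f -> functional T g ->
  dual_norm (fun y => f y - g y) <= dual_norm f + dual_norm g.
Proof.
move=> ff fg; have := dual_norm_comb 1 (-1) ff fg; rewrite normrN normr1 !mul1r.
by congr (dual_norm _ <= _); apply/funext => y; rewrite mul1r mulN1r.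
Qed.

Lemma functional_le f (B : R) : 0 <= B -> lin_on T f ->
  (forall y, T y -> f y <= B * `|y|) -> functional T f /\ dual_norm f <= B.
Proof.
move=> B0 lf fB.
have fB' y : T y -> `|f y| <= B * `|y|.
  move=> Ty; rewrite ler_norml fB// andbT lerNl.
  by rewrite -(linear_onN T_sub.1 lf Ty) -normrN; apply: fB; exact: subspaceN.
by split; [split=> //; exists B|exact: dual_norm_le].
Qed.

Lemma functional_cvg (I : topologicalType) (F : set_system I) {FF : ProperFilter F}
    (fn : I -> E -> R) f (B : R) :
  (forall i, functional T (fn i)) -> (forall i, dual_norm (fn i) <= B) ->
  (forall y, T y -> (fun i => fn i y) @ F --> f y) -> functional T f.
Proof.
move=> ffn fnB cf; split=> [a x y Tx Ty|]; last first.
  exists B => y Ty; apply: norm_cvg_le (cf y Ty) _ => i.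
  by apply: le_trans (le_dual_norm (ffn i) Ty) _; exact: ler_wpM2r.
apply: (cvg_unique (@norm_hausdorff _ _) (cf _ (T_sub.2.1 a _ _ Tx Ty))).
rewrite (funext (fun i => (ffn i).1 a x y Tx Ty)).
by apply: cvgD; [apply: cvgM; [exact: cvg_cst|exact: cf]|exact: cf].
Qed.

Lemma dual_norm_lsc (I : topologicalType) (F : set_system I) {FF : ProperFilter F}
    (fn : I -> E -> R) f (l : R) :
  (forall i, functional T (fn i)) -> (forall y, T y -> (fun i => fn i y) @ F --> f y) ->
  (fun i => dual_norm (fn i)) @ F --> l -> dual_norm f <= l.
Proof.
move=> ffn cf cl; apply: dual_norm_le => [|y Ty].
  by apply: le_cvg_to (cvg_cst 0) cl _ => i; exact: dual_norm_ge0.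
have cly : (fun i => dual_norm (fn i) * `|y|) @ F --> l * `|y|.
  by apply: cvgM => //; exact: cvg_cst.
by apply: le_cvg_to (cvg_norm (cf y Ty)) cly _ => i; exact: le_dual_norm.
Qed.

Lemma ultra_functional (I : topologicalType) (U : set_system I) (fn : I -> E -> R)
    (B : R) : UltraFilter U -> (forall i, functional T (fn i)) ->
  (forall i, dual_norm (fn i) <= B) ->
  exists2 f, functional T f & forall y, T y -> (fun i => fn i y) @ U --> f y.
Proof.
move=> UU ffn fnB.
have /choice[f cf] : forall y, exists l : R, T y -> (fun i => fn i y) @ U --> l.
  move=> y; have [Ty|nTy] := pselect (T y); last by exists 0.
  have [|l fl] := @ultra_cvg _ _ _ (fun i => fn i y) (B * `|y|) UU; last by exists l.
  by move=> i; apply: le_trans (le_dual_norm (ffn i) Ty) _; exact: ler_wpM2r.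
by exists f => //; exact: functional_cvg ffn fnB cf.
Qed.

End DualNorm.

(** * Smooth convex approximation on a subspace with separable dual *)

Section ConvexSmooth.
Context {R : realType} {E : normedModType R}.
Variable T : set E.
Hypothesis T_sub : closed_subspace T.
Implicit Types (k : E -> R) (x : E).

Definition convex_on k : Prop := forall x y (t : R), T x -> T y ->
  0 <= t -> t <= 1 -> k (t *: x + (1 - t) *: y) <= t * k x + (1 - t) * k y.

Definition smooth_at k x : Prop := forall eps : R, 0 < eps ->
  exists2 delta : R, 0 < delta & forall u, T u -> `|u| < delta ->
    k (x + u) + k (x - u) - 2 * k x <= eps * `|u|.

Definition smooth_approximation (s : E -> R) (eta : R) k : Prop :=
  [/\ forall x, T x -> s x - eta <= k x <= s x,
      forall x u, T x -> T u -> k (x + u) <= k x + s u,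
      convex_on k & forall x, T x -> smooth_at k x].

Lemma convex_onD k k' : convex_on k -> convex_on k' ->
  convex_on (fun x => k x + k' x).
Proof.
by move=> ck ck' x y t Tx Ty t0 t1; have := ck x y t Tx Ty t0 t1;
  have := ck' x y t Tx Ty t0 t1; lra.
Qed.

Lemma convex_onZ (c : R) k : 0 <= c -> convex_on k -> convex_on (fun x => c * k x).
Proof.
move=> c0 ck x y t Tx Ty t0 t1.
by have := ler_wpM2l c0 (ck x y t Tx Ty t0 t1); lra.
Qed.

Lemma convex_on_reflect (a : E) k : T a -> convex_on k -> convex_on (fun x => k (a - x)).
Proof.
move=> Ta ck x y t Tx Ty t0 t1.
have -> : a - (t *: x + (1 - t) *: y) = t *: (a - x) + (1 - t) *: (a - y).
  by rewrite !scalerBr addrACA -opprD -scalerDl [t + _]addrC subrK scale1r.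
by apply: ck => //; exact: subspaceB.
Qed.

Lemma smooth_atD k k' x : smooth_at k x -> smooth_at k' x ->
  smooth_at (fun x => k x + k' x) x.
Proof.
move=> sk sk' eps e0; have e2 : 0 < eps / 2 by lra.
have [d d0 dP] := sk _ e2; have [d' d'0 d'P] := sk' _ e2.
exists (Num.min d d') => [|u Tu]; first by rewrite lt_min d0.
by rewrite lt_min => /andP[/(dP u Tu) ? /(d'P u Tu)]; lra.
Qed.

Lemma smooth_atZ (c : R) k x : 0 <= c -> smooth_at k x ->
  smooth_at (fun x => c * k x) x.
Proof.
move=> c0 sk eps e0; have c1 : 0 < 1 + c by lra.
have [d d0 dP] := sk _ (divr_gt0 e0 c1); exists d => // u Tu /(dP u Tu) ku.
apply: (@le_trans _ _ (c * (eps / (1 + c) * `|u|))).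
  by have := ler_wpM2l c0 ku; lra.
rewrite mulrA; apply: ler_wpM2r => //; rewrite mulrCA ler_piMr ?(ltW e0)//.
by rewrite ler_pdivrMr//; lra.
Qed.

Lemma smooth_at_reflect (a x : E) k : smooth_at k (a - x) ->
  smooth_at (fun x => k (a - x)) x.
Proof.
move=> sk eps e0; have [d d0 dP] := sk eps e0; exists d => // u Tu ud.
have -> : a - (x - u) = a - x + u by rewrite opprB addrA addrAC.
by rewrite opprD addrA; have := dP u Tu ud; lra.
Qed.

Lemma smooth_at_cst (c : R) x : smooth_at (fun=> c) x.
Proof.
move=> eps e0; exists 1 => // u _ _.
by rewrite mulr_natl mulr2n subrr mulr_ge0// ltW.
Qed.

Lemma convex_on_cst (c : R) : convex_on (fun=> c).
Proof. by move=> x y t *; lra. Qed.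

End ConvexSmooth.

Section SmoothApproximation.
Context {R : realType} {E : normedModType R}.
Variables (T : set E) (phis : nat -> E -> R) (s : E -> R) (C k : R).
Hypothesis T_sub : closed_subspace T.
Hypothesis phis_functional : forall n, functional T (phis n).
Hypothesis phis_dense : forall f, functional T f -> forall eps : R, 0 < eps ->
  exists n, forall y, T y -> `|f y - phis n y| <= eps * `|y|.
Hypothesis s_sub : sublinear s.
Hypothesis C_ge0 : 0 <= C.
Hypothesis s_le : forall x, s x <= C * `|x|.
Hypothesis k_gt0 : 0 < k.
Implicit Types (f g : E -> R) (x y : E) (j : nat).

Local Notation dnorm := (dual_norm T).

Definition minorant f : Prop := lin_on T f /\ forall y, T y -> f y <= s y.

Definition midpoint f g : E -> R := fun y => 2^-1 * f y + 2^-1 * g y.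

Definition dist_ratio f j : R :=
  dnorm (fun y => f y - phis j y) / (1 + dnorm (phis j)).

Definition penalty f : R := wsum (fun j => dist_ratio f j ^+ 2).

Definition penalized f x : R := f x - k * penalty f.

Definition envelope x : R := sup [set penalized f x | f in minorant].

Lemma minorant_le f y : minorant f -> T y -> f y <= C * `|y|.
Proof. by move=> mf Ty; exact: le_trans (mf.2 y Ty) (s_le y). Qed.

Lemma minorant_functional f : minorant f -> functional T f.
Proof.
move=> mf; apply: (functional_le T_sub C_ge0 mf.1 _).1 => y; exact: minorant_le.
Qed.

Lemma minorant_norm_le f : minorant f -> dnorm f <= C.
Proof.
move=> mf; apply: (functional_le T_sub C_ge0 mf.1 _).2 => y; exact: minorant_le.
Qed.

Lemma minorant_midpoint f g : minorant f -> minorant g -> minorant (midpoint f g).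
Proof.
move=> [lf fs] [lg gs]; split=> [a x y Tx Ty|y Ty].
  by rewrite /midpoint lf// lg//; ring.
by have := fs y Ty; have := gs y Ty; rewrite /midpoint; lra.
Qed.

Lemma minorant_at x : exists2 f, minorant f & f x = s x.
Proof.
have [f [lf fs fx]] := hahn_banach_at x s_sub.
by exists f => //; split=> [a y z _ _|y _]; [exact: lf|exact: fs].
Qed.

Let scale_gt0 j : 0 < 1 + dnorm (phis j).
Proof. by rewrite ltr_wpDr// dual_norm_ge0. Qed.

Let diff_functional f j : functional T f -> functional T (fun y => f y - phis j y).
Proof. by move=> ff; exact: functional_sub. Qed.

Lemma dist_ratio_ge0 f j : functional T f -> 0 <= dist_ratio f j.
Proof.
move=> ff; apply: divr_ge0; last exact: ltW.
by apply: dual_norm_ge0 => //; exact: diff_functional.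
Qed.

Lemma dist_ratio_le f j : minorant f -> dist_ratio f j <= 1 + C.
Proof.
move=> mf; have ff := minorant_functional mf; rewrite ler_pdivrMr//.
have := dual_norm_sub T_sub ff (phis_functional j); have := minorant_norm_le mf.
have : 0 <= C * dnorm (phis j) by rewrite mulr_ge0// dual_norm_ge0.
lra.
Qed.

Lemma dist_ratio_sq_itv f j : minorant f -> 0 <= dist_ratio f j ^+ 2 <= (1 + C) ^+ 2.
Proof.
move=> mf; rewrite sqr_ge0 lerXn2r ?nnegrE ?dist_ratio_le ?addr_ge0//.
exact/dist_ratio_ge0/minorant_functional.
Qed.

Lemma bounded_dist_ratio f : minorant f -> bounded_seq (fun j => dist_ratio f j ^+ 2).
Proof.
by move=> mf; apply: (bounded_seq_itv (B := (1 + C) ^+ 2)) => j; exact: dist_ratio_sq_itv.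
Qed.

Lemma penalty_itv f : minorant f -> 0 <= penalty f <= (1 + C) ^+ 2.
Proof.
move=> mf; have bf := bounded_dist_ratio mf; apply/andP; split.
  by apply: wsum_ge0 => // j; exact: sqr_ge0.
by apply: wsum_le_cst => // j; have /andP[] := dist_ratio_sq_itv j mf.
Qed.

Lemma dist_ratio_midpoint f g j : functional T f -> functional T g ->
  dist_ratio (midpoint f g) j <= (dist_ratio f j + dist_ratio g j) / 2.
Proof.
move=> ff fg; have df := diff_functional j ff; have dg := diff_functional j fg.
have := dual_norm_comb T_sub 2^-1 2^-1 df dg; rewrite ger0_norm// -!mulrDr => le_mid.
rewrite /dist_ratio -mulrDl mulrAC ler_wpM2r ?invr_ge0 ?(ltW (scale_gt0 j))//.
rewrite mulrC; congr (dnorm _ <= _): le_mid.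
by apply/funext => y; rewrite /midpoint; field.
Qed.

(* By the parallelogram identity, the convexity gap of the square of a convex
   quantity dominates the square of its half-difference. *)
Lemma penalty_gap f g j : minorant f -> minorant g ->
  ((dist_ratio f j - dist_ratio g j) / 2) ^+ 2 / 2 ^+ j.+1 <=
  (penalty f + penalty g) / 2 - penalty (midpoint f g).
Proof.
move=> mf mg; have mm := minorant_midpoint mf mg.
have [ff fg] := (minorant_functional mf, minorant_functional mg).
have [bf bg] := (bounded_dist_ratio mf, bounded_dist_ratio mg).
have bm := bounded_dist_ratio mm.
pose gap i := 2^-1 * dist_ratio f i ^+ 2 + 2^-1 * dist_ratio g i ^+ 2 +
  (-1) * dist_ratio (midpoint f g) i ^+ 2.
have bfg := bounded_seqD (bounded_seqZ 2^-1 bf) (bounded_seqZ 2^-1 bg).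
have bgap : bounded_seq gap := bounded_seqD bfg (bounded_seqZ (-1) bm).
have gapE : wsum gap = (penalty f + penalty g) / 2 - penalty (midpoint f g).
  rewrite (wsumD bfg (bounded_seqZ (-1) bm)).
  rewrite (wsumD (bounded_seqZ _ bf) (bounded_seqZ _ bg)).
  by rewrite !wsumZ// /penalty; ring.
have le_gap i : ((dist_ratio f i - dist_ratio g i) / 2) ^+ 2 <= gap i.
  have := lerXn2r 2 (dist_ratio_ge0 i (minorant_functional mm)) _
    (dist_ratio_midpoint i ff fg).
  rewrite nnegrE divr_ge0 ?addr_ge0 ?dist_ratio_ge0// => /(_ isT).
  by rewrite /gap !expr2; lra.
have gap_ge0 i : 0 <= gap i := le_trans (sqr_ge0 _) (le_gap i).
rewrite -gapE; apply: le_trans (wsum_term_le j bgap gap_ge0).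
by rewrite ler_wpM2r ?invr_ge0 ?exprn_ge0.
Qed.

Lemma penalty_lsc (U : set_system nat) (fn : nat -> E -> R) f (c : nat -> R) (cl : R) :
  UltraFilter U -> (forall n, minorant (fn n)) -> minorant f ->
  (forall y, T y -> (fun n => fn n y) @ U --> f y) ->
  (forall n, penalty (fn n) <= c n) -> c @ U --> cl -> penalty f <= cl.
Proof.
move=> UU mfn mf fnf pen_le ccl; have ffn n := minorant_functional (mfn n).
have /choice[rho rhoP] : forall j, exists l : R, (fun n => dist_ratio (fn n) j) @ U --> l.
  move=> j; apply: (ultra_cvg (B := 1 + C)) => n.
  by rewrite ger0_norm ?dist_ratio_ge0// dist_ratio_le.
have le_rho j : dist_ratio f j <= rho j.
  rewrite ler_pdivrMr//.
  apply: (dual_norm_lsc (F := U) T_sub (fun n => diff_functional j (ffn n))).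
    by move=> y Ty; apply: cvgB; [exact: fnf|exact: cvg_cst].
  under eq_fun do rewrite -(divfK (lt0r_neq0 (scale_gt0 j)) (dual_norm _ _)).
  by apply: cvgM; [exact: rhoP|exact: cvg_cst].
apply: wsum_le_of_wseries => [|N]; first exact: bounded_dist_ratio.
apply: (@le_trans _ _ (wseries (fun j => rho j ^+ 2) N)).
  apply: le_wseries => j; have r0 := dist_ratio_ge0 j (minorant_functional mf).
  by rewrite lerXn2r ?nnegrE// (le_trans r0).
have cvgN : (fun n => wseries (fun j => dist_ratio (fn n) j ^+ 2) N) @ U -->
    wseries (fun j => rho j ^+ 2) N.
  by apply: cvg_wseries_pointwise => j; apply: cvgM; exact: rhoP.
apply: (le_cvg_to cvgN ccl) => n; apply: le_trans (pen_le n).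
by apply: wseries_le_wsum => [|j]; [exact: bounded_dist_ratio|exact: sqr_ge0].
Qed.

Let penalized_has_sup x : T x -> has_sup [set penalized f x | f in minorant].
Proof.
move=> Tx; split; first by have [f mf _] := minorant_at 0; exists (penalized f x), f.
exists (s x) => _ [f mf <-]; have /andP[p0 _] := penalty_itv mf.
have := mf.2 x Tx; have := mulr_ge0 (ltW k_gt0) p0; rewrite /penalized; lra.
Qed.

Lemma le_envelope f x : minorant f -> T x -> penalized f x <= envelope x.
Proof. by move=> mf Tx; apply: (ub_le_sup (penalized_has_sup Tx).2); exists f. Qed.

Lemma envelope_le x (c : R) : T x ->
  (forall f, minorant f -> penalized f x <= c) -> envelope x <= c.
Proof.
move=> Tx fc; apply: ge_sup; first exact: (penalized_has_sup Tx).1.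
by move=> _ [f mf <-]; exact: fc.
Qed.

Lemma penalizedD f x y : minorant f -> T x -> T y ->
  penalized f (x + y) = penalized f x + f y.
Proof.
by move=> /minorant_functional ff Tx Ty; rewrite /penalized (functionalD ff)// addrAC.
Qed.

Lemma envelope_itv x : T x -> s x - k * (1 + C) ^+ 2 <= envelope x <= s x.
Proof.
move=> Tx; apply/andP; split.
  have [f mf <-] := minorant_at x; apply: le_trans (le_envelope mf Tx).
  have /andP[_ pf] := penalty_itv mf.
  by rewrite /penalized lerD2l lerN2 ler_pM2l.
apply: envelope_le => // f mf; have /andP[p0 _] := penalty_itv mf.
by have := mf.2 x Tx; have := mulr_ge0 (ltW k_gt0) p0; rewrite /penalized; lra.
Qed.

Lemma envelope_slope x u : T x -> T u -> envelope (x + u) <= envelope x + s u.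
Proof.
move=> Tx Tu; apply: envelope_le => [|f mf]; first exact: subspaceD.
by rewrite penalizedD//; apply: lerD; [exact: le_envelope|exact: mf.2].
Qed.

Lemma envelope_convex : convex_on T envelope.
Proof.
move=> x y t Tx Ty t0 t1.
have Txy : T (t *: x + (1 - t) *: y) by apply: subspaceD => //; exact: subspaceZ.
apply: envelope_le => // f mf; have ff := minorant_functional mf.
have t1' : 0 <= 1 - t by lra.
have := ler_wpM2l t0 (le_envelope mf Tx); have := ler_wpM2l t1' (le_envelope mf Ty).
rewrite /penalized (functionalD ff); try exact: subspaceZ.
by rewrite !(functionalZ T_sub)//; lra.
Qed.

Lemma envelope_attained x : T x -> exists2 f, minorant f & penalized f x = envelope x.
Proof.
move=> Tx.
have /choice[fn fnP] : forall n, exists f, minorant f /\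
    envelope x - harmonic n < penalized f x.
  move=> n; have [_ [f mf <-]] := sup_adherent (harmonic_gt0 n) (penalized_has_sup Tx).
  by exists f.
have mfn n := (fnP n).1; have [U [UU ooU]] := free_ultrafilter.
have [f ff fnf] := ultra_functional T_sub UU (fun n => minorant_functional (mfn n))
  (fun n => minorant_norm_le (mfn n)).
have mf : minorant f.
  split=> [|y Ty]; first exact: ff.1.
  by apply: (le_cvg_to (fnf y Ty) (cvg_cst (s y))) => n; exact: (mfn n).2.
exists f => //; apply/eqP; rewrite eq_le le_envelope//=.
have ccl : (fun n => (fn n x - envelope x + harmonic n) / k) @ U -->
    (f x - envelope x + 0) / k.
  apply: cvgM; last exact: cvg_cst.
  apply: cvgD; first by apply: cvgB; [exact: fnf|exact: cvg_cst].
  by apply: cvg_trans (@cvg_harmonic R); exact: cvg_app.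
have := penalty_lsc UU mfn mf fnf _ ccl; rewrite ler_pdivlMr//.
rewrite /penalized => pen_le; have {pen_le}: penalty f * k <= f x - envelope x + 0.
  apply: pen_le => n; rewrite ler_pdivlMr//; have := (fnP n).2.
  by rewrite /penalized; lra.
lra.
Qed.

Lemma near_max_close f x : minorant f -> T x -> penalized f x = envelope x ->
  forall eps : R, 0 < eps -> exists2 eta : R, 0 < eta &
    forall g, minorant g -> envelope x - eta <= penalized g x ->
      forall u, T u -> `|g u - f u| <= eps * `|u|.
Proof.
move=> mf Tx f_max eps e0; have ff := minorant_functional mf.
have e4 : 0 < eps / 4 by lra.
have [j jP] := phis_dense ff e4.
pose tau := eps / 4 / (1 + dnorm (phis j)).
have tau0 : 0 < tau by rewrite divr_gt0.
pose eta := 2 * k * ((tau / 2) ^+ 2 / 2 ^+ j.+1).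
have eta0 : 0 < eta by rewrite !mulr_gt0 ?invr_gt0 ?exprn_gt0.
exists eta => // g mg g_near u Tu; have fg := minorant_functional mg.
have close : dist_ratio g j - dist_ratio f j <= tau.
  have mid_le := le_envelope (minorant_midpoint mg mf) Tx.
  have := penalty_gap j mg mf; have k2 : 0 < 2 * k by rewrite mulr_gt0.
  have gap_le : (penalty g + penalty f) / 2 - penalty (midpoint g f) <=
      (tau / 2) ^+ 2 / 2 ^+ j.+1.
    rewrite -(ler_pM2l k2) -/eta.
    by move: mid_le f_max g_near; rewrite /penalized /midpoint; lra.
  move=> /le_trans/(_ gap_le); rewrite ler_pM2r ?invr_gt0 ?exprn_gt0//.
  rewrite -[leLHS]real_normK ?num_real// ler_pXn2r ?nnegrE//; last first.
    by rewrite divr_ge0// ltW.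
  by move=> /ler_normlW; lra.
have f_phi : dnorm (fun y => f y - phis j y) <= eps / 4.
  by apply: dual_norm_le => //; exact: ltW.
have g_phi : dnorm (fun y => g y - phis j y) <= eps / 2.
  have : dist_ratio g j <= dist_ratio f j + tau by rewrite -lerBlDl.
  by rewrite ler_pdivrMr// mulrDl /dist_ratio !divfK ?lt0r_neq0//; lra.
have -> : g u - f u = (g u - phis j u) - (f u - phis j u) by ring.
apply: le_trans (ler_normB _ _) _.
have := le_dual_norm T_sub (diff_functional j fg) Tu.
have := ler_wpM2r (normr_ge0 u) g_phi; have := jP u Tu.
have : 0 <= eps * `|u| by rewrite mulr_ge0// ltW.
lra.
Qed.

Lemma envelope_smooth x : T x -> smooth_at T envelope x.
Proof.
move=> Tx eps e0; have [f mf f_max] := envelope_attained Tx.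
have e2 : 0 < eps / 2 by lra.
have [eta eta0 close] := near_max_close mf Tx f_max e2.
have C2 : 0 < 1 + 2 * C by have := C_ge0; lra.
exists (eta / (1 + 2 * C)) => [|u Tu]; first by rewrite divr_gt0.
rewrite ltr_pdivlMr// => u_small.
have maximizer v : T v -> `|v| = `|u| -> exists2 g, minorant g &
    envelope (x + v) = penalized g x + g v /\ `|g v - f v| <= eps / 2 * `|u|.
  move=> Tv vu; have Txv := subspaceD T_sub Tx Tv.
  have [g mg g_max] := envelope_attained Txv.
  exists g => //; rewrite -g_max penalizedD//; split=> //; rewrite -vu.
  apply: close => //; rewrite -vu in u_small.
  have gv := minorant_le mg Tv; have := minorant_le mf (subspaceN T_sub Tv).
  rewrite normrN (functionalN T_sub (minorant_functional mf))//.
  have := le_envelope mf Txv; rewrite penalizedD// f_max -g_max penalizedD//.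
  by have := normr_ge0 v; lra.
have TNu := subspaceN T_sub Tu.
have [g1 mg1 [-> g1u]] := maximizer u Tu erefl.
have [g2 mg2 [-> g2u]] := maximizer (- u) TNu (normrN u).
have := le_envelope mg1 Tx; have := le_envelope mg2 Tx.
have := ler_normlW g1u; have := ler_normlW g2u.
by rewrite (functionalN T_sub (minorant_functional mf))//; lra.
Qed.

End SmoothApproximation.

Lemma smooth_approximation_exists {R : realType} {E : normedModType R} (T : set E)
    (s : E -> R) (C eta : R) : closed_subspace T -> separable_dual_of T ->
  sublinear s -> 0 <= C -> (forall x, s x <= C * `|x|) -> 0 < eta ->
  exists k, smooth_approximation T s eta k.
Proof.
move=> Tsub [phis [phisF phisD]] ssub C0 sC eta0.
have phis_dense f : functional T f -> forall eps : R, 0 < eps ->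
  exists n, forall y, T y -> `|f y - phis n y| <= eps * `|y| by case=> lf; exact: phisD.
pose k := eta / (1 + C) ^+ 2.
have C1 : 0 < (1 + C) ^+ 2 by rewrite exprn_gt0//; lra.
have k0 : 0 < k by rewrite divr_gt0.
exists (envelope T phis s k); split.
- by move=> x Tx; have := envelope_itv Tsub phisF ssub C0 sC k0 Tx; rewrite divfK ?gt_eqF.
- by move=> x u; exact: (envelope_slope Tsub phisF ssub C0 sC k0).
- exact: (envelope_convex Tsub phisF ssub C0 sC k0).
- by move=> x; exact: (envelope_smooth Tsub phisF phis_dense ssub C0 sC k0).
Qed.

(** * A smooth variational principle *)

Lemma cvg_div_expr {R : realType} (a q : R) : 1 < q ->
  (fun n => a / q ^+ n) @ \oo --> (0 : R).
Proof.
move=> q1; have q0 : 0 < q := lt_trans ltr01 q1.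
have -> : (fun n => a / q ^+ n) = geometric a q^-1.
  by apply/funext => n; rewrite /= exprVn.
by apply: cvg_geometric; rewrite gtr0_norm ?invr_gt0// invf_lt1.
Qed.

Section BorweinPreiss.
Context {R : realType} {E : completeNormedModType R}.
Variables (M : set E) (k0 : E -> R) (sig : nat -> E -> R) (z0 : E) (Ck gam r : R).
Hypothesis gam_gt0 : 0 < gam.
Hypothesis r_gt0 : 0 < r.
Hypothesis M_closed : closed M.
Hypothesis M_z0 : M z0.
Hypothesis k0_lip : forall y z, M y -> M z -> `|k0 y - k0 z| <= Ck * `|y - z|.
Hypothesis z0_near_min : forall y, M y -> k0 z0 <= k0 y + gam * r / 8.
Hypothesis sig_itv : forall j y z, M y -> M z ->
  `|y - z| - r / 2 ^+ j.+1 <= sig j (y - z) <= `|y - z|.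
Hypothesis sig_lip : forall j y z w, M y -> M z -> M w ->
  `|sig j (y - w) - sig j (z - w)| <= `|y - z|.
Implicit Types (zs : nat -> E) (y : E).

Definition perturb zs n y : R := k0 y + gam * wseries (fun j => sig j (y - zs j)) n.

Definition tolerance n : R := gam * r / 8 / 4 ^+ n.

Definition near_minimal (f : E -> R) (eps : R) : set E :=
  [set z | M z /\ forall y, M y -> f z <= f y + eps].

Lemma tolerance_gt0 n : 0 < tolerance n.
Proof. by rewrite !divr_gt0 ?mulr_gt0 ?exprn_gt0. Qed.

Lemma near_minimal_exists (f : E -> R) (b eps : R) : (forall y, M y -> b <= f y) ->
  0 < eps -> exists z, near_minimal f eps z.
Proof.
move=> fb eps0; have f_inf : has_inf [set f y | y in M].
  by split; [exists (f z0), z0|exists b => _ [y My <-]; exact: fb].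
have [_ [z Mz <-] z_inf] := inf_adherent eps0 f_inf.
exists z; split=> // y My; apply: le_trans (ltW z_inf) _.
by rewrite lerD2r; apply: (ge_inf f_inf.2); exists y.
Qed.

Lemma perturb_ge zs n y : (forall j, M (zs j)) -> M y ->
  k0 z0 - gam * r / 8 - gam * r <= perturb zs n y.
Proof.
move=> Mzs My; have := z0_near_min My.
have : gam * wseries (fun=> - r) n <= gam * wseries (fun j => sig j (y - zs j)) n.
  rewrite ler_pM2l//; apply: le_wseries => j.
  have /andP[+ _] := sig_itv j My (Mzs j); have := normr_ge0 (y - zs j).
  by have := div_exp2_le j.+1 (ltW r_gt0); lra.
have : - r <= wseries (fun=> - r) n.
  have := wseries_cst_le n (ltW r_gt0).
  by have := @wseriesZ R (-1) (fun=> r) n; rewrite !mulN1r => ->; lra.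
by rewrite -(ler_pM2l gam_gt0) /perturb; lra.
Qed.

Lemma near_minimal_sequence : exists zs, zs 0 = z0 /\
  forall n, near_minimal (perturb zs n) (tolerance n) (zs n).
Proof.
pose pick n f := xget z0 (near_minimal f (tolerance n)).
pose st := fix st n : (E -> R) * E := if n is m.+1 then
  let f y := (st m).1 y + gam * (sig m (y - (st m).2) / 2 ^+ m.+1) in (f, pick m.+1 f)
  else (k0, z0).
pose zs n := (st n).2; exists zs; split=> //.
have stE n : (st n).1 = perturb zs n.
  elim: n => [|n IH]; apply/funext => y.
    by rewrite /perturb /wseries /series/= big_nil mulr0 addr0.
  by rewrite /= IH /perturb wseriesS mulrDr addrA.
have Mzs n : M (zs n).
  by case: n => [|n] //; rewrite /zs /= /pick; case: xgetP => [z _ [Mz _]|_].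
case=> [|n].
  split=> // y My; rewrite /perturb /tolerance /wseries /series/= !big_nil expr0.
  by have := z0_near_min My; lra.
rewrite -stE; apply: xgetPex; rewrite -[fun y => _]/((st n.+1).1) stE.
apply: near_minimal_exists (tolerance_gt0 _) => y.
exact: perturb_ge.
Qed.

Section Limit.
Variable zs : nat -> E.
Hypothesis zs_near_min : forall n, near_minimal (perturb zs n) (tolerance n) (zs n).

Let Mzs n : M (zs n) := (zs_near_min n).1.

Lemma dist_step n : `|zs n.+1 - zs n| <= r / 2 ^+ n.
Proof.
have := (zs_near_min n.+1).2 _ (Mzs n); have := (zs_near_min n).2 _ (Mzs n.+1).
rewrite /perturb !wseriesS; have /andP[_] := sig_itv n (Mzs n) (Mzs n).
rewrite subrr normr0; have /andP[+ _] := sig_itv n (Mzs n.+1) (Mzs n).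
move: (sig n _) (sig n 0) => a b le_a b_le0 near_n near_n1.
have p0 : 0 < 2 ^+ n :> R by rewrite exprn_gt0.
have tolS : tolerance n.+1 <= tolerance n.
  rewrite /tolerance exprS invfM mulrA mulrAC ler_pdivrMr// ler_peMr ?ler1n//.
  exact: ltW (tolerance_gt0 n).
have tolE : tolerance n = gam * (r / 8 / 2 ^+ n / 2 ^+ n).
  by rewrite /tolerance (_ : 4 = 2 * 2 :> R) ?exprMn; [field; rewrite gt_eqF|ring].
have b2 : gam * (b / 2 ^+ n.+1) <= 0.
  by rewrite pmulr_rle0// pmulr_lle0 ?invr_gt0 ?exprn_gt0.
have : gam * (a / 2 ^+ n.+1) <= gam * (r / 4 / 2 ^+ n / 2 ^+ n) by lra.
rewrite ler_pM2l// exprS invfM mulrA ler_pM2r ?invr_gt0// ler_pdivrMr//.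
by move: le_a; rewrite exprS invfM; lra.
Qed.

Lemma dist_le m n : (m <= n)%N -> `|zs n - zs m| <= 2 * r / 2 ^+ m.
Proof.
move=> mn; suff : `|zs n - zs m| <= 2 * r / 2 ^+ m - 2 * r / 2 ^+ n.
  have : 0 <= 2 * r / 2 ^+ n by rewrite divr_ge0 ?exprn_ge0// mulr_ge0// ltW.
  lra.
move: mn => /subnK <-; elim: (n - m)%N => [|i IH]; first by rewrite add0n !subrr normr0.
rewrite addSn; have := ler_normD (zs (i + m).+1 - zs (i + m)%N) (zs (i + m)%N - zs m).
rewrite subrKA; have := dist_step (i + m); move: IH.
by rewrite [2 ^+ (i + m).+1]exprS invfM; lra.
Qed.

Lemma zs_cvg : exists e : E, zs @ \oo --> e.
Proof.
suff /cauchy_cvgP/cvg_ex : cauchy (zs @ \oo) by [].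
apply: cauchy_exP => eps eps0.
have /cvgrPdist_lt/(_ eps eps0)[N _ NP] := @cvg_div_expr R (2 * r) 2 (ltr1n _ 2).
exists (zs N); exists N => // n /= Nn; rewrite -ball_normE /= distrC.
apply: le_lt_trans (dist_le Nn) _; apply: le_lt_trans (ler_norm _) _.
by have := NP N (leqnn N); rewrite /= sub0r normrN.
Qed.

Variable e : E.
Hypothesis zs_e : zs @ \oo --> e.

Lemma dist_limit m : `|e - zs m| <= 2 * r / 2 ^+ m.
Proof.
have cvg_dist : (fun n => `|zs n - zs m|) @ \oo --> `|e - zs m|.
  by apply: cvg_norm; apply: cvgB => //; exact: cvg_cst.
apply: (ler_cvg_to cvg_dist (cvg_cst _)).
by exists m => // n /= mn; exact: dist_le.
Qed.

Lemma M_limit : M e.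
Proof. by apply: closed_cvg M_closed _ _ zs_e; apply: nearW. Qed.

Lemma perturb_cvg y : M y ->
  (fun n => perturb zs n y) @ \oo --> k0 y + gam * wsum (fun j => sig j (y - zs j)).
Proof.
move=> My; apply: cvgD; first exact: cvg_cst.
apply: cvgM; first exact: cvg_cst.
apply: cvg_wseries; exists (`|y - e| + 2 * r + r) => j.
have := ler_normD (y - e) (e - zs j); rewrite subrKA.
have := dist_limit j; have := div_exp2_le j (mulr_ge0 (ler0n _ 2) (ltW r_gt0)).
have := div_exp2_le j.+1 (ltW r_gt0); have := normr_ge0 (y - zs j).
by have /andP[+ +] := sig_itv j My (Mzs j); rewrite ler_norml; lra.
Qed.

Lemma limit_minimal y : M y ->
  k0 e + gam * wsum (fun j => sig j (e - zs j)) <=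
  k0 y + gam * wsum (fun j => sig j (y - zs j)).
Proof.
move=> My.
have near_e n : `|perturb zs n (zs n) - perturb zs n e| <= (Ck + gam) * `|zs n - e|.
  have -> : perturb zs n (zs n) - perturb zs n e = (k0 (zs n) - k0 e) +
      gam * (wseries (fun j => sig j (zs n - zs j)) n -
             wseries (fun j => sig j (e - zs j)) n).
    by rewrite /perturb; ring.
  apply: le_trans (ler_normD _ _) _; rewrite mulrDl normrM (gtr0_norm gam_gt0).
  apply: lerD; first exact: k0_lip (Mzs n) M_limit.
  rewrite ler_pM2l//; apply: wseries_dist_le => // j.
  exact: sig_lip (Mzs n) M_limit (Mzs j).
have cvg_min : (fun n => perturb zs n (zs n)) @ \oo -->
    k0 e + gam * wsum (fun j => sig j (e - zs j)).
  exact: (cvg_of_dist_le (perturb_cvg M_limit) (cvg_dist0 zs_e) near_e).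
have cvg_y : (fun n => perturb zs n y + tolerance n) @ \oo -->
    k0 y + gam * wsum (fun j => sig j (y - zs j)) + 0.
  by apply: cvgD; [exact: perturb_cvg|apply: cvg_div_expr; rewrite ltr1n].
rewrite -[leRHS]addr0; apply: (le_cvg_to cvg_min cvg_y) => n.
exact: (zs_near_min n).2.
Qed.

End Limit.

Lemma borwein_preiss : exists zs e,
  [/\ forall n, M (zs n), M e, zs 0 = z0, forall n, `|e - zs n| <= 2 * r &
      forall y, M y -> k0 e + gam * wsum (fun j => sig j (e - zs j)) <=
                       k0 y + gam * wsum (fun j => sig j (y - zs j))].
Proof.
have [zs [zs0 zs_near_min]] := near_minimal_sequence.
have [e zs_e] := zs_cvg zs_near_min.
exists zs, e; split=> // [n||n|y].
- exact: (zs_near_min n).1.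
- exact: M_limit zs_e.
- apply: le_trans (dist_limit zs_near_min zs_e n) _.
  by apply: div_exp2_le; rewrite mulr_ge0// ltW.
- exact: limit_minimal.
Qed.

End BorweinPreiss.

(** * Approximate Frechet normals at minimizers *)

Section TranslatedSums.
Context {R : realType} {E : normedModType R}.
Variables (T : set E) (sig : nat -> E -> R) (eta : nat -> R) (d : nat -> E) (r B : R).
Hypothesis T_sub : closed_subspace T.
Hypothesis sig_norm : forall j,
  smooth_approximation T (fun x : E => `|x|) (eta j) (sig j).
Hypothesis eta_le : forall j, eta j <= r.
Hypothesis d_T : forall j, T (d j).
Hypothesis d_le : forall j, `|d j| <= B.
Implicit Types (x y u w : E) (j : nat).

Definition translated_sum w : R := wsum (fun j => sig j (w + d j)).

Lemma bounded_translates w : T w -> bounded_seq (fun j => sig j (w + d j)).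
Proof.
move=> Tw; exists (`|w| + B + r) => j.
have [/(_ _ (subspaceD T_sub Tw (d_T j)))/andP[lb ub] _ _ _] := sig_norm j.
rewrite ler_norml; have := ler_normD w (d j); have := normr_ge0 (w + d j).
by have := eta_le j; have := d_le j; have := normr_ge0 w; lra.
Qed.

Lemma translated_sum_slope w u : T w -> T u ->
  translated_sum (w + u) <= translated_sum w + `|u|.
Proof.
move=> Tw Tu; have bw := bounded_translates Tw.
rewrite -[`|u|]wsum_cst -wsumD//; last exact: bounded_seq_cst.
apply: le_wsum => [||j]; first exact: bounded_translates (subspaceD T_sub Tw Tu).
  exact: bounded_seqD (bounded_seq_cst _).
have [_ slope _ _] := sig_norm j.
by rewrite addrAC; apply: slope => //; exact: subspaceD.
Qed.

Lemma translated_sum_convex : convex_on T translated_sum.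
Proof.
move=> x y t Tx Ty t0 t1.
have [bdx bdy] := (bounded_translates Tx, bounded_translates Ty).
rewrite -!wsumZ// -wsumD; [|exact: bounded_seqZ..].
apply: le_wsum => [||j].
- by apply: bounded_translates; apply: subspaceD => //; exact: subspaceZ.
- by apply: bounded_seqD; exact: bounded_seqZ.
have -> : t *: x + (1 - t) *: y + d j = t *: (x + d j) + (1 - t) *: (y + d j).
  by rewrite !scalerDr addrACA -scalerDl [t + (1 - t)]addrC subrK scale1r.
by have [_ _ cvx _] := sig_norm j; apply: cvx => //; exact: subspaceD.
Qed.

Lemma initial_terms_smooth w (J : nat) (eps : R) : T w -> 0 < eps ->
  exists2 delta : R, 0 < delta & forall j u, (j < J)%N -> T u -> `|u| < delta ->
    sig j (w + d j + u) + sig j (w + d j - u) - 2 * sig j (w + d j) <= eps * `|u|.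
Proof.
move=> Tw eps0; elim: J => [|J [delta delta0 IH]]; first by exists 1.
have [_ _ _ /(_ _ (subspaceD T_sub Tw (d_T J)) _ eps0)[delta' delta'0 smJ]] := sig_norm J.
exists (Num.min delta delta') => [|j u]; first by rewrite lt_min delta0.
rewrite ltnS leq_eqVlt lt_min => /predU1P[->|jJ] Tu /andP[u1 u2]; first exact: smJ.
exact: IH.
Qed.

(* The slopes are uniformly bounded, so that the second differences of the
   tail of the series are negligible. *)
Lemma translated_sum_smooth w : T w -> smooth_at T translated_sum w.
Proof.
move=> Tw eps eps0; have e2 : 0 < eps / 2 by lra.
have /cvgrPdist_le/(_ _ e2)[J _ /(_ J (leqnn J)) JP] := @cvg_div_expr R 2 2 (ltr1n _ 2).
have {}JP : 2 / 2 ^+ J <= eps / 2.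
  by apply: le_trans (ler_norm _) _; rewrite -normrN -sub0r.
have [delta delta0 smooth_init] := initial_terms_smooth J Tw e2.
exists delta => // u Tu u_delta; have TNu := subspaceN T_sub Tu.
have bw := bounded_translates Tw.
have bp := bounded_translates (subspaceD T_sub Tw Tu).
have bm := bounded_translates (subspaceD T_sub Tw TNu).
pose D j := sig j (w + u + d j) + sig j (w - u + d j) + (-2) * sig j (w + d j).
have bpm := bounded_seqD bp bm; have b2 := bounded_seqZ (-2) bw.
have -> : translated_sum (w + u) + translated_sum (w - u) - 2 * translated_sum w = wsum D.
  by rewrite (wsumD bpm b2) (wsumD bp bm) (wsumZ _ bw) mulNr.
have DE j : D j = sig j (w + d j + u) + sig j (w + d j - u) - 2 * sig j (w + d j).
  by rewrite /D mulNr [w + u + _]addrAC [w - u + _]addrAC.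
have half_ge0 : 0 <= eps / 2 * `|u| by rewrite mulr_ge0// ltW.
apply: (@le_trans _ _ (eps / 2 * `|u| + 2 * `|u| / 2 ^+ J)).
  apply: wsum_tail_le => // [|j jJ|j]; first exact: bounded_seqD.
    by rewrite DE; exact: smooth_init.
  have [_ slope _ _] := sig_norm j; have Twd := subspaceD T_sub Tw (d_T j).
  by rewrite DE; have := slope _ _ Twd Tu; have := slope _ _ Twd TNu; rewrite normrN; lra.
have := ler_wpM2r (normr_ge0 u) JP; rewrite [2 / _ * _]mulrAC; lra.
Qed.

End TranslatedSums.

Section ViolationsAndConvexity.
Context {R : realType} {E : normedModType R}.
Variable T : set E.
Hypothesis T_sub : closed_subspace T.

Lemma convex_on_sum (k : E -> R) (I : eqType) (l : seq I) (a : I -> R) (x : I -> E) :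
  convex_on T k -> k 0 = 0 -> (forall i, i \in l -> 0 <= a i /\ T (x i)) ->
  \sum_(i <- l) a i < 1 ->
  T (\sum_(i <- l) a i *: x i) /\
  k (\sum_(i <- l) a i *: x i) <= \sum_(i <- l) a i * k (x i).
Proof.
move=> kcvx k0; elim: l a => [|i l IH] a aP.
  by rewrite !big_nil k0; split=> //; exact: T_sub.1.
have [ai0 Txi] := aP i (mem_head _ _); rewrite !big_cons => sum1.
have aP' j : j \in l -> 0 <= a j /\ T (x j).
  by move=> jl; apply: aP; rewrite in_cons jl orbT.
have suml0 : 0 <= \sum_(j <- l) a j by rewrite big_seq; apply: sumr_ge0 => j /aP'[].
pose c := 1 - a i; have c0 : 0 < c by rewrite /c; lra.
have [j /aP'[aj0 Txj]||Ty ky] := IH (fun j => a j / c).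
- by split=> //; rewrite divr_ge0// ltW.
- by rewrite -mulr_suml ltr_pdivrMr// mul1r /c; lra.
set y := \sum_(j <- l) _ *: _ in Ty ky.
have -> : \sum_(j <- l) a j *: x j = (1 - a i) *: y.
  by rewrite scaler_sumr; apply: eq_bigr => j _; rewrite scalerA mulrC divfK ?gt_eqF.
split; first by apply: subspaceD => //; exact: subspaceZ.
apply: le_trans (kcvx _ _ (a i) Txi Ty ai0 _) _; first by move: c0; rewrite /c; lra.
rewrite lerD2l; apply: le_trans (ler_wpM2l (ltW c0) ky) _.
rewrite mulr_sumr le_eqVlt; apply/orP; left; apply/eqP; apply: eq_bigr => j _.
by rewrite mulrA [c * _]mulrC divfK ?gt_eqF.
Qed.

(* Minimality bounds the increase of K along y - e by the slope |y - e|/(j+1)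
   that smoothness allows for its second difference. *)
Lemma no_violation_of_convex (A : set E) (s K : E -> R) (e : E) :
  sublinear s -> T e -> convex_on T K -> smooth_at T K 0 -> K 0 = 0 ->
  (forall y, A y -> T y -> 0 <= K (y - e)) -> (forall w, T w -> K w <= s (- w)) ->
  exists m, no_violation s (A `&` T) e m.
Proof.
move=> ssub Te Kcvx Ksm K0 Kmin Ks.
have /choice[m mP] : forall j : nat, exists n : nat, forall u, T u ->
    `|u| < harmonic n -> K u + K (- u) <= harmonic j * `|u|.
  move=> j; have [delta delta0 second_diff] := Ksm _ (harmonic_gt0 j).
  have [n n_delta] := harmonic_lt delta0; exists n => u Tu un.
  by have := second_diff u Tu (lt_trans un n_delta); rewrite add0r sub0r K0; lra.
exists m => l lm adl; have w0 := weight_ge0 adl.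
have w1 : 0 < 1 + weight l by lra.
pose t := (1 + weight l)^-1; have t0 : 0 < t by rewrite invr_gt0.
pose v := displacement e l.
have vE : - (t *: v) = \sum_(i <- l) (t * i.1.1) *: (e - i.1.2).
  rewrite /v /displacement scaler_sumr -sumrN; apply: eq_bigr => i _.
  by rewrite -scalerN -scalerN opprB scalerA.
have [i il||Ttv Kle] :=
    @convex_on_sum K _ l (fun i => t * i.1.1) (fun i => e - i.1.2) Kcvx K0.
- have [l0 [_ Ti] _] := adl i il.
  by split; [rewrite mulr_ge0// ltW|exact: subspaceB].
- by rewrite -mulr_sumr /t mulrC ltr_pdivrMr// mul1r -/(weight l); lra.
rewrite -vE in Ttv Kle.
have Kcost : K (- (t *: v)) <= t * slope_cost e l.
  apply: le_trans Kle _; rewrite /slope_cost mulr_sumr big_seq [leRHS]big_seq.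
  apply: ler_sum => i il; have [l0 [Ai Ti]] := adl i il; rewrite addr0 => rad.
  rewrite -mulrA ler_pM2l//; apply: ler_wpM2l => //.
  have := mP i.2.1 _ (subspaceB T_sub Ti Te); rewrite -(lm i il) => /(_ rad).
  by rewrite opprB; have := Kmin _ Ai Ti; lra.
have TtvN : T (t *: v) by rewrite -[t *: v]opprK; exact: subspaceN.
have Kpm : 0 <= K (t *: v) + K (- (t *: v)).
  have half : 1 - 2^-1 = 2^-1 :> R by field.
  have := Kcvx _ _ 2^-1 TtvN Ttv; rewrite half -scalerDr subrr scaler0 K0.
  by move=> /(_ ltac:(lra) ltac:(lra)); lra.
have := Ks _ TtvN; rewrite -scalerN ssub.2 ?(ltW t0)// => Ktv.
by rewrite -(pmulr_rge0 _ t0) /cost mulrDr -/v; lra.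
Qed.

End ViolationsAndConvexity.

Lemma smooth_approximation_lip {R : realType} {E : normedModType R} (T : set E)
    (s k : E -> R) (C eta : R) (x y : E) : closed_subspace T ->
  smooth_approximation T s eta k -> (forall z, s z <= C * `|z|) -> T x -> T y ->
  `|k x - k y| <= C * `|x - y|.
Proof.
move=> Tsub [_ slope _ _] sC Tx Ty.
have half u v : T u -> T v -> k u - k v <= C * `|u - v|.
  move=> Tu Tv; have := slope v (u - v) Tv (subspaceB Tsub Tu Tv).
  by rewrite [v + _]addrC subrK; have := sC (u - v); lra.
rewrite ler_norml half// andbT lerNl opprB distrC; exact: half.
Qed.

Section NormalsAtMinimizers.
Context {R : realType} {E : completeNormedModType R}.
Variables (A : set E) (s : E -> R) (C : R) (e0 : E).
Hypothesis E_asplund : asplund E.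
Hypothesis A_closed : closed A.
Hypothesis s_sub : sublinear s.
Hypothesis C_ge0 : 0 <= C.
Hypothesis s_le : forall x, s x <= C * `|x|.
Hypothesis A_e0 : A e0.
Hypothesis e0_min : forall e, A e -> 0 <= s (e0 - e).

Section SmoothPerturbation.
Variables (T : set E) (gam : R) (k : E -> R) (sig : nat -> E -> R).
Hypothesis T_sub : closed_subspace T.
Hypothesis T_e0 : T e0.
Hypothesis gam_gt0 : 0 < gam.
Local Notation r := (gam / 4).
Hypothesis k_smooth : smooth_approximation T s (gam * r / 8) k.
Hypothesis sig_smooth : forall j,
  smooth_approximation T (fun x : E => `|x|) (r / 2 ^+ j.+1) (sig j).

Definition perturbed_objective (zs : nat -> E) (y : E) : R :=
  k (e0 - y) + gam * wsum (fun j => sig j (y - zs j)).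

Lemma perturbed_minimizer_exists : exists zs e,
  [/\ forall n, T (zs n), A e /\ T e, `|e - e0| < gam, forall n, `|e - zs n| <= 2 * r &
      forall y, A y -> T y -> perturbed_objective zs e <= perturbed_objective zs y].
Proof.
have r_gt0 : 0 < r by rewrite divr_gt0.
have norm_le (x : E) : `|x| <= 1 * `|x| by rewrite mul1r.
have TB := subspaceB T_sub; have [k_itv _ _ _] := k_smooth.
have [|y z [_ Ty] [_ Tz]|y [Ay Ty]|j y z [_ Ty] [_ Tz]|j y z w [_ Ty] [_ Tz] [_ Tw]|] :=
    @borwein_preiss R E (A `&` T) (fun e => k (e0 - e)) sig e0 C gam r gam_gt0 r_gt0 _
      (conj A_e0 T_e0).
- by apply: closedI => //; exact: T_sub.2.2.
- have := smooth_approximation_lip T_sub k_smooth s_le (TB _ _ T_e0 Ty) (TB _ _ T_e0 Tz).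
  by rewrite opprB [_ - y + _]addrC subrKA [`|z - y|]distrC.
- have /andP[_] := k_itv _ (TB _ _ T_e0 T_e0).
  have /andP[+ _] := k_itv _ (TB _ _ T_e0 Ty).
  by have := e0_min Ay; rewrite subrr (sublinear0 s_sub); lra.
- by have [itv _ _ _] := sig_smooth j; apply: itv; exact: TB.
- have := smooth_approximation_lip T_sub (sig_smooth j) norm_le
    (TB _ _ Ty Tw) (TB _ _ Tz Tw).
  by rewrite mul1r opprB subrKA.
move=> zs [e [zsM [Ae Te] zs0 e_zs e_min]]; exists zs, e; split=> // [n||y Ay Ty].
- exact: (zsM n).2.
- by have := e_zs 0%N; rewrite zs0; have := gam_gt0; lra.
- exact: e_min (conj Ay Ty).
Qed.

Lemma no_violation_of_perturbed_minimizer (zs : nat -> E) (e : E) :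
  (forall n, T (zs n)) -> T e -> (forall n, `|e - zs n| <= 2 * r) ->
  (forall y, A y -> T y -> perturbed_objective zs e <= perturbed_objective zs y) ->
  exists m, no_violation (fun x => s x + gam * `|x|) (A `&` T) e m.
Proof.
move=> zsT Te e_zs e_min; have r_ge0 : 0 <= r by rewrite divr_ge0// ltW.
have gam_ge0 := ltW gam_gt0; have [_ k_slope k_cvx k_diff] := k_smooth.
pose d j := e - zs j; have dT j : T (d j) by exact: subspaceB.
have eta_r j : r / 2 ^+ j.+1 <= r by exact: div_exp2_le.
pose K w := k (e0 - e - w) + gam * translated_sum sig d w + - perturbed_objective zs e.
have objectiveE y :
    perturbed_objective zs y = k (e0 - y) + gam * translated_sum sig d (y - e).
  by congr (_ + _ * wsum _); apply/funext => j; rewrite /d subrKA.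
have Te0e := subspaceB T_sub T_e0 Te.
apply: (@no_violation_of_convex _ _ T T_sub A _ K) => //.
- by apply: sublinearD => //; apply: sublinearZ => //; exact: norm_sublinear.
- apply: convex_onD; last exact: convex_on_cst.
  apply: convex_onD; first exact: convex_on_reflect.
  apply: convex_onZ => //.
  exact: (translated_sum_convex T_sub sig_smooth eta_r dT e_zs).
- apply: smooth_atD; last exact: smooth_at_cst.
  apply: smooth_atD; first by apply: smooth_at_reflect; rewrite subr0; exact: k_diff.
  apply: smooth_atZ => //.
  exact: (translated_sum_smooth T_sub sig_smooth eta_r dT e_zs T_sub.1).
- by rewrite /K objectiveE subr0 !subrr.
- by move=> y Ay Ty; rewrite /K opprB subrKA -objectiveE subr_ge0; exact: e_min.
- move=> w Tw; have := k_slope _ _ Te0e (subspaceN T_sub Tw).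
  have := translated_sum_slope T_sub sig_smooth eta_r dT e_zs T_sub.1 Tw; rewrite add0r.
  by rewrite -(ler_pM2l gam_gt0) /K objectiveE subrr normrN; lra.
Qed.

End SmoothPerturbation.

Lemma no_violation_at_minimizer (T : set E) (gam : R) :
  closed_subspace T -> separable_dual_of T -> T e0 -> 0 < gam ->
  exists e, [/\ A e, T e, `|e - e0| < gam &
    exists m, no_violation (fun x => s x + gam * `|x|) (A `&` T) e m].
Proof.
move=> T_sub T_dual T_e0 gam_gt0; have r_gt0 : 0 < gam / 4 by rewrite divr_gt0.
have [k k_smooth] := smooth_approximation_exists T_sub T_dual s_sub C_ge0 s_le
  (divr_gt0 (mulr_gt0 gam_gt0 r_gt0) (ltr0n _ 8)).
have /choice[sig sig_smooth] : forall j, exists f,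
    smooth_approximation T (fun x : E => `|x|) (gam / 4 / 2 ^+ j.+1) f.
  move=> j; apply: (smooth_approximation_exists (C := 1)) => // [|x|].
  - exact: norm_sublinear.
  - by rewrite mul1r.
  - by rewrite divr_gt0// exprn_gt0.
have [zs [e [zsT [Ae Te] e_near e_zs e_min]]] :=
  perturbed_minimizer_exists T_sub T_e0 gam_gt0 k_smooth sig_smooth.
exists e; split=> //.
exact: (no_violation_of_perturbed_minimizer T_sub T_e0 gam_gt0 k_smooth sig_smooth zsT).
Qed.

Lemma normal_at_minimizer (gam : R) : 0 < gam ->
  exists e nu, [/\ A e, `|e - e0| < gam, fnormal A e nu &
    forall x, nu x <= s x + gam * `|x|].
Proof.
move=> gam0; pose s' x := s x + gam * `|x|.
have s'_sub : sublinear s'.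
  apply: sublinearD => //; apply: sublinearZ; [exact: ltW|exact: norm_sublinear].
have C'0 : 0 <= C + gam by rewrite addr_ge0// ltW.
have s'_le x : s' x <= (C + gam) * `|x| by have := s_le x; rewrite /s'; lra.
have [T [Tsub Tsep Te0 Tred]] := separable_no_violation s'_sub C'0 s'_le A e0.
have [e [Ae Te ee0 [m /(Tred e m Te) nv]]] :=
  no_violation_at_minimizer Tsub (E_asplund Tsub Tsep) Te0 gam0.
by have [nu nuN nu_le] := normal_of_no_violation s'_sub s'_le nv; exists e, nu.
Qed.

End NormalsAtMinimizers.

(** * Calculus of Frechet normals *)

Section FrechetNormals.
Context {R : realType}.
Local Notation cball := (closed_ball_ Num.norm).

Lemma cball_subset {V : normedModType R} (x0 x : V) (r rho : R) :
  `|x0 - x| + r <= rho -> cball x r `<=` cball x0 rho.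
Proof.
move=> r_rho y xy; have := ler_normD (x0 - x) (x - y).
by rewrite subrKA; move: xy; rewrite /closed_ball_ /=; lra.
Qed.

Lemma cball_nbhs {V : normedModType R} (x0 x : V) (rho : R) :
  `|x0 - x| < rho -> nbhs x (cball x0 rho).
Proof.
move=> x_near; apply/nbhs_normP; exists (rho - `|x0 - x|); first by rewrite /= subr_gt0.
move=> y /= xy; apply: (@cball_subset _ x0 x (rho - `|x0 - x|)); last exact: ltW.
by rewrite addrC subrK.
Qed.

Lemma nbhs_exists_cball {V : normedModType R} (x : V) (A : set V) :
  nbhs x A -> exists2 r : R, 0 < r & cball x r `<=` A.
Proof. by move=> /nbhs_closedballP[r rA]; exists r%:num => //; rewrite -closed_ballE. Qed.

Lemma fnormal_scalar {V : normedModType R} (A : set V) (x : V) nu :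
  fnormal A x nu -> scalar nu.
Proof. by case=> [[]]. Qed.

Lemma fnormal_local {V : normedModType R} (A N : set V) (x : V) nu :
  nbhs x N -> fnormal (A `&` N) x nu -> fnormal A x nu.
Proof.
move=> /nbhs_normP[rho /= rho0 rhoN] [cnu nuN]; split=> // eps eps0.
have [delta delta0 nu_le] := nuN _ eps0.
exists (Num.min delta rho) => [|u Au]; first by rewrite lt_min delta0.
rewrite lt_min => /andP[u1 u2]; apply: nu_le => //; split=> //.
by apply: rhoN; rewrite /= distrC.
Qed.

Lemma fnormal_scale {V : normedModType R} (A : set V) (x : V) nu (c : R) :
  0 < c -> fnormal A x nu -> fnormal A x (fun y => c * nu y).
Proof.
move=> c0 [[lnu cnu] nuN]; split.
  split; first by move=> a y z; rewrite lnu; ring.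
  by move=> y; apply: cvgM; [exact: cvg_cst|exact: cnu].
move=> eps eps0; have [delta delta0 nu_le] := nuN _ (divr_gt0 eps0 c0).
exists delta => // u Au ud; have := ler_wpM2l (ltW c0) (nu_le u Au ud).
by rewrite mulrA [c * (_ / _)]mulrC divfK ?gt_eqF.
Qed.

Lemma clin_pairx0 {U V : normedModType R} (nu : U * V -> R) :
  clin nu -> clin (fun u => nu (u, 0)).
Proof.
move=> [lnu cnu]; split=> [|u]; first exact: scalar_pairx0.
apply: (@cvg_comp _ _ _ (fun u => (u, 0)) nu _ (nbhs (u, 0 : V))); last exact: cnu.
by apply: cvg_pair; [exact: cvg_id|exact: cvg_cst].
Qed.

Lemma clin_pair0x {U V : normedModType R} (nu : U * V -> R) :
  clin nu -> clin (fun v => nu (0, v)).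
Proof.
move=> [lnu cnu]; split=> [|v]; first exact: scalar_pair0x.
apply: (@cvg_comp _ _ _ (fun v => (0, v)) nu _ (nbhs (0 : U, v))); last exact: cnu.
by apply: cvg_pair; [exact: cvg_cst|exact: cvg_id].
Qed.

Lemma clin_pair {U V : normedModType R} (f : U -> R) (g : V -> R) :
  clin f -> clin g -> clin (fun q : U * V => f q.1 + g q.2).
Proof.
move=> [lf cf] [lg cg]; split=> [a x y|q]; first by rewrite /= lf lg; ring.
apply: cvgD.
  by apply: (@cvg_comp _ _ _ fst f _ (nbhs q.1)); [exact: cvg_fst|exact: cf].
by apply: (@cvg_comp _ _ _ snd g _ (nbhs q.2)); [exact: cvg_snd|exact: cg].
Qed.

Lemma clin_opp {V : normedModType R} (f : V -> R) : clin f -> clin (fun x => - f x).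
Proof.
by move=> [lf cf]; split=> [|x]; [exact: scalar_opp|apply: cvgN; exact: cf].
Qed.

Lemma fnormal_setX {U V : normedModType R} (A : set U) (B : set V) (z : U * V) nu :
  A z.1 -> B z.2 -> fnormal (A `*` B) z nu ->
  fnormal A z.1 (fun u => nu (u, 0)) /\ fnormal B z.2 (fun v => nu (0, v)).
Proof.
move=> Az Bz [cnu nuN].
split; (split; first by [exact: clin_pairx0|exact: clin_pair0x]);
    move=> eps /nuN[delta delta0 nu_le]; exists delta => // w Aw wd.
- have dE : (w, z.2) - z = (w - z.1, 0) :> U * V.
    by apply: injective_projections; rewrite //= subrr.
  by have := nu_le (w, z.2) (conj Aw Bz); rewrite dE norm_pairx0; exact.
- have dE : (z.1, w) - z = (0, w - z.2) :> U * V.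
    by apply: injective_projections; rewrite //= subrr.
  by have := nu_le (z.1, w) (conj Az Aw); rewrite dE norm_pair0x; exact.
Qed.

End FrechetNormals.

Section DecoupledMinimizer.
Context {R : realType} {U V : completeNormedModType R}.
Local Notation cball := (closed_ball_ Num.norm).
Variables (A : set U) (B : set V) (s : U * V -> R) (C rho : R) (a0 : U) (b0 : V).
Hypotheses (U_asplund : asplund U) (V_asplund : asplund V).
Hypothesis rho_gt0 : 0 < rho.
Hypothesis A_closed : closed (A `&` cball a0 rho).
Hypothesis B_closed : closed (B `&` cball b0 rho).
Hypothesis s_sub : sublinear s.
Hypothesis C_ge0 : 0 <= C.
Hypothesis s_le : forall x, s x <= C * `|x|.
Hypotheses (A_a0 : A a0) (B_b0 : B b0).
Hypothesis local_min : forall a b, A a -> cball a0 rho a -> B b -> cball b0 rho b ->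
  0 <= s (a0 - a, b0 - b).

Lemma normals_at_decoupled_minimizer (gam : R) : 0 < gam ->
  exists a b nu mu,
  [/\ A a /\ `|a0 - a| < gam, B b /\ `|b0 - b| < gam, fnormal A a nu, fnormal B b mu &
      forall u v, nu u + mu v <= s (u, v) + gam * `|(u, v) : U * V|].
Proof.
move=> gam0; pose g := Num.min gam rho.
have g0 : 0 < g by rewrite lt_min gam0.
pose S := (A `&` cball a0 rho) `*` (B `&` cball b0 rho).
have S_closed : closed S.
  have closed_fst := (continuous_closedP (fst : U * V -> U)).1 (fun=> cvg_fst).
  have closed_snd := (continuous_closedP (snd : U * V -> V)).1 (fun=> cvg_snd).
  by apply: closedI; [exact: closed_fst|exact: closed_snd].
have center (W : normedModType R) (w : W) : cball w rho w.
  by rewrite /closed_ball_ /= subrr normr0 ltW.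
have S0 : S (a0, b0) := conj (conj A_a0 (center _ a0)) (conj B_b0 (center _ b0)).
have S_min e : S e -> 0 <= s ((a0, b0) - e) by case=> -[Aa Ba] [Ab Bb]; exact: local_min.
have [[a b] [nu [[[Aa Ba] [Bb Cb]] near nuN nu_le]]] :=
  normal_at_minimizer (asplund_prod U_asplund V_asplund) S_closed s_sub C_ge0 s_le
    S0 S_min g0.
have near_a : `|a0 - a| < g by rewrite distrC; exact: le_lt_trans (norm_fst _) near.
have near_b : `|b0 - b| < g by rewrite distrC; exact: le_lt_trans (norm_snd _) near.
have [nu1 nu2] := fnormal_setX (conj Aa Ba) (conj Bb Cb) nuN.
have lt_g x : x < g -> x < gam by move=> /lt_le_trans; apply; rewrite /g ge_min lexx.
have lt_rho x : x < g -> x < rho.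
  by move=> /lt_le_trans; apply; rewrite /g ge_min lexx orbT.
exists a, b, (fun u => nu (u, 0)), (fun v => nu (0, v)); split.
- by split=> //; exact: lt_g.
- by split=> //; exact: lt_g.
- exact: fnormal_local (cball_nbhs (lt_rho _ near_a)) nu1.
- exact: fnormal_local (cball_nbhs (lt_rho _ near_b)) nu2.
move=> u v; rewrite -(scalar_pairE (u, v) (fnormal_scalar nuN)).
apply: le_trans (nu_le _) _; rewrite lerD2l ler_wpM2r//.
by rewrite /g ge_min lexx.
Qed.

End DecoupledMinimizer.

(** * Subgradients of scalarizations of Lipschitz maps *)

Section LipschitzSets.
Context {R : realType} {X Z : normedModType R}.
Implicit Types (D : set X) (h : X -> Z).

Definition function_graph h : set (X * Z) := [set w | w.2 = h w.1].

Lemma ler_addgt0_mul (x y c : R) :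
  0 <= c -> (forall eps, 0 < eps -> x <= y + c * eps) -> x <= y.
Proof.
move=> c0 le_xy; apply/ler_addgt0Pr => eps eps0; have c1 : 0 < 1 + c by lra.
apply: le_trans (le_xy _ (divr_gt0 eps0 c1)) _; rewrite lerD2l mulrCA.
by rewrite ler_piMr ?(ltW eps0)// ler_pdivrMr//; lra.
Qed.

Lemma closed_fst_preimage (Y : normedModType R) D :
  closed D -> closed [set w : X * Y | D w.1].
Proof. by apply: (continuous_closedP (fst : X * Y -> X)).1 => x; exact: cvg_fst. Qed.

Lemma closed_setI_cball (Y : normedModType R) D (S : set (X * Y)) (w0 : X * Y) (r : R) :
  closed_ball_ Num.norm w0.1 r `<=` D -> closed ([set w | D w.1] `&` S) ->
  closed (S `&` closed_ball_ Num.norm w0 r).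
Proof.
move=> ball_D S_closed.
have -> : S `&` closed_ball_ Num.norm w0 r =
    ([set w | D w.1] `&` S) `&` closed_ball_ Num.norm w0 r.
  apply/seteqP; split=> w; last by case=> -[].
  case=> Sw w_near; split=> //; split=> //.
  exact: ball_D (le_trans (norm_fst (w0 - w)) w_near).
by apply: closedI => //; exact: closed_closed_ball_.
Qed.

Lemma closed_graph_lipschitz D h (L : R) : closed D -> 0 <= L -> L.-lipschitz_D h ->
  closed ([set w | D w.1] `&` function_graph h).
Proof.
move=> D_closed L0 h_lip w clw.
have Dw : D w.1.
  apply: (closed_fst_preimage D_closed); apply: closureS clw; exact: subIsetl.
split=> //; apply/eqP; rewrite -subr_eq0 -normr_le0.
apply: (@ler_addgt0_mul _ _ (1 + L)) => [|eps eps0]; first by rewrite addr_ge0.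
have [w' [Dw' w'E] ww'] := (closure_normP _ _).1 clw _ eps0.
rewrite add0r -(subrKA w'.2) {2}w'E; apply: le_trans (ler_normD _ _) _.
have := h_lip (w'.1, w.1) (conj Dw' Dw); rewrite /= [`|w'.1 - _|]distrC.
have := ler_wpM2l L0 (le_trans (norm_fst (w - w')) (ltW ww')).
by have := norm_snd (w - w'); rewrite /=; lra.
Qed.

Lemma closed_epi_lipschitz D (phi : X -> R) (L : R) : closed D -> 0 <= L ->
  L.-lipschitz_D (phi : X -> R^o) -> closed ([set w | D w.1] `&` epi phi).
Proof.
move=> D_closed L0 phi_lip w clw.
have Dw : D w.1.
  apply: (closed_fst_preimage D_closed); apply: closureS clw; exact: subIsetl.
split=> //; apply: (@ler_addgt0_mul _ _ (1 + L)) => [|eps eps0].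
  by rewrite addr_ge0.
have [w' [Dw' w'E] ww'] := (closure_normP _ _).1 clw _ eps0.
have := ler_normlW (phi_lip (w.1, w'.1) (conj Dw Dw')) => /= phiL.
have := le_trans (norm_fst (w - w')) (ltW ww') => /(ler_wpM2l L0).
have := le_trans (norm_snd (w - w')) (ltW ww'); rewrite /= distrC => /ler_normlW.
by move: w'E; rewrite /epi /=; lra.
Qed.

End LipschitzSets.

Section ScalarizedSubgradients.
Context {R : realType}.
Local Notation cball := (closed_ball_ Num.norm).

Definition scalarized_subgradient {X Z : normedModType R} (h : X -> Z) (x : X)
    (zeta : Z -> R) (xi : X -> R) : Prop :=
  forall eps : R, 0 < eps -> exists2 delta : R, 0 < delta & forall x',
    `|x' - x| < delta -> xi (x' - x) - zeta (h x' - h x) <= eps * `|x' - x|.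

Lemma subgradient_of_graph_normal {X Z : normedModType R} (h : X -> Z) (x : X) nu
    (N : set X) (L : R) : nbhs x N -> 0 <= L -> L.-lipschitz_N h ->
  fnormal (function_graph h) (x, h x) nu ->
  scalarized_subgradient h x (fun z => - nu (0, z)) (fun u => nu (u, 0)).
Proof.
move=> /nbhs_normP[rho /= rho0 rhoN] L0 h_lip [[lnu _] nuN] eps eps0.
have L1 : 0 < 1 + L by rewrite ltr_wpDr.
have [delta delta0 nu_le] := nuN _ (divr_gt0 eps0 L1).
exists (Num.min (delta / (1 + L)) rho) => [|x']; first by rewrite lt_min divr_gt0.
rewrite lt_min ltr_pdivlMr// => /andP[x'd x'r].
have Nx : N x by apply: rhoN; rewrite /= subrr normr0.
have Nx' : N x' by apply: rhoN; rewrite /= distrC.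
have dist_le : `|(x', h x') - (x, h x) : X * Z| <= `|x' - x| * (1 + L).
  have hx := h_lip (x', x) (conj Nx' Nx); have x0 := normr_ge0 (x' - x).
  apply: norm_pair_le => /=; first by rewrite ler_peMr// lerDl.
  by move: hx => /=; have := mulr_ge0 L0 x0; lra.
have := nu_le (x', h x') erefl (le_lt_trans dist_le x'd).
rewrite (scalar_pairE _ lnu) /= opprK => /le_trans; apply.
rewrite mulrC in dist_le; rewrite mulrAC ler_pdivrMr// -mulrA ler_pM2l// mulrC.
exact: dist_le.
Qed.

Section Splitting.
Context {X Z : completeNormedModType R}.
Variables (h : X -> Z) (xbar : X) (rho L C : R) (zst : Z -> R).
Hypotheses (X_asplund : asplund X) (Z_asplund : asplund Z).
Hypotheses (L_ge0 : 0 <= L) (C_ge0 : 0 <= C).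
Hypothesis h_lip : L.-lipschitz_(cball xbar rho) h.
Hypothesis zst_form : bounded_form C zst.

Local Notation phi := (fun x => zst (h x)).

Record subgradient_splitting (x : X) (zeta : Z -> R) (xi : X -> R) (gam : R) := {
  epi_point : X * R^o;
  graph_point : X;
  epi_slope : X -> R;
  epi_scale : R;
  graph_slope : X -> R;
  graph_weight : Z -> R;
  epi_pointP : epi phi epi_point;
  epi_point_near : `|(x, phi x : R^o) - epi_point| <= gam;
  epi_scale_near : `|epi_scale - 1| <= gam;
  epi_normal : fnormal (epi phi) epi_point (fun q => epi_slope q.1 - epi_scale * q.2);
  graph_point_near : `|x - graph_point| <= gam;
  graph_subgradient :
    scalarized_subgradient h graph_point graph_weight graph_slope;
  graph_slope_scalar : scalar graph_slope;
  graph_weight_scalar : scalar graph_weight;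
  graph_weight_near : forall z, `|graph_weight z - (zeta z - zst z)| <= gam * `|z|;
  slopes_near : forall u, `|epi_slope u + graph_slope u - xi u| <= gam * `|u| }.

Variables (x : X) (zeta : Z -> R) (xi : X -> R).
Hypothesis zeta_form : bounded_form C zeta.

Lemma graph_weight_form gam (m : subgradient_splitting x zeta xi gam) :
  bounded_form (gam + C + C) (graph_weight m).
Proof.
apply: bounded_form_le => [|z]; first exact: graph_weight_scalar.
have := ler_normlW (graph_weight_near m z).
have := bounded_form_ub zeta_form z; have := bounded_form_ub zst_form (- z).
by rewrite (scalarN _ zst_form.1) normrN; lra.
Qed.

Hypothesis x_near : `|xbar - x| < rho.
Hypothesis xi_form : bounded_form C xi.
Hypothesis x_subgradient : scalarized_subgradient h x zeta xi.

(* The first two terms and [xi] express the minimality of x for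
   <zst, h> + <zeta - zst, h> - xi; the last one, an exact penalty for
   decoupling the two occurrences of the variable. *)
Definition splitting_objective (eps : R) (q : (X * R^o) * (X * Z)) : R :=
  - q.1.2 + (zst q.2.2 - zeta q.2.2) + xi q.1.1 + eps * `|q.2.1|
  + (C * L + C) * `|q.1.1 - q.2.1|.

Let D_ge0 : 0 <= C * L + C.
Proof. by rewrite addr_ge0// mulr_ge0. Qed.

Lemma splitting_objective_sublinear eps : 0 <= eps -> sublinear (splitting_objective eps).
Proof.
move=> eps0; apply: sublinearD; last first.
  apply: sublinearZ => //.
  apply: (sublinear_comp (l := fun q : (X * R^o) * (X * Z) => q.1.1 - q.2.1)).
    exact: norm_sublinear.
  by move=> t q q'; rewrite /= scalerBr opprD addrACA.
apply: sublinearD; last first.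
  apply: sublinearZ => //.
  apply: (sublinear_comp (l := fun q : (X * R^o) * (X * Z) => q.2.1)) => //.
  exact: norm_sublinear.
apply: scalar_sublinear => t q q'.
by rewrite /= zst_form.1 zeta_form.1 xi_form.1 /GRing.scale /=; ring.
Qed.

Lemma splitting_objective_le eps q : 0 <= eps ->
  splitting_objective eps q <= (1 + C + C + C + eps + 2 * (C * L + C)) * `|q|.
Proof.
move=> eps0.
have n11 := le_trans (norm_fst q.1) (norm_fst q).
have n12 := le_trans (norm_snd q.1) (norm_fst q).
have n21 := le_trans (norm_fst q.2) (norm_snd q).
have n22 := le_trans (norm_snd q.2) (norm_snd q).
have := bounded_form_ub xi_form q.1.1; have := ler_wpM2l C_ge0 n11.
have := bounded_form_ub zst_form q.2.2; have := ler_wpM2l C_ge0 n22.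
have := bounded_form_ub zeta_form (- q.2.2); rewrite (scalarN _ zeta_form.1) normrN.
have := ler_wpM2l eps0 n21; have := ler_norm (- q.1.2); rewrite normrN.
have := ler_wpM2l D_ge0 (le_trans (ler_normB q.1.1 q.2.1) (lerD n11 n21)).
by rewrite /splitting_objective; lra.
Qed.

Lemma splitting_objective_min eps : 0 < eps -> exists2 r : R, 0 < r &
  r <= rho - `|xbar - x| /\
  forall a b, epi phi a -> cball (x, phi x : R^o) r a ->
    function_graph h b -> cball (x, h x) r b ->
    0 <= splitting_objective eps ((x, phi x : R^o) - a, (x, h x) - b).
Proof.
move=> eps0; have [delta delta0 sub] := x_subgradient eps0.
exists (Num.min (delta / 2) (rho - `|xbar - x|)).
  by rewrite lt_min divr_gt0// subr_gt0.
set r := Num.min _ _; split=> [|[u t] [v z]]; first by rewrite /r ge_min lexx orbT.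
rewrite /epi /function_graph /= => tu a_near -> b_near.
have r_delta : r < delta.
  by apply: (@le_lt_trans _ _ (delta / 2)); [rewrite /r ge_min lexx|lra].
have in_ball : cball x r `<=` cball xbar rho.
  by apply: cball_subset; rewrite -lerBrDl /r ge_min lexx orbT.
have u_near : `|x - u| <= r := le_trans (norm_fst ((x, phi x : R^o) - (u, t))) a_near.
have v_near : `|x - v| <= r := le_trans (norm_fst ((x, h x) - (v, h v))) b_near.
have := sub v; rewrite distrC => /(_ (le_lt_trans v_near r_delta)).
have := ler_wpM2l C_ge0 (@h_lip (v, u) (conj (in_ball v v_near) (in_ball u u_near))).
have := bounded_form_ub zst_form (h v - h u); rewrite (scalarB _ _ zst_form.1).
have := bounded_form_ub xi_form (u - v); rewrite (scalarB _ _ xi_form.1) /=.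
have uvE : x - u - (x - v) = v - u by rewrite opprB addrC subrKA.
rewrite /splitting_objective /= uvE [`|u - v|]distrC.
rewrite !(scalarB _ _ zst_form.1) !(scalarB _ _ zeta_form.1) !(scalarB _ _ xi_form.1).
by move: tu; lra.
Qed.

Let phi_lip : (C * L).-lipschitz_(cball xbar rho) (phi : X -> R^o).
Proof.
move=> [u v] uv /=; rewrite -(scalarB _ _ zst_form.1) -mulrA.
by apply: le_trans (zst_form.2 _) _; apply: ler_wpM2l => //; exact: h_lip uv.
Qed.

Lemma splitting_estimates (nu : X * R^o -> R) (mu : X * Z -> R) (eps g gam : R) :
  scalar nu -> scalar mu -> 0 <= eps -> 0 <= g -> eps + g <= gam ->
  (forall u v, nu u + mu v <=
    splitting_objective eps (u, v) + g * `|(u, v) : (X * R^o) * (X * Z)|) ->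
  [/\ `|- nu (0, 1) - 1| <= gam,
      forall z, `|- mu (0, z) - (zeta z - zst z)| <= gam * `|z| &
      forall u, `|nu (u, 0) + mu (u, 0) - xi u| <= gam * `|u|].
Proof.
move=> lnu lmu eps0 g0 g_gam le_obj.
have [nu0 mu0] := (scalar0 lnu, scalar0 lmu).
have [zst0 zeta0] := (scalar0 zst_form.1, scalar0 zeta_form.1).
have xi0 := scalar0 xi_form.1.
have gamM t : 0 <= t -> (eps + g) * t <= gam * t by move=> t0; exact: ler_wpM2r.
split=> [|z|u0].
- have := le_obj (0, 1) 0; have := le_obj (0, -1) 0.
  rewrite !norm_pairx0 !norm_pair0x normrN normr1 mulr1 mu0 /splitting_objective /=.
  have -> : nu (0, -1) = - nu (0, 1) by rewrite -(scalarN _ (scalar_pair0x lnu)).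
  rewrite zst0 zeta0 xi0 !subrr !normr0 ler_norml.
  by move=> ? ?; apply/andP; split; lra.
- rewrite -opprD normrN.
  apply: (bounded_form_le (f := fun z => mu (0, z) + (zeta z - zst z)) _ _).2
    => [a y y'|y].
    by rewrite (scalar_pair0x lmu) zeta_form.1 zst_form.1; ring.
  have := le_obj 0 (0, y); rewrite !norm_pair0x nu0 /splitting_objective /=.
  rewrite xi0 subrr !normr0; have := gamM _ (normr_ge0 y).
  by have := mulr_ge0 eps0 (normr_ge0 y); lra.
- apply: (bounded_form_le (f := fun u => nu (u, 0) + mu (u, 0) - xi u) _ _).2
    => [a u v|u].
    by rewrite (scalar_pairx0 lnu) (scalar_pairx0 lmu) xi_form.1; ring.
  have := le_obj (u, 0) (u, 0); rewrite /splitting_objective /= zst0 zeta0 !subrr normr0.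
  have : `|((u, 0), (u, 0)) : (X * R^o) * (X * Z)| <= `|u|.
    by apply: norm_pair_le; rewrite norm_pairx0.
  by move=> /(ler_wpM2l g0); have := gamM _ (normr_ge0 u); lra.
Qed.

Lemma split_subgradient (gam : R) : 0 < gam -> $| subgradient_splitting x zeta xi gam |.
Proof.
move=> gam0; have gam2 : 0 < gam / 2 by lra.
have [r r0 [r_le objective_min]] := splitting_objective_min gam2.
pose g := Num.min (gam / 2) r; have g0 : 0 < g by rewrite lt_min gam2.
have [g_gam g_r] : g <= gam / 2 /\ g <= r by rewrite /g !ge_min !lexx orbT.
have ball_closed : closed (cball xbar rho) by exact: closed_closed_ball_.
have in_ball : cball x r `<=` cball xbar rho by apply: cball_subset; rewrite -lerBrDl.
have epi_closed := closed_setI_cball (w0 := (x, phi x : R^o)) in_ball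
  (closed_epi_lipschitz ball_closed (mulr_ge0 C_ge0 L_ge0) phi_lip).
have graph_closed := closed_setI_cball (w0 := (x, h x)) in_ball
  (closed_graph_lipschitz ball_closed L_ge0 h_lip).
have bound_ge0 : 0 <= 1 + C + C + C + gam / 2 + 2 * (C * L + C).
  by have := D_ge0; have := C_ge0; lra.
have [w [[v z] [nu [mu [[epi_w w_near] [zE v_near] nuN muN le_obj]]]]] :=
  normals_at_decoupled_minimizer (asplund_prod X_asplund asplund_real)
    (asplund_prod X_asplund Z_asplund) r0 epi_closed graph_closed
    (splitting_objective_sublinear (ltW gam2)) bound_ge0
    (fun q => splitting_objective_le q (ltW gam2)) (lexx _) erefl objective_min g0.
rewrite /function_graph /= in zE; rewrite {z}zE in muN v_near.
have [lnu lmu] := (fnormal_scalar nuN, fnormal_scalar muN).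
have [|scale_near weight_near slope_near] :=
  splitting_estimates (gam := gam) lnu lmu (ltW gam2) (ltW g0) _ le_obj; first by lra.
have nuE : nu = (fun q => nu (q.1, 0) - - nu (0, 1) * q.2).
  by apply/funext => q; rewrite (scalar_pair_realE q lnu) mulNr opprK mulrC.
have v_near' : `|x - v| < g := le_lt_trans (norm_fst ((x, h x) - (v, h v))) v_near.
have v_ball : nbhs v (cball xbar rho).
  by apply: cball_nbhs; have := ler_normD (xbar - x) (x - v); rewrite subrKA; lra.
apply: squash; apply: (@Build_subgradient_splitting x zeta xi gam w v
  (fun u => nu (u, 0)) (- nu (0, 1)) (fun u => mu (u, 0)) (fun z => - mu (0, z))
  epi_w _ scale_near _ _ (subgradient_of_graph_normal v_ball L_ge0 h_lip muN)
  (scalar_pairx0 lmu) (scalar_opp (scalar_pair0x lmu)) weight_near slope_near).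
- by rewrite (le_trans (ltW w_near))//; lra.
- by rewrite -nuE.
- by lra.
Qed.

End Splitting.
End ScalarizedSubgradients.

(** * Weak-star sequential compactness *)

Section Subsequences.

Lemma infinite_natP (A : set nat) :
  infinite_set A -> forall N, exists2 n, (N <= n)%N & A n.
Proof.
move=> Ainf N; apply: contrapT => noA; apply: Ainf.
apply: sub_finite_set (finite_II N) => n An /=.
by rewrite ltnNge; apply/negP => Nn; apply: noA; exists n.
Qed.

Lemma finite_nat_bound (A : set nat) :
  finite_set A -> exists N, forall n, A n -> (n < N)%N.
Proof.
move=> /finite_seqP[s ->]; exists (\max_(i <- s) i).+1 => n /= ns.
by rewrite ltnS; apply: leq_bigmax_seq.
Qed.

Lemma diagonal_subsequence (A : nat -> set nat) : (forall k, infinite_set (A k)) ->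
  exists2 phi : nat -> nat, {homo phi : m n / (m < n)%N} & forall k, A k (phi k).
Proof.
move=> Ainf; have /choice[pick pickP] : forall t : nat * nat, exists n,
    (t.2 <= n)%N /\ A t.1 n.
  by move=> [k N]; have [n Nn An] := infinite_natP (Ainf k) N; exists n.
pose phi := fix phi k := if k is k'.+1 then pick (k, (phi k').+1) else pick (0, 0)%N.
exists phi; last by case=> [|k]; [exact: (pickP (0, 0)%N).2|exact: (pickP (k.+1, _)).2].
by apply: homo_ltn; [exact: ltn_trans|move=> k; exact: (pickP (k.+1, _)).1].
Qed.

Lemma homo_ge_id (phi : nat -> nat) n : {homo phi : m n / (m < n)%N} -> (n <= phi n)%N.
Proof.
by move=> phi_mono; elim: n => // n IH; apply: leq_ltn_trans IH (phi_mono _ _ _).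
Qed.

Lemma cvg_subseq {V : topologicalType} (u : nat -> V) (l : V) (phi : nat -> nat) :
  {homo phi : m n / (m < n)%N} -> u @ \oo --> l -> (fun k => u (phi k)) @ \oo --> l.
Proof.
move=> phi_mono; apply: cvg_comp => A [N _ NA]; exists N => // n /= Nn.
exact/NA/(leq_trans Nn)/homo_ge_id.
Qed.

Lemma cantor_not_injective (T : Type) (N : (T -> bool) -> T) : ~ injective N.
Proof.
move=> Ninj; have /choice[inv invP] : forall t, exists b0,
    (exists b, N b = t) -> N b0 = t.
  move=> t; have [[b bt]|nt] := pselect (exists b, N b = t); first by exists b.
  by exists (fun=> true).
pose d t := ~~ inv t t; have invd : inv (N d) = d by apply/Ninj/invP; exists d.
have : d (N d) = ~~ d (N d) by rewrite {1}/d invd.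
by case: (d (N d)).
Qed.

End Subsequences.

Section WeakStarCompactness.
Context {R : realType} {X : completeNormedModType R}.
Variables (fn : nat -> X -> R) (C : R).
Hypothesis X_asplund : asplund X.
Hypothesis fn_form : forall n, bounded_form C (fn n).
Implicit Types (A B : set nat) (eps : R) (x : X).

Definition small_oscillation A eps : Prop := forall x, exists N : nat, forall m n,
  A m -> A n -> (N <= m)%N -> (N <= n)%N -> `|fn m x - fn n x| <= eps * `|x|.

Definition upper_part B eps x (b : R) : set nat :=
  [set n | B n /\ b + eps * `|x| <= fn n x].
Definition lower_part B x (b : R) : set nat := [set n | B n /\ fn n x <= b].

Lemma large_oscillation_split B eps : 0 < eps -> infinite_set B ->
  ~ small_oscillation B (8 * eps) -> exists x b,
  [/\ 0 < `|x|, infinite_set (upper_part B eps x b) & infinite_set (lower_part B x b)].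
Proof.
move=> eps0 Binf /existsNP[x osc].
have osc_ge N : exists m n, [/\ B m, B n, (N <= m)%N, (N <= n)%N &
    8 * eps * `|x| < `|fn m x - fn n x|].
  apply: contrapT => no_osc; apply: osc; exists N => m n Bm Bn Nm Nn.
  by rewrite leNgt; apply/negP => gt_osc; apply: no_osc; exists m, n.
have x0 : 0 < `|x|.
  rewrite normr_gt0; apply/eqP => x0; have [m [n [_ _ _ _]]] := osc_ge 0%N.
  by rewrite x0 !(scalar0 (fn_form _).1) subrr !normr0 mulr0 ltxx.
pose eta := eps * `|x|; have eta0 : 0 < eta by rewrite mulr_gt0.
have fn_itv n : - (C * `|x|) <= fn n x <= C * `|x| by rewrite -ler_norml (fn_form n).2.
pose S := [set r : R | infinite_set [set n | B n /\ r <= fn n x]].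
have S_sup : has_sup S.
  split.
    exists (- (C * `|x|)); apply: sub_infinite_set Binf => n Bn; split=> //.
    by have /andP[] := fn_itv n.
  exists (C * `|x|) => r /infinite_natP/(_ 0%N)[n _ [_ rn]].
  by apply: le_trans rn _; have /andP[] := fn_itv n.
exists x, (sup S - 2 * eta); split=> // [|low_fin].
  have [r Sr r_near] := sup_adherent eta0 S_sup.
  apply: sub_infinite_set Sr => n [Bn rn]; split=> //.
  by rewrite -/eta; lra.
have up_fin : finite_set [set n | B n /\ sup S + eta <= fn n x].
  apply: contrapT => /(ub_le_sup S_sup.2); lra.
have [N1 low_lt] := finite_nat_bound low_fin; have [N2 up_lt] := finite_nat_bound up_fin.
have [m [n [Bm Bn]]] := osc_ge (maxn N1 N2); rewrite !geq_max.
move=> /andP[N1m N2m] /andP[N1n N2n]; rewrite -mulrA -/eta.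
have low k : B k -> (N1 <= k)%N -> sup S - 2 * eta < fn k x.
  move=> Bk; rewrite leqNgt ltNge => /negP Nk; apply/negP => fk; apply: Nk.
  exact: low_lt.
have up k : B k -> (N2 <= k)%N -> fn k x < sup S + eta.
  move=> Bk; rewrite leqNgt ltNge => /negP Nk; apply/negP => fk; apply: Nk.
  exact: up_lt.
have := low m Bm N1m; have := low n Bn N1n; have := up m Bm N2m; have := up n Bn N2n.
by rewrite ltr_normr => ? ? ? ? /orP[]; lra.
Qed.

(* If no infinite subset of A had small oscillation, the successive splittings
   would form a dyadic tree, whose branches yield a continuum of functionals
   uniformly separated on a separable subspace. *)
Section DyadicTree.
Variables (A : set nat) (eps : R) (point : set nat -> X) (level : set nat -> R).
Hypothesis eps_gt0 : 0 < eps.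
Hypothesis A_infinite : infinite_set A.
Hypothesis split_subset : forall B, B `<=` A -> infinite_set B ->
  [/\ 0 < `|point B|, infinite_set (upper_part B eps (point B) (level B)) &
      infinite_set (lower_part B (point B) (level B))].
Implicit Types (l : seq bool) (b : nat -> bool).

Fixpoint node l : set nat := if l is c :: l' then let B := node l' in
  if c then upper_part B eps (point B) (level B) else lower_part B (point B) (level B)
  else A.

Definition branch b (k : nat) : seq bool := rev (mkseq b k).

Lemma branchS b k : branch b k.+1 = b k :: branch b k.
Proof. by rewrite /branch mkseqS rev_rcons. Qed.

Lemma node_infinite l : node l `<=` A /\ infinite_set (node l).
Proof.
elim: l => [|c l [lA l_inf]]; first by split.
have [_ up low] := split_subset lA l_inf.
by case: c; split=> // n [] /lA.
Qed.

Lemma node_point_gt0 l : 0 < `|point (node l)|.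
Proof. by have [lA l_inf] := node_infinite l; have [] := split_subset lA l_inf. Qed.

Lemma node_branch_sub b j k : (j <= k)%N -> node (branch b k) `<=` node (branch b j).
Proof.
move=> /subnK <-; elim: (k - j)%N => [//|i IH] n; rewrite addSn branchS /=.
by case: (b _) => -[/IH].
Qed.

Definition follows_branch b (f : X -> R) : Prop := forall k, let B := node (branch b k) in
  if b k then level B + eps * `|point B| <= f (point B) else f (point B) <= level B.

Lemma branch_functional b : exists2 f, bounded_form C f & follows_branch b f.
Proof.
have /choice[ph phP] : forall k, exists n, node (branch b k) n.
  move=> k; have [_ /infinite_natP/(_ 0%N)[n _]] := node_infinite (branch b k).
  by exists n.
have [U [UU ooU]] := free_ultrafilter.
have /choice[f fP] : forall x, exists l : R, (fun k => fn (ph k) x) @ U --> l.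
  by move=> x; apply: (ultra_cvg (B := C * `|x|)) => k; exact: (fn_form _).2.
exists f => [|k]; first exact: (bounded_form_cvg (fun k => fn_form (ph k)) fP).
have eventually_node : \forall j \near U, node (branch b k.+1) (ph j).
  by apply: ooU; exists k.+1 => // j kj; exact: node_branch_sub kj _ (phP j).
move: eventually_node; rewrite branchS /=; case: (b k) => node_k.
  apply: (ler_cvg_to (cvg_cst _) (fP _)).
  by apply: filterS node_k => j [].
apply: (ler_cvg_to (fP _) (cvg_cst _)).
by apply: filterS node_k => j [].
Qed.

Lemma branch_first_difference b b' : b != b' -> exists2 k,
  branch b k = branch b' k & b k != b' k.
Proof.
move=> bb'; have ex : exists k, b k != b' k.
  apply: contrapT => no_k; move/eqP: bb'; apply; apply/funext => k; apply/eqP.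
  by apply: contrapT => /negP kk'; apply: no_k; exists k.
exists (ex_minn ex); case: ex_minnP => k kk' kmin //.
rewrite /branch; congr rev; apply/eq_in_map => j; rewrite mem_iota /= => jk.
by apply/eqP; apply: contraTT jk => /kmin; rewrite -leqNgt.
Qed.

Lemma splittings_not_everywhere : False.
Proof.
have [T [Tsub Tsep Tpoint]] := separable_subspace_containing
  (fun n => point (node (odflt [::] (unpickle n)))).
have T_point l : T (point (node l)) by have := Tpoint (pickle l); rewrite pickleK.
have /choice[F FP] : forall b, exists f, bounded_form C f /\ follows_branch b f.
  by move=> b; have [f] := branch_functional b; exists f.
have [fs [_ fs_dense]] := X_asplund Tsub Tsep.
have eps4 : 0 < eps / 4 by rewrite divr_gt0.
have /choice[N NP] : forall b, exists n, forall y, T y ->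
    `|F b y - fs n y| <= eps / 4 * `|y|.
  move=> b; have [lF bF] := bounded_form_functional T (FP b).1; exact: fs_dense.
apply: (@cantor_not_injective _ N) => b b' NN; apply/eqP; apply: contrapT => /negP bb'.
have [k kE kk'] := branch_first_difference bb'.
have := (FP b).2 k; have := (FP b').2 k; rewrite /= -kE.
have := NP b _ (T_point (branch b k)); have := NP b' _ (T_point (branch b k)).
have := mulr_gt0 eps_gt0 (node_point_gt0 (branch b k)); rewrite -NN !ler_norml.
move: (node _) => B eps_pt /andP[? ?] /andP[? ?].
by move: kk'; case: (b k); case: (b' k) => //= _; lra.
Qed.

End DyadicTree.

Lemma small_oscillation_subset A eps : 0 < eps -> infinite_set A ->
  exists A', [/\ A' `<=` A, infinite_set A' & small_oscillation A' eps].
Proof.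
move=> eps0 Ainf; apply: contrapT => no_small.
have eps8 : 0 < eps / 8 by lra.
have /choice[t tP] : forall B, exists t : X * R, B `<=` A -> infinite_set B ->
    [/\ 0 < `|t.1|, infinite_set (upper_part B (eps / 8) t.1 t.2) &
        infinite_set (lower_part B t.1 t.2)].
  move=> B; have [[BA Binf]|nB] := pselect (B `<=` A /\ infinite_set B); last first.
    by exists (0, 0) => BA Binf; case: nB.
  have [|x [b xb]] := large_oscillation_split eps8 Binf; last by exists (x, b).
  by rewrite mulrC divfK ?pnatr_eq0// => osc; apply: no_small; exists B.
exact: (splittings_not_everywhere eps8 Ainf tP).
Qed.

Lemma weak_star_subsequence : exists2 phi : nat -> nat,
  {homo phi : m n / (m < n)%N} & exists2 f, bounded_form C f &
  forall x, (fun k => fn (phi k) x) @ \oo --> f x.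
Proof.
have /choice[G GP] : forall t : set nat * nat, exists A', infinite_set t.1 ->
    [/\ A' `<=` t.1, infinite_set A' & small_oscillation A' (harmonic t.2)].
  move=> [A k]; have [Ainf|Afin] := pselect (infinite_set A); last by exists A.
  by have [A' A'P] := small_oscillation_subset (harmonic_gt0 k) Ainf; exists A'.
pose As := fix As k : set nat := if k is k'.+1 then G (As k', k') else setT.
have As_inf k : infinite_set (As k).
  by elim: k => [|k IH]; [exact: infinite_nat|have [] := GP (As k, k) IH].
have As_sub j k : (j <= k)%N -> As k `<=` As j.
  move=> /subnK <-; elim: (k - j)%N => [//|i IH] n; rewrite addSn => Asn.
  by apply: IH; have [sub _ _] := GP (As (i + j), (i + j))%N (As_inf _); exact: sub.
have [phi phi_mono phiA] := diagonal_subsequence As_inf.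
exists phi => //; have /choice[f fP] : forall x, exists l : R,
    (fun k => fn (phi k) x) @ \oo --> l.
  move=> x; suff /cauchy_cvgP/cvg_ex : cauchy ((fun k => fn (phi k) x) @ \oo) by [].
  apply: cauchy_exP => eps eps0; have x1 : 0 < 1 + `|x| by rewrite ltr_wpDr.
  have [k k_eps] := harmonic_lt (divr_gt0 eps0 x1).
  have [_ _ /(_ x)[N NP]] := GP (As k, k) (As_inf k).
  pose n0 := maxn N k.+1; exists (fn (phi n0) x); exists n0 => // n /=.
  have in_As j : (n0 <= j)%N -> As k.+1 (phi j) /\ (N <= phi j)%N.
    rewrite geq_max => /andP[Nj kj]; split; first exact: As_sub kj _ (phiA j).
    exact: leq_trans Nj (homo_ge_id _ phi_mono).
  move=> /in_As[An Nn]; have [A0 N0] := in_As n0 (leqnn _).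
  rewrite -ball_normE /=; apply: le_lt_trans (NP _ _ A0 An N0 Nn) _.
  move: k_eps; rewrite ltr_pdivlMr// => /(le_lt_trans _); apply.
  by apply: ler_wpM2l; [exact: harmonic_ge0|rewrite lerDr].
by exists f => //; exact: (bounded_form_cvg (fun k => fn_form (phi k)) fP).
Qed.

End WeakStarCompactness.

(** * Strictly Lipschitz maps and limiting subgradients *)

Section StrictlyLipschitz.
Context {R : realType} {X Z : normedModType R}.
Implicit Types (h : X -> Z) (x v : X) (zeta : Z -> R) (xi : X -> R).

Lemma weak_star_strong_cvg (zs : nat -> Z -> R) zeta (C : R) (q : nat -> Z) (l : Z) :
  (forall k, bounded_form C (zs k)) -> (forall z, (fun k => zs k z) @ \oo --> zeta z) ->
  q @ \oo --> l -> (fun k => zs k (q k)) @ \oo --> zeta l.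
Proof.
move=> zs_form zs_zeta ql.
apply: (cvg_of_dist_le (V := R^o) (C := C) (zs_zeta l) (cvg_dist0 ql)) => k.
by rewrite -(scalarB _ _ (zs_form k).1); exact: (zs_form k).2.
Qed.

Lemma subgradient_le_quotient h x v zeta xi (eps tau : R) :
  scalarized_subgradient h x zeta xi -> scalar zeta -> scalar xi -> 0 < eps -> 0 < tau ->
  exists t, [/\ 0 < t, t <= tau &
    xi v <= zeta (t^-1 *: (h (x + t *: v) - h x)) + eps].
Proof.
move=> sub lzeta lxi eps0 tau0; have v1 : 0 < 1 + `|v| by rewrite ltr_wpDr.
have [delta delta0 sub_le] := sub _ (divr_gt0 eps0 v1).
pose t := Num.min tau (delta / (1 + `|v|) / 2).
have t0 : 0 < t by rewrite lt_min tau0 !divr_gt0.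
have xtv : x + t *: v - x = t *: v by rewrite addrC addKr.
have tv_small : `|t *: v| < delta.
  rewrite normrZ (gtr0_norm t0); apply: (@le_lt_trans _ _ (delta / 2)); last by lra.
  apply: (@le_trans _ _ (delta / (1 + `|v|) / 2 * (1 + `|v|))).
    apply: ler_pM; rewrite ?(ltW t0)// ?lerDr//.
    by rewrite /t ge_min lexx orbT.
  by rewrite mulrAC divfK ?gt_eqF.
exists t; split=> //; first by rewrite /t ge_min lexx.
have := sub_le (x + t *: v); rewrite xtv => /(_ tv_small).
rewrite (scalarZ _ _ lxi) (scalarZ _ _ lzeta) normrZ (gtr0_norm t0) => le_eps.
have eps_v : eps / (1 + `|v|) * `|v| <= eps.
  by rewrite mulrAC ler_pdivrMr// ler_pM2l// lerDr.
rewrite -(ler_pM2l t0) mulrDr mulrA mulfV ?gt_eqF// mul1r.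
by have := ler_wpM2l (ltW t0) eps_v; lra.
Qed.

Section VanishingWeights.
Variables (h : X -> Z) (xbar : X) (C : R).
Variables (vs : nat -> X) (zs : nat -> Z -> R) (bs : nat -> X -> R).
Hypothesis h_strict : strictly_lipschitz h xbar.
Hypothesis vs_cvg : vs @ \oo --> xbar.
Hypothesis zs_form : forall k, bounded_form C (zs k).
Hypothesis zs_cvg0 : forall z, (fun k => zs k z) @ \oo --> (0 : R).
Hypothesis bs_scalar : forall k, scalar (bs k).
Hypothesis bs_subgradient : forall k, scalarized_subgradient h (vs k) (zs k) (bs k).

Lemma subgradients_eventually_le : exists2 d0 : R, 0 < d0 & forall v, `|v| < d0 ->
  forall eps : R, 0 < eps -> \forall k \near \oo, bs k v <= eps.
Proof.
have [_ [V0 [/nbhs_normP[d0 /= d00 d0V] V0P]]] := h_strict.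
exists d0 => // v vd eps eps0; apply: contrapT => not_near.
have large_inf : infinite_set [set k | eps < bs k v].
  move=> /finite_nat_bound[N NP]; apply: not_near; exists N => // k /= Nk.
  by rewrite leNgt; apply/negP => /NP; rewrite ltnNge Nk.
have [psi psi_mono psi_large] := diagonal_subsequence (fun=> large_inf).
have eps2 : 0 < eps / 2 by lra.
have /choice[ts tsP] : forall k, exists t, [/\ 0 < t, t <= harmonic k &
    bs (psi k) v <=
      zs (psi k) (t^-1 *: (h (vs (psi k) + t *: v) - h (vs (psi k)))) + eps / 2].
  by move=> k; exact: (subgradient_le_quotient _ (bs_subgradient _) (zs_form _).1
    (bs_scalar _) eps2 (harmonic_gt0 k)).
have ts_cvg : ts @ \oo --> (0 : R).
  apply: (@squeeze_cvgr _ _ _ _ (fun=> 0) harmonic); last exact: cvg_harmonic.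
    by apply: nearW => k; have [/ltW t0 t_le _] := tsP k; rewrite /= t0.
  exact: cvg_cst.
have [||k||phi [phi_mono [l quotients_l]]] := V0P v _ (fun k => vs (psi k)) ts.
- by apply: d0V; rewrite /= sub0r normrN.
- exact: cvg_subseq.
- by have [] := tsP k.
- exact: ts_cvg.
have zs0 z : (fun k => zs (psi (phi k)) z) @ \oo --> (0 : R).
  exact: (cvg_subseq phi_mono (cvg_subseq psi_mono (zs_cvg0 z))).
have quotients0 := weak_star_strong_cvg (fun k => zs_form (psi (phi k))) zs0 quotients_l.
suff : eps / 2 <= 0 by lra.
apply: (le_cvg_to (cvg_cst _) quotients0) => k.
by have [_ _] := tsP (phi k); have := psi_large (phi k); rewrite /=; lra.
Qed.

Lemma subgradients_cvg0 v : (fun k => bs k v) @ \oo --> (0 : R).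
Proof.
have [d0 d00 bs_le] := subgradients_eventually_le.
have near0 u : `|u| < d0 -> (fun k => bs k u) @ \oo --> (0 : R).
  move=> ud; apply/cvgr0Pnorm_le => eps eps0.
  have uNd : `|- u| < d0 by rewrite normrN.
  apply: filterS2 (bs_le u ud eps eps0) (bs_le (- u) uNd eps eps0) => k.
  by rewrite (scalarN _ (bs_scalar k)) ler_norml => -> ?; rewrite lerNl andbT.
have v1 : 0 < 1 + `|v| by rewrite ltr_wpDr.
pose c := d0 / (1 + `|v|) / 2; have c0 : 0 < c by rewrite !divr_gt0.
have cv : `|c *: v| < d0.
  rewrite normrZ (gtr0_norm c0); apply: (@le_lt_trans _ _ (c * (1 + `|v|))).
    by rewrite ler_pM2l// lerDr.
  by rewrite /c mulrAC divfK ?gt_eqF//; lra.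
have -> : (fun k => bs k v) = (fun k => c^-1 * bs k (c *: v)).
  by apply/funext => k; rewrite (scalarZ _ _ (bs_scalar k)) mulrA mulVf ?gt_eqF// mul1r.
by rewrite -(mulr0 c^-1); apply: cvgM; [exact: cvg_cst|exact: near0].
Qed.

End VanishingWeights.

Lemma lsubdiff_of_epi_normals (phi : X -> R) (xbar : X) xi
    (w : nat -> X * R^o) (a : nat -> X -> R) (th : nat -> R) :
  clin xi -> (forall k, epi phi (w k)) -> w @ \oo --> ((xbar, phi xbar) : X * R^o) ->
  (forall k, fnormal (epi phi) (w k) (fun q => a k q.1 - th k * q.2)) ->
  (forall k, 0 < th k) -> th @ \oo --> (1 : R) ->
  (forall u, (fun k => a k u) @ \oo --> xi u) -> lsubdiff phi xbar xi.
Proof.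
move=> xi_clin w_epi w_cvg normals th0 th_cvg a_cvg; split.
  apply: (clin_pair (g := fun t : R^o => - (t : R))) => //; apply: clin_opp.
  by split=> [//|t]; exact: cvg_id.
exists w, (fun k q => (th k)^-1 * (a k q.1 - th k * q.2)); split=> //; split=> //.
split=> [k|q]; first by apply: fnormal_scale; rewrite ?invr_gt0.
have -> : (fun k => (th k)^-1 * (a k q.1 - th k * q.2)) =
    (fun k => (th k)^-1 * a k q.1 - q.2).
  by apply/funext => k; rewrite mulrBr mulrA mulVf ?gt_eqF// mul1r.
apply: cvgB; last exact: cvg_cst.
rewrite -[xi _]mul1r -invr1; apply: cvgM => //.
by apply: cvgV => //; exact: oner_neq0.
Qed.

End StrictlyLipschitz.

Section LimitingSubgradient.
Context {R : realType} {X Z : completeNormedModType R}.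
Local Notation cball := (closed_ball_ Num.norm).
Variables (h : X -> Z) (xbar : X) (rho L C : R).
Hypotheses (X_asplund : asplund X) (Z_asplund : asplund Z).
Hypotheses (rho_gt0 : 0 < rho) (L_ge0 : 0 <= L) (C_ge0 : 0 <= C).
Hypothesis h_lip : L.-lipschitz_(cball xbar rho) h.
Hypothesis h_strict : strictly_lipschitz h xbar.

Lemma scalarization_cvg (zst : Z -> R) (xk : nat -> X) : bounded_form C zst ->
  (forall k, `|xbar - xk k| < rho) -> xk @ \oo --> xbar ->
  (fun k => zst (h (xk k))) @ \oo --> zst (h xbar).
Proof.
move=> zst_form xk_near xk_cvg.
apply: (cvg_of_dist_le (V := R^o) (C := C * L) (cvg_cst _) (cvg_dist0 xk_cvg)) => k.
rewrite -(scalarB _ _ zst_form.1) -mulrA; apply: le_trans (zst_form.2 _) _.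
apply: ler_wpM2l => //; apply: (@h_lip (xk k, xbar)); split=> /=; first exact: ltW.
by rewrite /closed_ball_ /= subrr normr0 ltW.
Qed.

(* Splitting the subgradient xi_k of <zeta_k, h> along zst + (zeta_k - zst), the
   part due to zeta_k - zst vanishes since h is strictly Lipschitz. *)
Lemma limiting_subgradient (zst : Z -> R) (xi : X -> R) (xk : nat -> X)
    (zk : nat -> Z -> R) (xik : nat -> X -> R) :
  bounded_form C zst -> bounded_form C xi ->
  (forall k, bounded_form C (zk k)) -> (forall k, bounded_form C (xik k)) ->
  (forall k, `|xbar - xk k| < rho) -> xk @ \oo --> xbar ->
  (forall z, (fun k => zk k z) @ \oo --> zst z) ->
  (forall u, (fun k => xik k u) @ \oo --> xi u) ->
  (forall k, scalarized_subgradient h (xk k) (zk k) (xik k)) ->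
  lsubdiff (fun x => zst (h x)) xbar xi.
Proof.
move=> zst_form xi_form zk_form xik_form xk_near xk_cvg zk_cvg xik_cvg xk_sub.
pose gam k : R := harmonic k.+1.
have gam0 k : 0 < gam k by exact: harmonic_gt0.
have gam1 k : gam k < 1 by rewrite /gam /= invf_lt1// ltr1n.
have gam_cvg : gam @ \oo --> (0 : R) by apply: (cvg_subseq _ cvg_harmonic) => m n.
pose m k := unsquash (split_subgradient X_asplund Z_asplund L_ge0 C_ge0 h_lip
  zst_form (zk_form k) (xk_near k) (xik_form k) (xk_sub k) (gam0 k)).
have weight_cvg z : (fun k => graph_weight (m k) z) @ \oo --> (0 : R).
  have diff0 : (fun k => zk k z - zst z) @ \oo --> (0 : R).
    by rewrite -(subrr (zst z)); apply: cvgB; [exact: zk_cvg|exact: cvg_cst].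
  apply: (cvg_of_dist_le (V := R^o) (C := `|z|) diff0 gam_cvg) => k.
  by rewrite mulrC; exact: graph_weight_near.
have weight_form k : bounded_form (1 + C + C) (graph_weight (m k)).
  apply: bounded_formW (graph_weight_form zst_form (zk_form k) (m k)).
  by rewrite !lerD2r ltW.
have point_cvg : (fun k => graph_point (m k)) @ \oo --> xbar.
  apply: (cvg_of_dist_le (C := 1) xk_cvg gam_cvg) => k.
  by rewrite mul1r distrC; exact: graph_point_near.
have slope_cvg u : (fun k => epi_slope (m k) u) @ \oo --> xi u.
  have graph_slope_cvg := subgradients_cvg0 h_strict point_cvg weight_form weight_cvg
    (fun k => graph_slope_scalar (m k)) (fun k => graph_subgradient (m k)) u.
  have diff_cvg : (fun k => xik k u - graph_slope (m k) u) @ \oo --> xi u.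
    by rewrite -[xi u]subr0; apply: cvgB.
  apply: (cvg_of_dist_le (V := R^o) (C := `|u|) diff_cvg gam_cvg) => k.
  by rewrite opprB addrA mulrC; exact: slopes_near.
have epi_cvg : (fun k => epi_point (m k)) @ \oo --> ((xbar, zst (h xbar)) : X * R^o).
  have base_cvg : (fun k => (xk k, zst (h (xk k))) : X * R^o) @ \oo -->
      ((xbar, zst (h xbar)) : X * R^o).
    exact: (cvg_pair xk_cvg (scalarization_cvg zst_form xk_near xk_cvg)).
  apply: (cvg_of_dist_le (C := 1) base_cvg gam_cvg) => k.
  by rewrite mul1r distrC; exact: epi_point_near.
apply: (lsubdiff_of_epi_normals (a := fun k => epi_slope (m k))
  (bounded_form_clin xi_form) (fun k => epi_pointP (m k)) epi_cvg
  (fun k => epi_normal (m k))) => // [k|].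
  have := ler_normlW (epi_scale_near (m k)); have := epi_scale_near (m k).
  by rewrite ler_norml; have := gam1 k; move: (epi_scale _) => t; lra.
apply: (cvg_of_dist_le (V := R^o) (C := 1) (cvg_cst (1 : R)) gam_cvg) => k.
by rewrite mul1r; exact: epi_scale_near.
Qed.

End LimitingSubgradient.

(** * Scalarization and multipliers *)

Section Gerstewitz.
Context {R : realType} {Z : normedModType R}.
Variables (K : set Z) (e : Z) (rho : R).
Hypotheses (K_cvx : cvx_set K) (K_cone : is_cone K).
Hypothesis rho_gt0 : 0 < rho.
Hypothesis e_ball : closed_ball_ Num.norm e rho `<=` K.
Hypothesis opp_e_notin : ~ K (- e).
Implicit Types (z w : Z) (t : R).

Definition gerstewitz z : R := inf [set t : R | K (t *: e - z)].

Let e_interior w : `|w| <= rho -> K (e + w).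
Proof. by move=> w_le; apply: e_ball; rewrite /closed_ball_ /= opprD addNKr normrN. Qed.

Lemma cone_add z w : K z -> K w -> K (z + w).
Proof.
move=> Kz Kw; have half : 0 <= (2^-1 : R) <= 1.
  by rewrite invr_ge0 ler0n /= invf_le1// ler1n.
have := K_cone (ler0n _ 2) (K_cvx Kz Kw half).
have -> : 1 - 2^-1 = 2^-1 :> R by field.
by rewrite -scalerDr scalerA divff ?scale1r// pnatr_eq0.
Qed.

Lemma cone_scale_ge0 t : K (t *: e) -> 0 <= t.
Proof.
move=> Kt; rewrite leNgt; apply/negP => t0; apply: opp_e_notin.
have tn : 0 <= (- t)^-1 by rewrite invr_ge0; lra.
by have := K_cone tn Kt; rewrite scalerA invrN mulNr mulVf ?scaleN1r// lt_eqF.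
Qed.

Lemma cone_absorbs z : K ((2 / rho * `|z|) *: e - z).
Proof.
have [->|z0] := eqVneq z 0.
  have Ke := e_interior (w := 0); rewrite addr0 normr0 in Ke.
  by have := K_cone (lexx 0) (Ke (ltW rho_gt0)); rewrite normr0 mulr0 scale0r subr0.
have t0 : 0 < 2 / rho * `|z| by rewrite mulr_gt0 ?divr_gt0 ?normr_gt0.
have -> : (2 / rho * `|z|) *: e - z =
    (2 / rho * `|z|) *: (e + - ((2 / rho * `|z|)^-1 *: z)).
  by rewrite scalerBr scalerA divff ?gt_eqF// scale1r.
apply: (K_cone (ltW t0)); apply: e_interior; rewrite ltW//.
rewrite normrN normrZ normfV (gtr0_norm t0) ltr_pdivrMl// mulrAC divfK ?gt_eqF//.
by move: z0; rewrite -normr_gt0; lra.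
Qed.

Lemma gerstewitz_has_inf z : has_inf [set t | K (t *: e - z)].
Proof.
split; first by exists (2 / rho * `|z|); exact: cone_absorbs.
exists (- (2 / rho * `|z|)) => t /= Kt.
have := cone_add Kt (cone_absorbs (- z)).
by rewrite normrN opprK addrACA addNr addr0 -scalerDl => /cone_scale_ge0; lra.
Qed.

Lemma gerstewitz_le z t : K (t *: e - z) -> gerstewitz z <= t.
Proof. by move=> Kt; exact: (ge_inf (gerstewitz_has_inf z).2 Kt). Qed.

Lemma gerstewitz_bound z : gerstewitz z <= 2 / rho * `|z|.
Proof. exact: gerstewitz_le (cone_absorbs z). Qed.

Lemma gerstewitz_sublinear : sublinear gerstewitz.
Proof.
apply: sublinear_inf gerstewitz_has_inf _ _ => [w w' t t' Kt Kt'|t w r t0 Kr].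
  exists (t + t') => //=; have := cone_add Kt Kt'.
  by rewrite addrACA -scalerDl -opprD.
by exists (t * r) => //=; rewrite -scalerA -scalerBr; apply: K_cone => //; exact: ltW.
Qed.

Lemma gerstewitz_lt0_interior z : gerstewitz z < 0 -> interior K (- z).
Proof.
move=> z_lt0; have gap : 0 < - gerstewitz z by rewrite oppr_gt0.
have [t Kt] := inf_adherent gap (gerstewitz_has_inf z); rewrite subrr => t0.
have nt : 0 < - t by lra.
apply/nbhs_normP; exists (- t * rho); first by rewrite /= mulr_gt0.
move=> y; rewrite /= -opprD normrN addrC => yz.
have -> : y = (t *: e - z) + (- t) *: (e + (- t)^-1 *: (y + z)).
  rewrite scalerDr scalerA divff ?gt_eqF// scale1r scaleNr addrACA subrr add0r.
  by rewrite addrC addrK.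
apply: cone_add => //; apply: (K_cone (ltW nt)).
by apply: e_interior; rewrite ltW// normrZ normfV (gtr0_norm nt) ltr_pdivrMl.
Qed.

Lemma dual_cone_of_gerstewitz_minorant (zst : Z -> R) :
  clin zst -> (forall z, zst z <= gerstewitz z) -> dual_cone K zst /\ zst e = 1.
Proof.
move=> zst_clin zst_le; have lzst := zst_clin.1; split.
  split=> // z Kz; rewrite -oppr_le0 -(scalarN _ lzst); apply: le_trans (zst_le _) _.
  by apply: gerstewitz_le; rewrite scale0r opprK add0r.
have K0 : K 0 by have := cone_absorbs 0; rewrite normr0 mulr0 scale0r subr0.
apply/eqP; rewrite eq_le; apply/andP; split.
  by apply: le_trans (zst_le e) (gerstewitz_le _); rewrite scale1r subrr.
rewrite -lerN2 -(scalarN _ lzst); apply: le_trans (zst_le _) (gerstewitz_le _).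
by rewrite scaleN1r subrr.
Qed.

End Gerstewitz.

Lemma scalarization_exists {R : realType} {Z : normedModType R} (K : set Z) (e : Z) :
  cvx_set K -> is_cone K -> interior K e -> ~ K (- e) ->
  exists (phi : Z -> R) (c : R),
  [/\ 0 <= c /\ (forall z, phi z <= c * `|z|), sublinear phi,
      forall z, phi z < 0 -> interior K (- z) &
      forall zst, clin zst -> (forall z, zst z <= phi z) ->
        dual_cone K zst /\ zst e = 1].
Proof.
move=> K_cvx K_cone /nbhs_exists_cball[rho rho_gt0 e_ball] opp_e_notin.
exists (gerstewitz K e), (2 / rho); split.
- by split=> [|z]; [rewrite divr_ge0// ltW|exact: gerstewitz_bound].
- exact: gerstewitz_sublinear rho_gt0 _ _.
- by move=> z; exact: gerstewitz_lt0_interior rho_gt0 _ _ _.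
- by move=> zst; exact: dual_cone_of_gerstewitz_minorant rho_gt0 _ _ zst.
Qed.

Lemma opp_interior_notin {R : realType} {Z : normedModType R} (K : set Z) (e : Z) :
  pointed K -> interior K e -> ~ interior K 0 -> ~ K (- e).
Proof.
by move=> K_pt Ke nK0 KNe; apply: nK0; rewrite -(K_pt e (interior_subset Ke) KNe).
Qed.

Lemma coderivN_of_normals {R : realType} {X Y : normedModType R} (F : X -> set Y)
    (x : X) (y : Y) (xs : X -> R) (ys : Y -> R)
    (w : nat -> X * Y) (nu : nat -> X * Y -> R) :
  clin xs -> clin ys -> (forall k, graph F (w k)) -> w @ \oo --> ((x, y) : X * Y) ->
  (forall k, fnormal (graph F) (w k) (nu k)) ->
  (forall u, (fun k => nu k (u, 0)) @ \oo --> xs u) ->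
  (forall v, (fun k => nu k (0, v)) @ \oo --> - ys v) -> coderivN F x y ys xs.
Proof.
move=> xs_clin ys_clin w_graph w_cvg nuN nu_xs nu_ys; split.
  exact: clin_pair xs_clin (clin_opp ys_clin).
exists w, nu; do 3![split=> //] => q.
have -> : (fun k => nu k q) = (fun k => nu k (q.1, 0) + nu k (0, q.2)).
  by apply/funext => k; exact: scalar_pairE _ (fnormal_scalar (nuN k)).
by apply: cvgD; [exact: nu_xs|exact: nu_ys].
Qed.

Section ConstrainedProblem.
Context {R : realType} {X Y Z : completeNormedModType R}.
Local Notation cball := (closed_ball_ Num.norm).
Variables (h : X -> Z) (F : X -> set Y) (xbar : X) (phi : Z -> R) (L c0 : R).
Hypotheses (L_ge0 : 0 <= L) (c0_ge0 : 0 <= c0).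
Hypothesis phi_sub : sublinear phi.
Hypothesis phi_le : forall z, phi z <= c0 * `|z|.

Hypotheses (X_asplund : asplund X) (Y_asplund : asplund Y) (Z_asplund : asplund Z).
Hypothesis h_strict : strictly_lipschitz h xbar.
Hypothesis F_closed : closed (graph F).
Hypothesis F_xbar : F xbar 0.

Section PenalizedProblem.
Variables (c rho : R).
Hypotheses (c_ge0 : 0 <= c) (rho_gt0 : 0 < rho).
Hypothesis h_lip : L.-lipschitz_(cball xbar rho) h.
Hypothesis penalized_min : forall x y, cball xbar rho x -> `|y| <= rho -> F x y ->
  0 <= phi (h x - h xbar) + c * `|y|.

Record approximate_multiplier (gam : R) := {
  multiplier_point : X;
  multiplier_pair : X * Y;
  multiplier_slope : X -> R;
  multiplier_weight : Z -> R;
  multiplier_normal : X * Y -> R;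
  multiplier_point_near : `|xbar - multiplier_point| < gam;
  multiplier_point_in_ball : `|xbar - multiplier_point| < rho;
  multiplier_pairP : graph F multiplier_pair;
  multiplier_pair_near : `|(xbar, 0) - multiplier_pair| < gam;
  multiplier_subgradient :
    scalarized_subgradient h multiplier_point multiplier_weight multiplier_slope;
  multiplier_normalP : fnormal (graph F) multiplier_pair multiplier_normal;
  multiplier_weight_scalar : scalar multiplier_weight;
  multiplier_weight_le : forall z, multiplier_weight z <= phi z + gam * `|z|;
  multiplier_slope_form : bounded_form (c0 * L + gam) multiplier_slope;
  multiplier_normal_form : bounded_form (c + gam) (fun y => multiplier_normal (0, y));
  multiplier_balance :
    forall u, `|multiplier_slope u + multiplier_normal (u, 0)| <= gam * `|u| }.

Definition multiplier_objective (q : (X * Z) * (X * Y)) : R :=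
  phi (- q.1.2) + c0 * L * `|q.1.1 - q.2.1| + c * `|q.2.2|.

Let c0L_ge0 : 0 <= c0 * L.
Proof. exact: mulr_ge0. Qed.

Lemma multiplier_objective_sublinear : sublinear multiplier_objective.
Proof.
apply: sublinearD; last first.
  apply: sublinearZ => //.
  apply: (sublinear_comp (l := fun q : (X * Z) * (X * Y) => q.2.2)) => //.
  exact: norm_sublinear.
apply: sublinearD; last first.
  apply: sublinearZ => //.
  apply: (sublinear_comp (l := fun q : (X * Z) * (X * Y) => q.1.1 - q.2.1)).
    exact: norm_sublinear.
  by move=> t q q'; rewrite /= scalerBr opprD addrACA.
apply: (sublinear_comp (l := fun q : (X * Z) * (X * Y) => - q.1.2)) => // t q q'.
by rewrite /= opprD scalerN.
Qed.

Lemma multiplier_objective_le q :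
  multiplier_objective q <= (c0 + 2 * (c0 * L) + c) * `|q|.
Proof.
have n11 := le_trans (norm_fst q.1) (norm_fst q).
have n12 := le_trans (norm_snd q.1) (norm_fst q).
have n21 := le_trans (norm_fst q.2) (norm_snd q).
have n22 := le_trans (norm_snd q.2) (norm_snd q).
have := phi_le (- q.1.2); have := ler_wpM2l c0_ge0 n12; rewrite normrN.
have := ler_wpM2l c_ge0 n22.
have := ler_wpM2l c0L_ge0 (le_trans (ler_normB q.1.1 q.2.1) (lerD n11 n21)).
by rewrite /multiplier_objective; lra.
Qed.

Lemma multiplier_objective_min a b : function_graph h a -> cball (xbar, h xbar) rho a ->
  graph F b -> cball (xbar, 0) rho b ->
  0 <= multiplier_objective ((xbar, h xbar) - a, (xbar, 0) - b).
Proof.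
case: a b => [u z] [v y]; rewrite /function_graph /graph /= => -> a_near Fvy b_near.
have u_near : cball xbar rho u := le_trans (norm_fst ((xbar, h xbar) - (u, h u))) a_near.
have v_near : cball xbar rho v := le_trans (norm_fst ((xbar, 0 : Y) - (v, y))) b_near.
have y_near : `|y| <= rho.
  by have := le_trans (norm_snd ((xbar, 0 : Y) - (v, y))) b_near; rewrite /= sub0r normrN.
have uvE : xbar - u - (xbar - v) = v - u by rewrite opprB addrC subrKA.
rewrite /multiplier_objective /= uvE sub0r normrN opprB.
have := penalized_min v_near y_near Fvy.
have := phi_sub.1 (h u - h xbar) (h v - h u); rewrite addrC subrKA.
have := ler_wpM2l c0_ge0 (@h_lip (v, u) (conj v_near u_near)).
by have := phi_le (h v - h u); rewrite /=; lra.
Qed.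

Lemma multiplier_estimates (nu : X * Z -> R) (mu : X * Y -> R) (g : R) :
  scalar nu -> scalar mu -> 0 <= g ->
  (forall u v, nu u + mu v <=
    multiplier_objective (u, v) + g * `|(u, v) : (X * Z) * (X * Y)|) ->
  [/\ forall z, - nu (0, z) <= phi z + g * `|z|,
      bounded_form (c0 * L + g) (fun u => nu (u, 0)),
      bounded_form (c + g) (fun y => mu (0, y)) &
      forall u, `|nu (u, 0) + mu (u, 0)| <= g * `|u|].
Proof.
move=> lnu lmu g0 le_obj; have [nu0 mu0] := (scalar0 lnu, scalar0 lmu).
have phi0 := sublinear0 phi_sub; split=> [z|||u0].
- have := le_obj (0, - z) 0; rewrite norm_pairx0 norm_pair0x normrN mu0.
  rewrite /multiplier_objective /= opprK subrr !normr0.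
  by rewrite (scalarN _ (scalar_pair0x lnu)); lra.
- apply: bounded_form_le => [|u]; first exact: scalar_pairx0.
  have := le_obj (u, 0) 0; rewrite !norm_pairx0 mu0.
  by rewrite /multiplier_objective /= oppr0 phi0 subr0 normr0; lra.
- apply: bounded_form_le => [|y]; first exact: scalar_pair0x.
  have := le_obj 0 (0, y); rewrite !norm_pair0x nu0.
  by rewrite /multiplier_objective /= oppr0 phi0 subr0 normr0; lra.
- apply: (bounded_form_le (f := fun u => nu (u, 0) + mu (u, 0)) _ _).2 => [a u v|u].
    by rewrite (scalar_pairx0 lnu) (scalar_pairx0 lmu); ring.
  have := le_obj (u, 0) (u, 0).
  rewrite /multiplier_objective /= oppr0 phi0 subrr !normr0.
  have : `|((u, 0), (u, 0)) : (X * Z) * (X * Y)| <= `|u|.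
    by apply: norm_pair_le; rewrite norm_pairx0.
  by move=> /(ler_wpM2l g0); lra.
Qed.

Lemma approximate_multiplier_exists (gam : R) :
  0 < gam -> $| approximate_multiplier gam |.
Proof.
move=> gam0; pose g := Num.min gam rho; have g0 : 0 < g by rewrite lt_min gam0.
have [g_gam g_rho] : g <= gam /\ g <= rho by rewrite /g !ge_min !lexx orbT.
have graph_closed := closed_setI_cball (w0 := (xbar, h xbar)) (@subset_refl _ _)
  (closed_graph_lipschitz (@closed_closed_ball_ _ _ xbar rho) L_ge0 h_lip).
have F_graph_closed : closed (graph F `&` cball (xbar, 0) rho).
  by apply: closedI => //; exact: closed_closed_ball_.
have bound_ge0 : 0 <= c0 + 2 * (c0 * L) + c by rewrite !addr_ge0// mulr_ge0.
have [[x z] [w [nu [mu [[zE x_near] [Fw w_near] nuN muN le_obj]]]]] :=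
  normals_at_decoupled_minimizer (asplund_prod X_asplund Z_asplund)
    (asplund_prod X_asplund Y_asplund) rho_gt0 graph_closed F_graph_closed
    multiplier_objective_sublinear bound_ge0 multiplier_objective_le erefl F_xbar
    multiplier_objective_min g0.
rewrite /function_graph /= in zE; rewrite {z}zE in nuN x_near.
have [lnu lmu] := (fnormal_scalar nuN, fnormal_scalar muN).
have [weight_le slope_form normal_form balance] :=
  multiplier_estimates lnu lmu (ltW g0) le_obj.
have {}x_near : `|xbar - x| < g.
  exact: le_lt_trans (norm_fst ((xbar, h xbar) - (x, h x))) x_near.
have in_ball := lt_le_trans x_near g_rho.
have gM t : 0 <= t -> g * t <= gam * t by move=> t0; exact: ler_wpM2r.
apply: squash; apply: (@Build_approximate_multiplier gam x w (fun u => nu (u, 0))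
  (fun z => - nu (0, z)) mu (lt_le_trans x_near g_gam) in_ball Fw
  (lt_le_trans w_near g_gam)
  (subgradient_of_graph_normal (cball_nbhs in_ball) L_ge0 h_lip nuN) muN
  (scalar_opp (scalar_pair0x lnu))) => [z|||u].
- by have := weight_le z; have := gM _ (normr_ge0 z); lra.
- by apply: bounded_formW slope_form; rewrite lerD2l.
- by apply: bounded_formW normal_form; rewrite lerD2l.
- exact: le_trans (balance u) (gM _ (normr_ge0 u)).
Qed.

Let C := 1 + c0 + c0 * L + c.

Let multiplier_bound_ge0 : 0 <= C.
Proof. by rewrite !addr_ge0. Qed.

Let multiplier_weight_form k (m : approximate_multiplier (harmonic k)) :
  bounded_form C (multiplier_weight m).
Proof.
apply: bounded_form_le => [|z]; first exact: multiplier_weight_scalar.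
apply: le_trans (multiplier_weight_le m z) _.
have := ler_wpM2r (normr_ge0 z) (harmonic_le1 (R := R) k).
have := mulr_ge0 (addr_ge0 c0L_ge0 c_ge0) (normr_ge0 z); have := phi_le z.
by rewrite /C; lra.
Qed.

Let multiplier_slope_formC k (m : approximate_multiplier (harmonic k)) :
  bounded_form C (multiplier_slope m).
Proof.
apply: bounded_formW (multiplier_slope_form m); have := harmonic_le1 (R := R) k.
by rewrite /C; move: c0_ge0 c_ge0; lra.
Qed.

Let multiplier_normal_formC k (m : approximate_multiplier (harmonic k)) :
  bounded_form C (fun y => multiplier_normal m (0, y)).
Proof.
apply: bounded_formW (multiplier_normal_form m); have := harmonic_le1 (R := R) k.
by rewrite /C; move: c0_ge0 c0L_ge0; lra.
Qed.

Lemma approximate_multipliers_cvg (m : forall k, approximate_multiplier (harmonic k)) :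
  exists2 psi : nat -> nat, {homo psi : j k / (j < k)%N} &
  exists zst xi nu, [/\
    [/\ bounded_form C zst, bounded_form C xi & bounded_form C nu],
    forall z, (fun k => multiplier_weight (m (psi k)) z) @ \oo --> zst z,
    forall u, (fun k => multiplier_slope (m (psi k)) u) @ \oo --> xi u &
    forall y, (fun k => multiplier_normal (m (psi k)) (0, y)) @ \oo --> nu y].
Proof.
have [phi1 mono1 [zst zst_form zst_cvg]] :=
  weak_star_subsequence Z_asplund (fun k => multiplier_weight_form (m k)).
have [phi2 mono2 [xi xi_form xi_cvg]] :=
  weak_star_subsequence X_asplund (fun k => multiplier_slope_formC (m (phi1 k))).
have [phi3 mono3 [nu nu_form nu_cvg]] :=
  weak_star_subsequence Y_asplund (fun k => multiplier_normal_formC (m (phi1 (phi2 k)))).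
exists (fun k => phi1 (phi2 (phi3 k))) => [j k /mono3/mono2/mono1//|].
exists zst, xi, nu; split=> // [z|u].
  exact: (cvg_subseq mono3 (cvg_subseq mono2 (zst_cvg z))).
exact: (cvg_subseq mono3 (xi_cvg u)).
Qed.

Lemma multiplier_of_penalized_minimizer : exists zst ys xi,
  [/\ clin zst /\ (forall z, zst z <= phi z), clin ys,
      lsubdiff (fun x => zst (h x)) xbar xi & coderivN F xbar 0 ys (fun u => - xi u)].
Proof.
pose m k := unsquash (approximate_multiplier_exists (harmonic_gt0 k)).
have [psi psi_mono [zst [xi [nu [[zst_form xi_form nu_form] zst_cvg xi_cvg nu_cvg]]]]] :=
  approximate_multipliers_cvg m.
have gam_cvg : (fun k => harmonic (psi k) : R) @ \oo --> (0 : R).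
  exact: cvg_subseq psi_mono cvg_harmonic.
have nu_clin := bounded_form_clin nu_form.
have point_cvg : (fun k => multiplier_point (m (psi k))) @ \oo --> xbar.
  apply: (cvg_of_dist_le (C := 1) (cvg_cst xbar) gam_cvg) => k.
  by rewrite mul1r distrC ltW//; exact: multiplier_point_near.
have pair_cvg : (fun k => multiplier_pair (m (psi k))) @ \oo --> ((xbar, 0) : X * Y).
  apply: (cvg_of_dist_le (C := 1) (cvg_cst _) gam_cvg) => k.
  by rewrite mul1r distrC ltW//; exact: multiplier_pair_near.
exists zst, (fun y => - nu y), xi; split.
- split=> [|z]; first exact: bounded_form_clin zst_form.
  have bound_cvg : (fun k => phi z + harmonic (psi k) * `|z|) @ \oo --> phi z.
    rewrite -[X in _ --> X]addr0 -(mul0r `|z|).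
    by apply: cvgD; [exact: cvg_cst|apply: cvgM => //; exact: cvg_cst].
  by apply: (le_cvg_to (zst_cvg z) bound_cvg) => k; exact: multiplier_weight_le.
- exact: clin_opp.
- exact: (limiting_subgradient X_asplund Z_asplund rho_gt0 L_ge0 multiplier_bound_ge0
    h_lip h_strict zst_form xi_form (fun k => multiplier_weight_form (m (psi k)))
    (fun k => multiplier_slope_formC (m (psi k)))
    (fun k => multiplier_point_in_ball (m (psi k))) point_cvg zst_cvg xi_cvg
    (fun k => multiplier_subgradient (m (psi k)))).
- apply: (coderivN_of_normals (clin_opp (bounded_form_clin xi_form)) (clin_opp nu_clin)
    (fun k => multiplier_pairP (m (psi k))) pair_cvg
    (fun k => multiplier_normalP (m (psi k)))) => [u|y]; last by rewrite opprK.
  apply: (cvg_of_dist_le (V := R^o) (C := `|u|) (cvgN (xi_cvg u)) gam_cvg) => k.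
  by rewrite opprK addrC mulrC; exact: multiplier_balance.
Qed.

End PenalizedProblem.

Section ExactPenalization.
Variables (r m : R).
Hypotheses (r_gt0 : 0 < r) (m_gt0 : 0 < m).
Hypothesis h_lip : L.-lipschitz_(cball xbar m) h.
Hypothesis h_min : forall x, cball xbar m x -> F x 0 -> 0 <= phi (h x - h xbar).
Hypothesis dist_solution_le : forall x, cball xbar m x ->
  (dist x [set x | F x 0%R] <= r%:E * dist (0%R : Y) (F x))%E.

(* Clarke's exact penalization, combined with the estimate on the distance to
   the solution set. *)
Lemma exact_penalty x y :
  cball xbar (m / (4 * (1 + r))) x -> `|y| <= m / (4 * (1 + r)) -> F x y ->
    0 <= phi (h x - h xbar) + c0 * L * r * `|y|.
Proof.
have r1 : 0 < 1 + r by have := r_gt0; lra.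
have m4 : m / (4 * (1 + r)) * (1 + r) = m / 4 by field; apply: lt0r_neq0.
move=> x_near y_near Fxy.
have rho0 : 0 < m / (4 * (1 + r)) by rewrite divr_gt0// mulr_gt0.
move: (m / (4 * (1 + r))) m4 rho0 x_near y_near => rho rho_m rho0 x_near y_near.
have rho_r : 0 < rho * r by rewrite mulr_gt0.
have y_r : r * `|y| <= rho * r by rewrite mulrC ler_pM2r.
have xm : cball xbar m x by move: x_near; rewrite /closed_ball_ /=; lra.
apply: (@ler_addgt0_mul _ _ _ (c0 * L)); first exact: mulr_ge0.
move=> eps eps0; pose tau := Num.min eps (m / 4).
have tau0 : 0 < tau by rewrite lt_min eps0 divr_gt0.
have [tau_eps tau_m] : tau <= eps /\ tau <= m / 4 by rewrite /tau !ge_min !lexx orbT.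
have dist_y : (dist (0%R : Y) (F x) <= `|y|%:E)%E.
  by apply: ereal_inf_lbound; exists y => //; rewrite sub0r normrN.
have dist_sol : (dist x [set x | F x 0%R] < (r * `|y| + tau)%:E)%E.
  apply: (le_lt_trans (dist_solution_le xm)).
  apply: (@le_lt_trans _ _ (r%:E * `|y|%:E)%E).
    by apply: lee_wpmul2l => //; rewrite lee_fin ltW.
  by rewrite -EFinM lte_fin ltrDl.
have [_ [u Fu <-]] := ereal_inf_lt dist_sol; rewrite lte_fin => xu.
have um : cball xbar m u.
  have := ler_normD (xbar - x) (x - u); rewrite subrKA.
  by move: x_near; rewrite /closed_ball_ /=; lra.
have := phi_sub.1 (h x - h xbar) (h u - h x); rewrite addrC subrKA.
have := h_min um Fu; have := phi_le (h u - h x).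
have := ler_wpM2l c0_ge0 (@h_lip (u, x) (conj um xm)); rewrite /= [`|u - x|]distrC.
have c0L : 0 <= c0 * L by rewrite mulr_ge0.
by have := ler_wpM2l c0L (ltW xu); have := ler_wpM2l c0L tau_eps; lra.
Qed.

Lemma multiplier_of_constrained_minimizer : exists zst ys xi,
  [/\ clin zst /\ (forall z, zst z <= phi z), clin ys,
      lsubdiff (fun x => zst (h x)) xbar xi & coderivN F xbar 0 ys (fun u => - xi u)].
Proof.
have r1 : 0 < 4 * (1 + r) by rewrite mulr_gt0// addr_gt0.
have in_ball : cball xbar (m / (4 * (1 + r))) `<=` cball xbar m.
  apply: cball_subset; rewrite subrr normr0 add0r ler_pdivrMr// ler_peMr ?(ltW m_gt0)//.
  by have := r_gt0; lra.
apply: (multiplier_of_penalized_minimizer (c := c0 * L * r) (rho := m / (4 * (1 + r)))).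
- by rewrite !mulr_ge0// ltW.
- exact: divr_gt0.
- by move=> u [/in_ball u1 /in_ball u2]; exact: h_lip.
- exact: exact_penalty.
Qed.

End ExactPenalization.
End ConstrainedProblem.

Theorem theorem4p2 (R : realType) (X Y Z P : completeNormedModType R)
  (K : set Z) (g : X -> P -> Z) (H : X -> P -> set Y) (M : set P)
  (xbar : X) (L : R) :
  asplund X -> asplund Y -> asplund Z -> asplund P ->
  closed K -> cvx_set K -> is_cone K -> pointed K -> interior K !=set0 ->
  M !=set0 -> 0 < L ->
  (* (1) g is L-strictly Lipschitz at xbar w.r.t. M *)
  (forall p, M p -> strictly_lipschitz (fun x => g x p) xbar /\
                    lipschitz_near (fun x => g x p) xbar L) ->
  (* (2) xbar is a weak solution w.r.t. M *)
  (forall p, M p -> solset H p xbar) ->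
  (forall p, M p -> exists2 eps : R, 0 < eps &
     forall x, ball xbar eps x -> solset H p x ->
       ~ (interior K) (- (g x p - g xbar p))) ->
  (* (3) metric subregularity-type estimate *)
  (exists r : R, 0 < r /\ exists V : set X, nbhs xbar V /\
     forall p x, M p -> V x ->
       (dist x (solset H p) <= r%:E * dist (0%R : Y) (H x p))%E) ->
  (* (4) closed graph and Lipschitz-like *)
  (forall p, M p -> closed (graph (fun x => H x p)) /\ lipschitz_like H (xbar, p) 0) ->
  forall (e : Z) (p : P), interior K e -> M p ->
    exists (zs : Z -> R) (ys : Y -> R),
      dual_cone K zs /\ zs e = 1 /\ clin ys /\
      exists (xs1 xs2 : X -> R),
        lsubdiff (fun x => zs (g x p)) xbar xs1 /\
        coderivN (fun x => H x p) xbar 0 ys xs2 /\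
        (forall x, xs1 x + xs2 x = 0).
Proof.
move=> X_asplund Y_asplund Z_asplund _ _ K_cvx K_cone K_pointed _ _ L_gt0 g_lip xbar_sol
  xbar_min [r [r_gt0 [V [V_nbhs V_dist]]]] H_closed e p Ke Mp.
have [g_strict [N [N_nbhs N_lip]]] := g_lip p Mp.
have [eps eps_gt0 eps_min] := xbar_min p Mp.
have opp_e_notin : ~ K (- e).
  apply: (opp_interior_notin K_pointed Ke).
  by have := eps_min xbar (ballxx _ eps_gt0) (xbar_sol p Mp); rewrite subrr oppr0.
have [phi [c0 [[c0_ge0 phi_le] phi_sub phi_lt0 phi_minorant]]] :=
  scalarization_exists K_cvx K_cone Ke opp_e_notin.
have [m m_gt0 m_ball] :=
  nbhs_exists_cball (filterI N_nbhs (filterI V_nbhs (nbhsx_ballx xbar eps eps_gt0))).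
have [|x m_x x_sol|x /m_ball[_ [Vx _]]|zs [ys [xi [[zs_clin zs_le] ys_clin ? ?]]]] :=
  multiplier_of_constrained_minimizer (ltW L_gt0) c0_ge0 phi_sub phi_le
    X_asplund Y_asplund Z_asplund g_strict (H_closed p Mp).1 (xbar_sol p Mp) r_gt0 m_gt0.
- by move=> [x u] [/m_ball[Nx _] /m_ball[Nu _]]; exact: N_lip.
- have [_ [_ x_near]] := m_ball x m_x.
  by rewrite leNgt; apply/negP => /phi_lt0; exact: eps_min.
- exact: V_dist.
have [zs_dual zs_e] := phi_minorant zs zs_clin zs_le.
exists zs, ys; do 3![split=> //]; exists xi, (fun u => - xi u).
by do 2![split=> //]; move=> x; rewrite subrr.
Qed.
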